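(* Assume that the matrix $K\in\mathbb{R}^{n\times n}$ is invertible. Define $\tau:[0,1]\to[0,\infty)$ and $\kappa:[0,1]\to[0,1]$ by $$\tau(\zeta):=\int_0^\zeta\lambda_0(\eta)^{-1}\,\mathrm{d}\eta,\qquad \kappa(\zeta):=1-\tau(\zeta)\tau(1)^{-1},$$ and define the matrices $$A_d:=-K^{-1}L,\quad B_{1,d}:=-K^{-1}E,\quad B_{2,d}:=-K^{-1}\begin{pmatrix}0\\ I\end{pmatrix},$$ $$C_{1,d}:=K_zK^{-1}L-L_z,\quad C_{2,d}:=K_yK^{-1}L-L_y,\quad D_{11,d}:=K_zK^{-1}E,$$ $$D_{12,d}:=K_zK^{-1}\begin{pmatrix}0\\ I\end{pmatrix},\quad D_{21,d}:=K_yK^{-1}E,\quad D_{22,d}:=K_yK^{-1}\begin{pmatrix}0\\ I\end{pmatrix}.$$ Then the continuous-time system $$\frac{\partial x}{\partial t}(\zeta,t)=-\frac{\partial}{\partial\zeta}(\lambda_0(\zeta)x(\zeta,t)),\qquad x(\zeta,0)=x_0(\zeta),$$ $$Ed(t)+\begin{pmatrix}0\\ I\end{pmatrix}u(t)=-K\lambda_0(0)x(0,t)-L\lambda_0(1)x(1,t),$$ $$z(t)=-K_z\lambda_0(0)x(0,t)-L_z\lambda_0(1)x(1,t),$$ $$y(t)=-K_y\lambda_0(0)x(0,t)-L_y\lambda_0(1)x(1,t),$$ $\zeta\in[0,1]$, $t\ge0$, may be equivalently written as the discrete-time system $$x_d(j+1)(\zeta)=A_dx_d(j)(\zeta)+B_{1,d}d_d(j)(\zeta)+B_{2,d}u_d(j)(\zeta),$$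 $$x_d(0)(\kappa(\zeta))=\lambda_0(\zeta)x_0(\zeta),$$ $$z_d(j)(\zeta)=C_{1,d}x_d(j)(\zeta)+D_{11,d}d_d(j)(\zeta)+D_{12,d}u_d(j)(\zeta),$$ $$y_d(j)(\zeta)=C_{2,d}x_d(j)(\zeta)+D_{21,d}d_d(j)(\zeta)+D_{22,d}u_d(j)(\zeta),$$ for $j\in\mathbb{N}$ (with $0\in\mathbb{N}$) and $\zeta\in[0,1]$, where $x_d(j)\in L^2(0,1;\mathbb{R}^n)$, $d_d(j)\in L^2(0,1;\mathbb{R}^k)$, $u_d(j)\in L^2(0,1;\mathbb{R}^p)$, $z_d(j)\in L^2(0,1;\mathbb{R}^l)$, $y_d(j)\in L^2(0,1;\mathbb{R}^m)$, and the discrete-time and continuous-time variables are related by $$x_d(j)(\zeta)=f(j+\zeta)\ \ (j\ge1),$$ $$d_d(j)(\zeta)=d((j+\zeta)\tau(1)),\quad u_d(j)(\zeta)=u((j+\zeta)\tau(1)),$$ $$z_d(j)(\zeta)=z((j+\zeta)\tau(1)),\quad y_d(j)(\zeta)=y((j+\zeta)\tau(1))\ \ (j\in\mathbb{N}),$$ where $f$ is the function on $[0,\infty)$ given by $f(\kappa(\zeta)+\tau(1)^{-1}t)=\lambda_0(\zeta)x(\zeta,t)$ for $\zeta\in[0,1]$, $t\ge0$.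
   Context: Here $n,p,k,m,l\in\mathbb{N}$ and $\lambda_0\in L^\infty(0,1;\mathbb{R}^+)$ is a scalar function with $\lambda_0(\zeta)\ge\epsilon>0$ for a.e. $\zeta\in[0,1]$. The constant matrices are $E\in\mathbb{R}^{n\times k}$, $K,L\in\mathbb{R}^{n\times n}$, $K_y,L_y\in\mathbb{R}^{m\times n}$, $K_z,L_z\in\mathbb{R}^{l\times n}$, and $\begin{pmatrix}0\\ I\end{pmatrix}\in\mathbb{R}^{n\times p}$ has the $p\times p$ identity as its lower block. The state is $x(\cdot,t)\in X:=L^2(0,1;\mathbb{R}^n)$ with initial condition $x_0\in X$; the control input is $u\in L^2_{\mathrm{loc}}(0,\infty;\mathbb{R}^p)$, the disturbance is $d\in L^2_{\mathrm{loc}}(0,\infty;\mathbb{R}^k)$, the to-be-regulated output is $z(t)\in\mathbb{R}^l$ and the measured output is $y(t)\in\mathbb{R}^m$. Solutions of the continuous-time system are understood in the mild sense, the outputs being in $L^2_{\mathrm{loc}}$ (identities between $L^2$ functions hold almost everywhere). ''Equivalently written'' means that, under the stated relations between the variables, the continuous-time equations hold if and only if the discrete-time equations hold.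
   Formalization: Since the relations leave x_d(0) unlinked to f, the bare equivalence fails; it is proved with both initial conditions, x(ζ,0)=x_0(ζ) and x_d(0)(κ(ζ))=λ_0(ζ)x_0(ζ), required on each side, along with existence of related solutions in both directions. *)

(* Defs.v *)
(* MathComp-Analysis *)
From HB Require Import structures.
From mathcomp Require Import all_boot all_order all_algebra.
From mathcomp Require Import all_classical all_reals all_analysis.

Set Implicit Arguments.
Unset Strict Implicit.
Unset Printing Implicit Defensive.

Import Order.TTheory GRing.Theory Num.Theory.
Import numFieldNormedType.Exports.

Local Open Scope classical_set_scope.
Local Open Scope ring_scope.

Section Defs.
Context {R : realType}.

Notation mu := (@lebesgue_measure R).

(* Elements of L^2 and L^oo are represented by functions on all of R; only the
   values on the indicated set matter, and [f \_ D] is f extended by 0. *)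
Definition L2on (D : set R) {n : nat} (v : R -> 'cV[R]_n) : Prop :=
  forall i, (fun s => v s i 0) \_ D \in Lfun mu 2%:E.

Definition L2loc {n : nat} (v : R -> 'cV[R]_n) : Prop :=
  forall T, 0 < T -> L2on `[0, T] v.

Definition Linfty_on (D : set R) (a : R -> R) : Prop :=
  a \_ D \in Lfun mu +oo%E.

Definition ae_on (D : set R) (P : R -> Prop) : Prop :=
  {ae mu, forall s, D s -> P s}.

Definition vint (D : set R) {n : nat} (v : R -> 'cV[R]_n) : 'cV[R]_n :=
  \col_i \int[mu]_(s in D) v s i 0.

(* The inner product of X = L^2(0,1;R^n). *)
Definition ipX {n : nat} (v w : R -> 'cV[R]_n) : R :=
  \int[mu]_(s in `[0, 1]) \sum_i v s i 0 * w s i 0.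

(* w is (the continuous representative of) an element of H^1(0,1;R^n) with
   weak derivative v. *)
Definition H1_with_deriv {n : nat} (w v : R -> 'cV[R]_n) : Prop :=
  L2on `[0, 1] v /\
  forall zeta, zeta \in `[0, 1] -> w zeta = w 0 + vint `[0, zeta] v.

(* A state trajectory is a map [x : R -> R -> 'cV_n], [x zeta t] standing for
   x(zeta,t); its value x(.,t) in X is the slice [x^~ t], for t >= 0. *)
Definition state_in_X {n : nat} (x : R -> R -> 'cV[R]_n) : Prop :=
  forall t, 0 <= t -> L2on `[0, 1] (x^~ t).

(* t |-> x(.,t) is in C([0,oo);X). *)
Definition continuous_in_X {n : nat} (x : R -> R -> 'cV[R]_n) : Prop :=
  forall t, 0 <= t ->
    (fun s => ipX (fun zeta => x zeta s - x zeta t)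
                  (fun zeta => x zeta s - x zeta t))
      @ within [set s | 0 <= s] (nbhs t) --> (0 : R).

(* I is the X-valued integral of x(.,s) over 0 <= s <= t: for a continuous
   integrand, the Pettis integral below is the Bochner (or Riemann) one. *)
Definition integral_in_X {n : nat} (x : R -> R -> 'cV[R]_n) (t : R)
    (I : R -> 'cV[R]_n) : Prop :=
  L2on `[0, 1] I /\
  forall phi : R -> 'cV[R]_n, L2on `[0, 1] phi ->
    ipX phi I = \int[mu]_(s in `[0, t]) ipX phi (x^~ s).

(* The n x p block matrix (0; I), meaningful for p <= n. *)
Definition lower_id (n p : nat) : 'M[R]_(n, p) :=
  \matrix_(i, j) ((i == n - p + j :> nat)%N)%:R.

Definition ct_initial {n : nat} (x0 : R -> 'cV[R]_n)
    (x : R -> R -> 'cV[R]_n) : Prop :=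
  ae_on `[0, 1] (fun zeta => x zeta 0 = x0 zeta).

(* Mild solutions: x is in C([0,oo);X) and the equations hold after integration
   over [0,t], for every t >= 0. In particular lambda0 times the integral of
   the state is in H^1(0,1;R^n); w is its continuous representative, whose
   boundary values w 0 and w 1 are the integrals over [0,t] of
   lambda0(0) x(0,s) and lambda0(1) x(1,s). For x itself these traces need not
   make sense. *)
Definition ct_system {n p k m l : nat} (lambda0 : R -> R)
    (E : 'M[R]_(n, k)) (K L : 'M[R]_n) (Ky Ly : 'M[R]_(m, n))
    (Kz Lz : 'M[R]_(l, n)) (x0 : R -> 'cV[R]_n)
    (x : R -> R -> 'cV[R]_n) (d : R -> 'cV[R]_k) (u : R -> 'cV[R]_p)
    (z : R -> 'cV[R]_l) (y : R -> 'cV[R]_m) : Prop :=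
  [/\ continuous_in_X x,
      ct_initial x0 x &
      forall t, 0 <= t ->
        exists I w v : R -> 'cV[R]_n,
        [/\ integral_in_X x t I,
            H1_with_deriv w v /\
              ae_on `[0, 1] (fun zeta => w zeta = lambda0 zeta *: I zeta),
            ae_on `[0, 1] (fun zeta => x zeta t - x zeta 0 = - v zeta),
            E *m vint `[0, t] d + lower_id n p *m vint `[0, t] u
              = - (K *m w 0) - L *m w 1 &
            vint `[0, t] z = - (Kz *m w 0) - Lz *m w 1 /\
            vint `[0, t] y = - (Ky *m w 0) - Ly *m w 1]].

Definition tau (lambda0 : R -> R) (zeta : R) : R :=
  \int[mu]_(eta in `[0, zeta]) (lambda0 eta)^-1.

Definition kappa (lambda0 : R -> R) (zeta : R) : R :=
  1 - tau lambda0 zeta * (tau lambda0 1)^-1.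

Definition dt_initial {n : nat} (lambda0 : R -> R) (x0 : R -> 'cV[R]_n)
    (xd : nat -> R -> 'cV[R]_n) : Prop :=
  ae_on `[0, 1] (fun zeta =>
    xd 0%N (kappa lambda0 zeta) = lambda0 zeta *: x0 zeta).

Definition dt_system {n p k m l : nat} (lambda0 : R -> R)
    (Ad : 'M[R]_n) (B1 : 'M[R]_(n, k)) (B2 : 'M[R]_(n, p))
    (C1 : 'M[R]_(l, n)) (C2 : 'M[R]_(m, n))
    (D11 : 'M[R]_(l, k)) (D12 : 'M[R]_(l, p))
    (D21 : 'M[R]_(m, k)) (D22 : 'M[R]_(m, p)) (x0 : R -> 'cV[R]_n)
    (xd : nat -> R -> 'cV[R]_n) (dd : nat -> R -> 'cV[R]_k)
    (ud : nat -> R -> 'cV[R]_p) (zd : nat -> R -> 'cV[R]_l)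
    (yd : nat -> R -> 'cV[R]_m) : Prop :=
  dt_initial lambda0 x0 xd /\
  forall j : nat,
  [/\ ae_on `[0, 1] (fun zeta =>
        xd j.+1 zeta = Ad *m xd j zeta + B1 *m dd j zeta + B2 *m ud j zeta),
      ae_on `[0, 1] (fun zeta =>
        zd j zeta = C1 *m xd j zeta + D11 *m dd j zeta + D12 *m ud j zeta) &
      ae_on `[0, 1] (fun zeta =>
        yd j zeta = C2 *m xd j zeta + D21 *m dd j zeta + D22 *m ud j zeta)].

Definition ct_variables {n p k m l : nat}
    (x : R -> R -> 'cV[R]_n) (d : R -> 'cV[R]_k) (u : R -> 'cV[R]_p)
    (z : R -> 'cV[R]_l) (y : R -> 'cV[R]_m) : Prop :=
  [/\ state_in_X x, L2loc d, L2loc u, L2loc z & L2loc y].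

Definition dt_variables {n p k m l : nat}
    (xd : nat -> R -> 'cV[R]_n) (dd : nat -> R -> 'cV[R]_k)
    (ud : nat -> R -> 'cV[R]_p) (zd : nat -> R -> 'cV[R]_l)
    (yd : nat -> R -> 'cV[R]_m) : Prop :=
  forall j : nat,
  [/\ L2on `[0, 1] (xd j), L2on `[0, 1] (dd j), L2on `[0, 1] (ud j),
      L2on `[0, 1] (zd j) & L2on `[0, 1] (yd j)].

Definition sampled {q : nat} (T : R) (vd : nat -> R -> 'cV[R]_q)
    (v : R -> 'cV[R]_q) : Prop :=
  forall j : nat,
    ae_on `[0, 1] (fun zeta => vd j zeta = v ((j%:R + zeta) * T)).

Definition related {n p k m l : nat} (lambda0 : R -> R)
    (x : R -> R -> 'cV[R]_n) (d : R -> 'cV[R]_k) (u : R -> 'cV[R]_p)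
    (z : R -> 'cV[R]_l) (y : R -> 'cV[R]_m) (f : R -> 'cV[R]_n)
    (xd : nat -> R -> 'cV[R]_n) (dd : nat -> R -> 'cV[R]_k)
    (ud : nat -> R -> 'cV[R]_p) (zd : nat -> R -> 'cV[R]_l)
    (yd : nat -> R -> 'cV[R]_m) : Prop :=
  let T := tau lambda0 1 in
  [/\ L2loc f,
      forall t, 0 <= t -> ae_on `[0, 1] (fun zeta =>
        f (kappa lambda0 zeta + T^-1 * t) = lambda0 zeta *: x zeta t),
      forall j : nat, (1 <= j)%N ->
        ae_on `[0, 1] (fun zeta => xd j zeta = f (j%:R + zeta)),
      sampled T dd d /\ sampled T ud u &
      sampled T zd z /\ sampled T yd y].

End Defs.

(* Main.v *)
Require Import Defs.
From HB Require Import structures.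
From mathcomp Require Import all_boot all_order all_algebra.
From mathcomp Require Import all_classical all_reals all_analysis.
From mathcomp Require Import measurable_realfun ring lra.

Set Implicit Arguments.
Unset Strict Implicit.
Unset Printing Implicit Defensive.

Import Order.TTheory GRing.Theory Num.Theory.
Import numFieldNormedType.Exports.

Local Open Scope classical_set_scope.
Local Open Scope ring_scope.

(* In the coordinate r = kappa(zeta), which runs from 1 down to 0, and with time
   measured in units of T = tau(1), the flux lambda0 x is transported at unit
   speed, so that lambda0(zeta) x(zeta, t) = f(kappa(zeta) + t / T) for a single
   function f. If this holds, then by Fubini the continuous representative of
   lambda0 times the integral of x over [0, t] takes at zeta the value
   T int_{kappa(zeta)}^{kappa(zeta) + t / T} f, and the boundary equations,
   differentiated in t, become linear relations between f(1 + r), f(r) and the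
   signals at time r T. Solving them for f(1 + r) by means of K^-1 and cutting
   [0, oo) into unit intervals gives the discrete-time system.

   That a mild solution has this form is a uniqueness property of the integrated
   transport equation: Q(r, t) = int_0^r lambda0 x(., t T), taken in the
   coordinate kappa, satisfies Q(r, t) = alpha(r + t) - alpha(t), and f is the
   derivative of alpha. *)

(** * Square-integrable functions *)

(** A state in L^2 has neither boundary traces nor a time derivative, so uniqueness cannot be
    obtained by differentiating along characteristics. Testing the mild equation against indicators
    of [zeta, 1] integrates it once more in space: Q is then continuous in both variables, and
    alpha(t) is T^-1 times the flux through zeta = 1 integrated up to time t T. Increment estimates
    take the place of derivatives. Accordingly f is not produced by differentiating alpha: it is
    assembled from the states at integer multiples of T, and alpha serves to identify its primitive.
    As lambda0 is only measurable and bounded, kappa is merely bi-Lipschitz; its change of variables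
    is an equality of measures, checked on rays. Conversely, that a transported state is continuous
    in time with values in X is continuity of translations in L^2. The relation between the
    variables leaves xd 0 free; the two initial conditions together force it to agree with f on
    [0, 1]. *)

Section SquareIntegrable.
Context {R : realType}.
Local Notation mu := (@lebesgue_measure R).
Implicit Types (D : set R) (f g h : R -> R).

Lemma integrable_patch D f : measurable D ->
  mu.-integrable D (EFin \o f) <-> mu.-integrable setT (EFin \o (f \_ D)).
Proof.
move=> mD; have e : (EFin \o f) \_ D = EFin \o (f \_ D).
  by apply/funext => x; rewrite /= !patchE; case: ifPn.
by rewrite -e; exact: integrable_mkcond.
Qed.

(** Scalar counterpart of [L2on], which unfolds to it in each component. *)
Definition L2fun D h : Prop := h \_ D \in Lfun mu 2%:E.

Lemma L2funP D h : measurable D ->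
  L2fun D h <->
  measurable_fun D h /\ mu.-integrable D (EFin \o (fun s => h s ^+ 2)).
Proof.
move=> mD; split.
- move=> hD; have := hD; rewrite /L2fun inE => /andP[/[!inE]/= mh _].
  split; first exact: ((measurable_restrictT _ mD).2 mh).
  apply/integrable_patch => //; have := Lfun2_integrable_sqr hD.
  apply: (eq_integrable measurableT) => x _.
  by rewrite /= !patchE; case: ifPn => // _; rewrite expr0n.
- move=> [mh h2]; rewrite /L2fun inE; apply/andP; split.
    by rewrite inE /=; exact: (measurable_restrictT _ mD).1.
  rewrite inE/= /finite_norm unlock /Lnorm poweR_lty//.
  have /integrableP[_] := (integrable_patch _ mD).1 h2; apply: le_lt_trans.
  rewrite le_eqVlt; apply/orP; left; apply/eqP; apply: eq_integral => x _.
  rewrite /= !patchE /=; case: ifPn => _; first by rewrite powR_mulrn// normrX.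
  by rewrite normr0 powR0.
Qed.

Lemma integrable_dominated D f g : measurable D -> measurable_fun D f ->
  (forall x, D x -> `|f x| <= g x) ->
  mu.-integrable D (EFin \o g) -> mu.-integrable D (EFin \o f).
Proof.
move=> mD mf fg; apply: le_integrable => //; first exact/measurable_EFinP.
by move=> x Dx /=; rewrite lee_fin (le_trans (fg x Dx))// ler_norm.
Qed.

Lemma integrable_measurable D f :
  mu.-integrable D (EFin \o f) -> measurable_fun D f.
Proof. by move=> /integrableP[/measurable_EFinP]. Qed.

Lemma eq_integrableR D f g : measurable D -> (forall x, D x -> f x = g x) ->
  mu.-integrable D (EFin \o f) -> mu.-integrable D (EFin \o g).
Proof.
move=> mD fg; apply: eq_integrable => // x /set_mem Dx /=.
by rewrite fg.
Qed.

Lemma integrableDR D f g : measurable D -> mu.-integrable D (EFin \o f) ->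
  mu.-integrable D (EFin \o g) -> mu.-integrable D (EFin \o (fun x => f x + g x)).
Proof. by move=> mD fi gi; exact: (@integrableD _ _ R mu D _ _ _ fi gi). Qed.

Lemma integrableBR D f g : measurable D -> mu.-integrable D (EFin \o f) ->
  mu.-integrable D (EFin \o g) -> mu.-integrable D (EFin \o (fun x => f x - g x)).
Proof. by move=> mD fi gi; exact: (@integrableB _ _ R mu D _ _ _ fi gi). Qed.

Lemma integrableZR D f r : measurable D -> mu.-integrable D (EFin \o f) ->
  mu.-integrable D (EFin \o (fun x => r * f x)).
Proof. by move=> mD fi; exact: (@integrableZl _ _ R mu D _ r _ fi). Qed.

Lemma integrable_cstR D (r : R) : measurable D -> (mu D < +oo)%E ->
  mu.-integrable D (EFin \o (fun=> r)).
Proof.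
move=> mD muD; apply: measurable_bounded_integrable => //.
by exists `|r|; split; rewrite ?num_real// => y ry x _ /=; exact: ltW.
Qed.

Lemma L2fun_mul D f g : measurable D -> L2fun D f -> L2fun D g ->
  mu.-integrable D (EFin \o (fun x => f x * g x)).
Proof.
move=> mD /(L2funP _ mD)[mf f2] /(L2funP _ mD)[mg g2].
apply: (@integrable_dominated _ _ (fun x => f x ^+ 2 + g x ^+ 2)) => //.
- exact: measurable_funM.
- by move=> x _; rewrite ler_norml; apply/andP; split; nra.
- exact: integrableDR.
Qed.

Lemma L2fun_cst D (r : R) : measurable D -> (mu D < +oo)%E ->
  L2fun D (fun=> r).
Proof. by move=> mD fD; apply/L2funP => //; split => //; exact: integrable_cstR. Qed.

Lemma L2fun_integrable D f : measurable D -> (mu D < +oo)%E -> L2fun D f ->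
  mu.-integrable D (EFin \o f).
Proof.
move=> mD fD f2; have := L2fun_mul mD (L2fun_cst 1 mD fD) f2.
by apply: eq_integrableR => // x _; rewrite mul1r.
Qed.

Lemma L2fun_dominated D f g : measurable D -> measurable_fun D f ->
  (forall x, D x -> `|f x| <= `|g x|) -> L2fun D g -> L2fun D f.
Proof.
move=> mD mf fg /(L2funP _ mD)[mg g2]; apply/L2funP => //; split=> //.
apply: integrable_dominated g2 => //; first exact: measurable_funX.
move=> x Dx; rewrite normrX -[leRHS]real_normK ?num_real//.
by rewrite lerXn2r// ?nnegrE//; exact: fg.
Qed.

Lemma L2fun_le_sqr D f g : measurable D -> measurable_fun D f ->
  (forall x, D x -> `|f x| ^+ 2 <= g x) -> mu.-integrable D (EFin \o g) ->
  L2fun D f.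
Proof.
move=> mD mf fg gi; apply/L2funP => //; split => //.
apply: integrable_dominated gi => //; first exact: measurable_funX.
by move=> x Dx; rewrite normrX; exact: fg.
Qed.

Lemma L2fun_scale D f (r : R) : measurable D -> L2fun D f ->
  L2fun D (fun x => r * f x).
Proof.
move=> mD /(L2funP _ mD)[mf f2].
apply: (@L2fun_le_sqr _ _ (fun x => r ^+ 2 * f x ^+ 2)) => //.
- exact: measurable_funM.
- by move=> x _; rewrite normrM exprMn !real_normK ?num_real.
- exact: integrableZR.
Qed.

Lemma L2fun_add D f g : measurable D -> L2fun D f -> L2fun D g ->
  L2fun D (fun x => f x + g x).
Proof.
move=> mD /(L2funP _ mD)[mf f2] /(L2funP _ mD)[mg g2].
apply: (@L2fun_le_sqr _ _ (fun x => 2 * f x ^+ 2 + 2 * g x ^+ 2)) => //.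
- exact: measurable_funD.
- by move=> x _; rewrite real_normK ?num_real//; have := sqr_ge0 (f x - g x); nra.
- by apply: integrableDR => //; exact: integrableZR.
Qed.

Lemma L2fun_sub D f g : measurable D -> L2fun D f -> L2fun D g ->
  L2fun D (fun x => f x - g x).
Proof.
move=> mD fL gL; have := L2fun_add mD fL (L2fun_scale (-1) mD gL).
by congr L2fun; apply/funext => x; rewrite mulN1r.
Qed.

Lemma L2fun_boundedM D f g (M : R) : measurable D -> measurable_fun D f ->
  (forall x, D x -> `|f x| <= M) -> L2fun D g -> L2fun D (fun x => f x * g x).
Proof.
move=> mD mf fM gL; have [mg _] := (L2funP _ mD).1 gL.
apply: (@L2fun_dominated _ _ (fun x => M * g x)) => //.
- exact: measurable_funM.
- move=> x Dx; rewrite !normrM ler_wpM2r// (le_trans (fM _ Dx))//.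
  exact: ler_norm.
- exact: L2fun_scale.
Qed.

Lemma L2fun_sub_set D D' f : measurable D -> measurable D' -> D' `<=` D ->
  L2fun D f -> L2fun D' f.
Proof.
move=> mD mD' DD' /(L2funP _ mD)[mf f2]; apply/L2funP => //; split.
  exact: measurable_funS mf.
exact: integrableS f2.
Qed.

Lemma L2fun_sum D (I : finType) (F : I -> R -> R) : measurable D ->
  (mu D < +oo)%E ->
  (forall i, L2fun D (F i)) -> L2fun D (fun x => \sum_i F i x).
Proof.
move=> mD fD FD; rewrite /index_enum; elim: (Finite.enum I) => [|i s ih].
  have := L2fun_cst 0 mD fD; congr L2fun; apply/funext => x.
  by rewrite big_nil.
have := L2fun_add mD (FD i) ih; congr L2fun; apply/funext => x.
by rewrite big_cons.
Qed.

Lemma L2fun_eq D f g : {in D, f =1 g} -> L2fun D f -> L2fun D g.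
Proof.
move=> fg; rewrite /L2fun; suff -> : f \_ D = g \_ D by [].
by apply/funext => x; rewrite !patchE; case: ifPn => // xD; rewrite fg.
Qed.

End SquareIntegrable.

(** * Changes of variables *)

Section DensityMeasure.
Context {R : realType}.
Local Notation mu := (@lebesgue_measure R).
Variables (w : R -> R) (mw : measurable_fun setT w) (w0 : forall x, 0 <= w x).
Local Open Scope ereal_scope.

Definition density (A : set (measurableTypeR R)) : \bar R :=
  \int[mu]_(x in A) (w x)%:E.

Let density0 : density set0 = 0.
Proof. by rewrite /density integral_set0. Qed.

Let density_ge0 A : 0 <= density A.
Proof. by apply: integral_ge0 => x _; rewrite lee_fin. Qed.

Let density_sigma_additive :
  semi_sigma_additive density.
Proof.
apply: semi_sigma_additive_nng_induced => [|x]; last by rewrite lee_fin.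
exact/measurable_EFinP.
Qed.

HB.instance Definition _ := isMeasure.Build _ (measurableTypeR R) R density
  density0 density_ge0 density_sigma_additive.

Definition density_measure : {measure set (measurableTypeR R) -> \bar R} := density.

Import HBNNSimple.

Let integral_density_nnsfun (f : {nnsfun (measurableTypeR R) >-> R}) :
  \int[density_measure]_x (f x)%:E = \int[mu]_x ((w x)%:E * (f x)%:E).
Proof.
under [LHS]eq_integral do rewrite fimfunE -fsumEFin//.
rewrite [LHS]ge0_integral_fsum//; last 2 first.
  - by move=> r; exact/measurable_EFinP/measurableT_comp.
  - by move=> n x _; rewrite EFinM nnfun_muleindic_ge0.
under [RHS]eq_integral.
  move=> x xD; rewrite fimfunE -fsumEFin// ge0_mule_fsumr; last first.
    by move=> r; rewrite EFinM nnfun_muleindic_ge0.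
  over.
rewrite [RHS]ge0_integral_fsum//; last 2 first.
  - move=> r; apply/measurable_EFinP; apply: measurable_funM => //.
    by apply: measurable_funM.
  - move=> n x _; rewrite EFinM mule_ge0//; last by rewrite nnfun_muleindic_ge0.
    by rewrite lee_fin.
apply: eq_fsbigr => r _.
transitivity (\int[mu]_x (r%:E * ((w x)%:E * (\1_(f @^-1` [set r]) x)%:E))); last first.
  by apply: eq_integral => x _; rewrite EFinM muleCA.
have [r0|r0] := leP 0%R r; last first.
  rewrite preimage_nnfun0//.
  by rewrite !integral0_eq// => x _; rewrite indic0 ?mulr0 ?mule0 ?mul0e.
rewrite ge0_integralZl//; last 2 first.
  - apply: emeasurable_funM; first exact/measurable_EFinP.
    exact/measurable_EFinP.
  - by move=> x _; rewrite mule_ge0 ?lee_fin.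
rewrite integralZl_indic_nnsfun//; congr (_ * _).
rewrite integral_indic// setIT /= /density integral_mkcond.
apply: eq_integral => x _; rewrite patchE indicE.
by case: ifPn => _ /=; rewrite ?mule1 ?mule0.
Qed.

Lemma ge0_integral_density (f : R -> \bar R) :
  measurable_fun setT f -> (forall x, 0 <= f x) ->
  \int[density_measure]_x f x = \int[mu]_x ((w x)%:E * f x).
Proof.
move=> mf f0; have mT : measurable [set: measurableTypeR R] by [].
pose f_ := nnsfun_approx (mT : measurable [set: measurableTypeR R]) mf.
transitivity (lim (\int[density_measure]_x (f_ n x)%:E @[n --> \oo])).
  rewrite -monotone_convergence//=.
  - apply: eq_integral => ? /[!inE] xD; apply/esym/cvg_lim => //=.
    exact: cvg_nnsfun_approx.
  - by move=> n; exact/measurable_EFinP/measurable_funTS.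
  - by move=> n ? _; rewrite lee_fin.
  - by move=> ? _ ? ? mn; rewrite lee_fin; exact/lefP/nd_nnsfun_approx.
transitivity (lim (\int[mu]_x ((w x)%:E * (f_ n x)%:E) @[n --> \oo])).
  by apply: congr_lim; apply/funext => n /=; exact: integral_density_nnsfun.
rewrite -monotone_convergence//=.
- apply: eq_integral => x /[!inE] xD; apply: cvg_lim => //=.
  apply: cvgeZl => //.
  exact: cvg_nnsfun_approx.
- move=> n; apply: emeasurable_funM; first exact/measurable_EFinP.
  exact/measurable_EFinP.
- by move=> n x _; rewrite mule_ge0// lee_fin.
- move=> x _ i j ij; rewrite lee_wpmul2l ?lee_fin//.
  exact/lefP/nd_nnsfun_approx.
Qed.

End DensityMeasure.

Section ChangeOfVariables.
Context {R : realType}.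
Local Notation mu := (@lebesgue_measure R).
Variables (a b c d : R) (phi w : R -> R).
Hypotheses (cd : c <= d).
Hypotheses (mphi : measurable_fun `[a, b] phi) (mw : measurable_fun `[a, b] w).
Hypothesis w0 : forall x, a <= x <= b -> 0 <= w x.
Hypothesis phi_cd : forall x, a <= x <= b -> c <= phi x <= d.
Hypothesis w_total : (\int[mu]_(x in `[a, b]) (w x)%:E = (d - c)%:E)%E.
Hypothesis w_ray : forall y, c <= y <= d ->
  (\int[mu]_(x in `[a, b] `&` [set x | (phi x < y)%R]) (w x)%:E = (y - c)%:E)%E.

Let W := w \_ `[a, b].
Let mW : measurable_fun setT W.
Proof. exact: (measurable_restrictT _ _).1. Qed.
Let W0 x : 0 <= W x.
Proof. by rewrite /W patchE; case: ifPn => // /[!inE] /=; rewrite in_itv/=; exact: w0. Qed.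
(** Outside [a, b] this takes the value 0, which may lie in [c, d]; the density [W] vanishes there,
    so the pushforward does not see it. *)
Let Phi := phi \_ `[a, b].
Let mPhi : measurable_fun setT Phi.
Proof. exact: (measurable_restrictT _ _).1. Qed.

Let one_cd : R -> R := \1_(`[c, d]%classic).
Let mone : measurable_fun setT one_cd.
Proof. exact: measurable_indic. Qed.
Let one0 x : 0 <= one_cd x.
Proof. by rewrite /one_cd. Qed.

Let nu1 : {measure set (measurableTypeR R) -> \bar R} := density_measure mone one0.
Let nu2 : {measure set (measurableTypeR R) -> \bar R} :=
  measure_function_pushforward__canonical__measure_function_Measure
    (density_measure mW W0) (mPhi : measurable_fun [set: measurableTypeR R]
      (Phi : measurableTypeR R -> measurableTypeR R)).

Let nu2E A : measurable A ->
  (nu2 A = \int[mu]_(x in `[a, b] `&` [set x | A (phi x)]) (w x)%:E)%E.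
Proof.
move=> mA; rewrite /nu2 /pushforward /= /density [LHS]integral_mkcond [RHS]integral_mkcond.
apply: eq_integral => x _; rewrite !patchE.
case: ifPn => [/[!inE] /= h|/negP h].
  case: ifPn => [/[!inE] /= -[xab _]|/negP h']; first by rewrite /W patchE mem_set.
  rewrite /W patchE; case: ifPn => // xab; exfalso; apply: h'.
  rewrite inE; split; first by rewrite inE in xab.
  by move: h; rewrite /Phi patchE xab.
case: ifPn => // /[!inE] -[/= xab Ax]; exfalso; apply: h.
by rewrite inE /= /Phi patchE mem_set.
Qed.

Let nu1E A : measurable A -> nu1 A = mu (A `&` `[c, d]%classic).
Proof.
move=> mA; rewrite /nu1 /= /density /one_cd integral_indic//.
by rewrite setIC.
Qed.

(** The rays ]-oo, y[ form a generating pi-system on which [nu1] is finite, so agreement on them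
    suffices. Between c and d it is [w_ray]; beyond d all of [a, b] is counted, and up to c
    nothing. *)
Let nu1nu2 A : measurable A -> nu1 A = nu2 A.
Proof.
apply: (@measure_unique _ R (measurableTypeR R) (@RGenInftyO.G R)
  (fun n => `]-oo, n%:R[%classic) _ _ _ _ nu1 nu2).
- exact: RGenInftyO.measurableE.
- move=> _ _ [x ->] [y ->]; exists (Num.min x y).
  rewrite eqEsubset; split => z /=; rewrite !in_itv/= lt_min.
    by move=> [-> ->].
  by move=> /andP[].
- by move=> n; exists n%:R.
- rewrite -subTset => x _; exists (Num.truncn `|x|).+1 => //=.
  rewrite in_itv/= (le_lt_trans (ler_norm x))// truncnS_gt//.
- move=> _ [y ->]; have mI : measurable (`]-oo, y[%classic : set (measurableTypeR R)).
    exact: measurable_itv.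
  rewrite nu2E// nu1E//.
  have [yc|cy] := leP y c.
    rewrite [X in mu X](_ : _ = set0) ?measure0; last first.
      by rewrite -subset0 => x /= []; rewrite !in_itv/= => + /andP[]; lra.
    rewrite (_ : _ `&` _ = set0) ?integral_set0//.
    by rewrite -subset0 => x /= []; rewrite !in_itv/= => /phi_cd /andP[]; lra.
  have [yd|dy] := leP y d.
    rewrite [X in mu X](_ : _ = `[c, y[%classic); last first.
      rewrite eqEsubset; split => z /=; rewrite !in_itv/=.
        by move=> [-> /andP[->]].
      by move=> /andP[cz zy]; rewrite zy cz; split => //=; lra.
    rewrite lebesgue_measure_itv/= lte_fin cy -EFinB -w_ray; last first.
      by rewrite (ltW cy).
    by congr (integral _ _ _); apply/seteqP; split => x /=; rewrite in_itv.
  rewrite [X in mu X](_ : _ = `[c, d]%classic); last first.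
    rewrite eqEsubset; split => z /=; rewrite !in_itv/=.
      by move=> [_ /andP[-> ->]].
    by move=> /andP[cz zd]; rewrite zd cz; split => //=; lra.
  rewrite [X in integral _ X _](_ : _ = `[a, b]%classic); last first.
    apply/setIidPl => z /=; rewrite !in_itv/= => /phi_cd /andP[]; lra.
  rewrite lebesgue_measure_itv/= lte_fin w_total.
  case: ifPn => //; rewrite -leNgt => dc.
  by congr EFin; apply/esym/eqP; rewrite subr_eq0 eq_le cd dc.
- move=> k.
  have mI : measurable (`]-oo, k%:R[%classic : set (measurableTypeR R)).
    exact: measurable_itv.
  rewrite nu1E//.
  apply: (@le_lt_trans _ _ (mu `[c, d])).
    by apply: le_measure; rewrite ?inE//; exact: measurableI.
  by rewrite lebesgue_measure_itv/=; case: ifPn => _; rewrite ?ltry.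
Qed.

(** The intended [phi] is [kappa], which is only Lipschitz. Instead of differentiating it, the
    pushforward of [w dx] is compared with Lebesgue measure on [c, d]. *)
Lemma ge0_change_of_variables (g : R -> \bar R) : measurable_fun `[c, d] g ->
  (forall y, (c <= y <= d)%R -> 0 <= g y)%E ->
  (\int[mu]_(y in `[c, d]) g y = \int[mu]_(x in `[a, b]) ((w x)%:E * g (phi x)))%E.
Proof.
move=> mg g0; pose G := g \_ `[c, d].
have mG : measurable_fun setT G by exact: (measurable_restrictT _ _).1.
have G0 y : (0 <= G y)%E.
  by rewrite /G patchE; case: ifPn => // /[!inE] /=; rewrite in_itv/=; exact: g0.
transitivity (\int[nu1]_y G y)%E.
  rewrite ge0_integral_density// integral_mkcond; apply: eq_integral => y _.
  rewrite /one_cd /G patchE indicE; case: ifPn => _; last by rewrite mul0e.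
  by rewrite mul1e.
transitivity (\int[nu2]_y G y)%E.
  by apply: eq_measure_integral => A mA _; exact: nu1nu2.
rewrite /nu2 ge0_integral_pushforward//.
rewrite preimage_setT ge0_integral_density//; last 2 first.
  exact: measurableT_comp.
  by move=> x; exact: G0.
rewrite [RHS]integral_mkcond; apply: eq_integral => x _.
rewrite patchE /W /Phi /= !patchE; case: ifPn => xab; last by rewrite mul0e.
congr (_ * _)%E; rewrite /G patchE mem_set//= in_itv/=; apply: phi_cd.
by rewrite inE /= in_itv in xab.
Qed.

End ChangeOfVariables.

Section ChangeOfVariablesCorollaries.
Context {R : realType}.
Local Notation mu := (@lebesgue_measure R).

(** [w] stands for the absolute value of the derivative of [phi], which may reverse orientation, as
    [kappa] does. The integral rule is part of the predicate, so that affine maps, [kappa] and its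
    inverse share the corollaries below. *)
Definition substitution (a b c d : R) (phi w : R -> R) : Prop :=
  [/\ measurable_fun `[a, b] phi, measurable_fun `[a, b] w,
      forall x, a <= x <= b -> 0 < w x,
      forall x, a <= x <= b -> c <= phi x <= d &
      forall g : R -> \bar R, measurable_fun `[c, d] g ->
        (forall y, (c <= y <= d)%R -> 0 <= g y)%E ->
        (\int[mu]_(y in `[c, d]) g y =
         \int[mu]_(x in `[a, b]) ((w x)%:E * g (phi x)))%E].

Variables (a b c d : R) (phi w : R -> R).
Hypothesis sub : substitution a b c d phi w.

Lemma substitution_measurable (g : R -> R) : measurable_fun `[c, d] g ->
  measurable_fun `[a, b] (fun x => g (phi x)).
Proof.
case: sub => mphi mw w0 phi_cd _ mg.
apply: (measurable_comp (F := `[c, d]%classic)) => //.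
by move=> _ /= [x + <-]; rewrite !in_itv/=; exact: phi_cd.
Qed.

Lemma substitution_integrable (g : R -> R) : mu.-integrable `[c, d] (EFin \o g) ->
  mu.-integrable `[a, b] (EFin \o (fun x => w x * g (phi x))).
Proof.
case: (sub) => mphi mw w0 phi_cd cv gi; have mg := integrable_measurable gi.
have mgphi := substitution_measurable mg.
apply/integrableP; split.
  by apply/measurable_EFinP; apply: measurable_funM.
have /integrableP[_] := gi; rewrite cv//; last first.
  by apply/measurable_EFinP; exact: measurableT_comp.
apply: le_lt_trans; rewrite le_eqVlt; apply/orP; left; apply/eqP.
apply: eq_integral => x /[!inE] /= xab.
rewrite normrM EFinM ger0_norm// ltW// w0//.
Qed.

Let ge0_substitution_Rintegral (g : R -> R) :
  measurable_fun `[c, d] g -> (forall y, 0 <= g y) ->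
  \int[mu]_(y in `[c, d]) g y = \int[mu]_(x in `[a, b]) (w x * g (phi x)).
Proof.
case: (sub) => mphi mw w0 phi_cd cv mg g0; rewrite /Rintegral; congr fine.
rewrite cv//; first exact/measurable_EFinP.
by move=> y _; rewrite lee_fin.
Qed.

Lemma substitution_Rintegral (g : R -> R) : mu.-integrable `[c, d] (EFin \o g) ->
  \int[mu]_(y in `[c, d]) g y = \int[mu]_(x in `[a, b]) (w x * g (phi x)).
Proof.
move=> gi; have mg := integrable_measurable gi.
have ni : mu.-integrable `[c, d] (EFin \o (fun y => `|g y|)).
  exact: (integrable_norm gi).
(* g is the difference of the nonnegative functions |g| + g and |g|. *)
have gn : mu.-integrable `[c, d] (EFin \o (fun y => `|g y| + g y)).
  exact: integrableDR.
have := RintegralB (mu := mu) (measurable_itv _) gn ni.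
under eq_Rintegral do rewrite addrAC subrr add0r.
move=> ->; rewrite !ge0_substitution_Rintegral//; last 3 first.
- exact: integrable_measurable ni.
- exact: integrable_measurable gn.
- by move=> y; rewrite -lerBlDr sub0r -normrN ler_norm.
rewrite -RintegralB//; last 2 first.
- exact: substitution_integrable gn.
- exact: substitution_integrable ni.
by apply: eq_Rintegral => x _; rewrite mulrDr addrAC subrr add0r.
Qed.

(** The indicator of a null set N integrates to 0 over [c, d], so its pullback weighted by [w]
    vanishes almost everywhere; [w] being positive, [phi] almost never falls in N. *)
Lemma substitution_ae (P : R -> Prop) : ae_on `[c, d] P ->
  ae_on `[a, b] (fun x => P (phi x)).
Proof.
case: (sub) => mphi mw w0 phi_cd cv [N [mN N0 PN]].
have m1 : measurable_fun setT (EFin \o \1_N : R -> \bar R).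
  by apply/measurable_EFinP; exact: measurable_indic.
have h : (\int[mu]_(x in `[a, b]) ((w x)%:E * (EFin \o \1_N) (phi x)) = 0)%E.
  rewrite -(cv (EFin \o \1_N))//; first last.
    by move=> y _; rewrite /= lee_fin.
  - exact: measurable_funTS.
  - rewrite integral_indic//; apply: subset_measure0 N0 => //.
    by apply: measurableI.
have mwN : measurable_fun `[a, b] (fun x => ((w x)%:E * (EFin \o \1_N) (phi x))%E).
  apply/measurable_EFinP; apply: measurable_funM => //.
  by apply: substitution_measurable; exact: measurable_indic.
have /(ae_eq_integral_abs mu (measurable_itv _) mwN) :
    (\int[mu]_(x in `[a, b]) `|(w x)%:E * (EFin \o \1_N) (phi x)| = 0)%E.
  rewrite -[RHS]h; apply: eq_integral => x /[!inE] /= xab; rewrite in_itv in xab.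
  by rewrite ger0_norm// mulr_ge0// ltW// w0.
apply: filterS => x /= xN xab; have := xN xab => /eqP.
rewrite in_itv/= in xab.
rewrite -EFinM eqe mulf_eq0 gt_eqF ?w0//= indicE => xN'.
apply: contrapT => nP; have : N (phi x).
  by apply: PN => /= /(_ _); rewrite in_itv/= => /(_ (phi_cd _ xab)).
by move=> Nx; move: xN'; rewrite mem_set//= oner_eq0.
Qed.

(** The lower bound on the weight gives g(phi)^2 <= delta^-1 w g(phi)^2, and the right-hand side is
    integrable by substitution. *)
Lemma substitution_L2fun (delta : R) (g : R -> R) : 0 < delta ->
  (forall x, a <= x <= b -> delta <= w x) ->
  L2fun `[c, d] g -> L2fun `[a, b] (fun x => g (phi x)).
Proof.
move=> d0 dw /L2funP[]// mg g2.
apply: (L2fun_le_sqr (g := fun x => delta^-1 * (w x * g (phi x) ^+ 2))) => //.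
- exact: substitution_measurable.
- move=> x /=; rewrite in_itv/= => xab; rewrite real_normK ?num_real//.
  rewrite mulrA ler_peMl ?sqr_ge0// mulrC ler_pdivlMr// mul1r.
  exact: dw.
- by apply: integrableZR => //; exact: (substitution_integrable g2).
Qed.

End ChangeOfVariablesCorollaries.

Section Affine.
Context {R : realType}.

Lemma affine_substitution (a b r s : R) : a <= b -> 0 < r ->
  substitution a b (r * a + s) (r * b + s) (fun x => r * x + s) (fun=> r).
Proof.
move=> ab r0.
have mphi : measurable_fun setT (fun x => r * x + s).
  by apply: measurable_funD => //; exact: measurable_funM.
have phi_cd x : a <= x <= b -> r * a + s <= r * x + s <= r * b + s.
  by move=> /andP[ax xb]; rewrite !lerD2r !ler_pM2l// ax.
split => //; first exact: measurable_funTS.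
move=> g mg g0; apply: ge0_change_of_variables => //.
- by rewrite lerD2r ler_pM2l.
- exact: measurable_funTS.
- by move=> x _; exact: ltW.
- rewrite integral_cst//= lebesgue_measure_itv/= lte_fin.
  case: ltP => [_|ba]; first by rewrite -EFinB -EFinM; congr EFin; ring.
  by rewrite mule0 (_ : b = a) ?subrr//; apply/eqP; rewrite eq_le ba ab.
- move=> y /andP[ay yb].
  have -> : `[a, b] `&` [set x | r * x + s < y] = `[a, (y - s) / r[%classic.
    apply/seteqP; split => x /=; rewrite !in_itv/= ltr_pdivlMr// ltrBrDr (mulrC x).
      by move=> [/andP[-> _] ->].
    move=> /andP[ax xy]; rewrite ax; split; rewrite ?xy//=.
    rewrite -(ler_pM2l r0); lra.
  rewrite integral_cst//= lebesgue_measure_itv/= lte_fin.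
  rewrite ltr_pdivlMr//; case: ltP => [_|ba].
    rewrite -EFinB -EFinM; congr EFin; field; lra.
  by rewrite mule0; congr EFin; lra.
Qed.

End Affine.

(** * Primitives and continuous functions *)

Section Primitive.
Context {R : realType}.
Local Notation mu := (@lebesgue_measure R).
Implicit Types (a b c : R) (f h : R -> R).

Lemma lebesgue_itv_lty a b : (mu `[a, b] < +oo)%E.
Proof. by rewrite lebesgue_measure_itv/=; case: ifP => _; rewrite ?ltry. Qed.

Lemma integrable_subitv a b c d f : a <= c -> d <= b ->
  mu.-integrable `[a, b] (EFin \o f) -> mu.-integrable `[c, d] (EFin \o f).
Proof.
move=> ac db; apply: integrableS => //; apply: subset_itv => //.
Qed.

Lemma Rintegral_itv_cat a b c f : a <= b -> b <= c ->
  mu.-integrable `[a, c] (EFin \o f) ->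
  \int[mu]_(x in `[a, c]) f x =
  \int[mu]_(x in `[a, b]) f x + \int[mu]_(x in `[b, c]) f x.
Proof.
move=> ab bc fi; have := @Rintegral_itvB R f (BLeft a) (BRight c) b fi.
rewrite !bnd_simp => /(_ ab bc) /eqP.
rewrite subr_eq => /eqP ->; rewrite addrC; congr (_ + _).
rewrite Rintegral_itv_obnd_cbnd//; apply: integrableS fi => //.
by apply: subset_itv; rewrite bnd_simp.
Qed.

Lemma ae_onS (D : set R) (P Q : R -> Prop) :
  (forall x, D x -> P x -> Q x) -> ae_on D P -> ae_on D Q.
Proof.
move=> PQ; apply: (@filterS _ _ (ae_filter_ringOfSetsType mu)) => x Px Dx.
exact/PQ/Px.
Qed.

Lemma ae_onI (D : set R) (P Q : R -> Prop) :
  ae_on D P -> ae_on D Q -> ae_on D (fun x => P x /\ Q x).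
Proof.
apply: (@filterS2 _ _ (ae_filter_ringOfSetsType mu)) => x Px Qx Dx.
by split; [exact: Px|exact: Qx].
Qed.

Lemma ae_on_subset (D D' : set R) (P : R -> Prop) :
  D' `<=` D -> ae_on D P -> ae_on D' P.
Proof.
by move=> D'D; apply: (@filterS _ _ (ae_filter_ringOfSetsType mu)) => x Px /D'D; exact: Px.
Qed.

Lemma ae_on_T (D : set R) (P : R -> Prop) :
  (forall x, D x -> P x) -> ae_on D P.
Proof. by move=> DP; exact: aeW. Qed.

Lemma ae_on_itv_ends a b (P : R -> Prop) :
  ae_on `]a, b[ P -> ae_on `[a, b] P.
Proof.
move=> h; have ne c : ae_on setT (fun x => x != c).
  exists [set c]; split => //; first exact: lebesgue_measure_set1.
  by move=> x /= nx; apply: contrapT => xc; apply: nx => _; apply/eqP.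
have := ae_onI (ae_on_subset (@subsetT _ `[a, b]) (ne a))
  (ae_on_subset (@subsetT _ `[a, b]) (ne b)).
move: h; rewrite /ae_on.
apply: (@filterS2 _ _ (ae_filter_ringOfSetsType mu)) => x xP xab xI; have [xa xb] := xab xI; apply: xP.
move: xI => /=; rewrite !in_itv/= => /andP[ax xb'].
by rewrite !lt_neqAle ax xb' eq_sym xa xb.
Qed.

(** At a Lebesgue point the primitive has the value of the function as its derivative, and here the
    primitive is locally constant. *)
Lemma primitive_eq0_ae a b h : mu.-integrable `[a, b] (EFin \o h) ->
  (forall s, a <= s <= b -> \int[mu]_(x in `[a, s]) h x = 0) ->
  ae_on `[a, b] (fun s => h s = 0).
Proof.
move=> hi h0; pose H := h \_ `[a, b].
have lH : locally_integrable setT H by exact: integrable_locally.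
apply: ae_on_itv_ends; have := lebesgue_differentiation lH.
apply: (@filterS _ _ (ae_filter_ringOfSetsType mu)) => x xpt /=; rewrite in_itv/= => /andP[ax xb].
have Hi : mu.-integrable [set` Interval (BLeft a) (BRight b)] (EFin \o H).
  apply: eq_integrableR hi => // y yab; rewrite /H patchE mem_set//.
have [|dF F'] := @FTC1_lebesgue_pt R H (BLeft a) x b xb Hi _ xpt.
  by rewrite (@lte_fin R).
have F0 : {near x, (fun y => \int[mu]_(t in [set` Interval (BLeft a) (BRight y)]) H t) =1 cst 0}.
  near=> y; have yab : a <= y <= b.
    suff : y \in `]a, b[ by rewrite in_itv/= => /andP[/ltW -> /ltW].
    by near: y; apply: near_in_itvoo; rewrite in_itv/= ax.
  rewrite /= -(h0 y yab); apply: eq_Rintegral => t /[!inE] /=; rewrite in_itv/= => /andP[at' ty].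
  rewrite /H patchE mem_set//= in_itv/= at' (le_trans ty)//.
  by case/andP: yab.
have : H x = h x by rewrite /H patchE mem_set//= in_itv/= !ltW.
move=> <-; rewrite -F' derive1E (near_eq_derive _ F0)//.
by rewrite derive_cst.
Unshelve. all: by end_near.
Qed.

End Primitive.

Section RealFunctions.
Context {R : realType}.
Local Notation mu := (@lebesgue_measure R).

(** Explicit moduli of continuity are convenient, since they are combined by hand in the
    two-variable estimates below. *)
Definition cont_on (a b : R) (g : R -> R) : Prop :=
  forall x, a <= x <= b -> forall e : R, 0 < e -> exists2 d : R, 0 < d &
    forall y, a <= y <= b -> `|y - x| < d -> `|g y - g x| <= e.

Lemma cont_onP (a b : R) (g : R -> R) :
  cont_on a b g -> {within `[a, b], continuous g}.
Proof.
move=> gc; apply/subspace_continuousP => x /=; rewrite in_itv/= => xab.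
apply/cvgrPdist_le => e e0; have [d d0 xd] := gc _ xab _ e0.
exists d => // y /= xy; rewrite in_itv/= => yab.
by rewrite distrC; apply: xd => //; rewrite distrC.
Qed.

Lemma cont_on_integrable (a b : R) (g : R -> R) :
  cont_on a b g -> mu.-integrable `[a, b] (EFin \o g).
Proof.
move=> /cont_onP gc; apply: continuous_compact_integrable => //.
exact: segment_compact.
Qed.

Lemma cont_onS (a b c d : R) g : a <= c -> d <= b -> cont_on a b g -> cont_on c d g.
Proof.
move=> ac db gc x /andP[cx xd] e e0.
have [|del d0 h] := gc x _ e e0.
  by rewrite (le_trans ac cx) (le_trans xd db).
exists del => // y /andP[cy yd]; apply: h.
by rewrite (le_trans ac cy) (le_trans yd db).
Qed.

(** A quantitative fundamental theorem of calculus. It replaces differentiation of primitives in the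
    uniqueness proof, where the closed ranges of r and t would call for one-sided derivatives. *)
Lemma primitive_increment_le (N a b v e : R) (g : R -> R) :
  mu.-integrable `[0, N] (EFin \o g) -> 0 <= a -> a <= b -> b <= N ->
  (forall x, a <= x <= b -> `|g x - v| <= e) ->
  `|\int[mu]_(x in `[0, b]) g x - \int[mu]_(x in `[0, a]) g x - v * (b - a)|
    <= e * (b - a).
Proof.
move=> gi a0 ab bN gv.
have gab : mu.-integrable `[a, b] (EFin \o g) by exact: integrable_subitv gi.
rewrite (@Rintegral_itv_cat _ 0 a b)//; last exact: integrable_subitv gi.
rewrite (addrC (\int[mu]_(x in `[0, a]) _)) addrK.
have len c : \int[mu]_(x in `[a, b]) c = c * (b - a).
  rewrite Rintegral_cst//=.
  rewrite lebesgue_measure_itv/= lte_fin.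
  case: ltP => //= ba; rewrite (_ : b = a) ?subrr//.
  by apply/eqP; rewrite eq_le ba ab.
rewrite -len -RintegralB//; last exact: integrable_cstR (lebesgue_itv_lty _ _).
rewrite -len; apply: le_trans.
  apply: le_normr_Rintegral => //; apply: integrableBR => //.
  exact: integrable_cstR (lebesgue_itv_lty _ _).
apply: le_Rintegral => //.
- have : mu.-integrable `[a, b] (EFin \o (fun x => g x - v)).
    by apply: integrableBR => //; exact: integrable_cstR (lebesgue_itv_lty _ _).
  exact: integrable_norm.
- exact: integrable_cstR (lebesgue_itv_lty _ _).
Qed.

Lemma primitive_increment (N a b v e : R) (g : R -> R) :
  mu.-integrable `[0, N] (EFin \o g) -> 0 <= a <= N -> 0 <= b <= N ->
  (forall x, 0 <= x <= N -> `|x - a| <= `|b - a| -> `|g x - v| <= e) ->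
  `|\int[mu]_(x in `[0, b]) g x - \int[mu]_(x in `[0, a]) g x - v * (b - a)|
    <= e * `|b - a|.
Proof.
move=> gi /andP[a0 aN] /andP[b0 bN] gv; have [ab|/ltW ba] := leP a b.
  rewrite (ger0_norm (_ : 0 <= b - a)) ?subr_ge0//.
  apply: (primitive_increment_le gi) => // x /andP[ax xb].
  apply: gv; first by rewrite (le_trans a0 ax) (le_trans xb bN).
  by rewrite !ger0_norm ?subr_ge0// lerD2r.
rewrite [X in e * X]distrC (ger0_norm (_ : 0 <= a - b)) ?subr_ge0//.
rewrite (_ : _ - _ - _ = - (\int[mu]_(x in `[0, a]) g x -
  \int[mu]_(x in `[0, b]) g x - v * (a - b))); last by ring.
rewrite normrN; apply: (primitive_increment_le gi) => // x /andP[bx xa].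
apply: gv; first by rewrite (le_trans b0 bx) (le_trans xa aN).
rewrite distrC [leRHS]distrC !ger0_norm ?subr_ge0// lerD2l lerN2//.
Qed.

Lemma max_lipschitz (a x y : R) : `|Num.max a x - Num.max a y| <= `|x - y|.
Proof.
have h1 := ler_norm (x - y); have h2 := ler_norm (y - x).
rewrite (distrC y) in h2; rewrite ler_norml.
by case: (leP a x) => ?; case: (leP a y) => ?; apply/andP; split; lra.
Qed.

Lemma min_lipschitz (a x y : R) : `|Num.min a x - Num.min a y| <= `|x - y|.
Proof.
have h1 := ler_norm (x - y); have h2 := ler_norm (y - x).
rewrite (distrC y) in h2; rewrite ler_norml.
by case: (leP a x) => ?; case: (leP a y) => ?; apply/andP; split; lra.
Qed.

(** Precomposing [D] with the 1-Lipschitz clamp [cl] yields a function with zero derivative on the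
    whole line, endpoints included. *)
Lemma flat_cst (a b : R) (D : R -> R) : a <= b ->
  (forall s, a <= s <= b -> forall e : R, 0 < e -> exists2 d : R, 0 < d &
    forall s', a <= s' <= b -> `|s' - s| < d ->
      `|D s' - D s| <= e * `|s' - s|) ->
  D a = D b.
Proof.
move=> ab Dflat; pose cl s := Num.max a (Num.min b s).
have cl_in s : a <= cl s <= b.
  by rewrite /cl le_max lexx/= ge_max ab ge_min lexx.
have cl_lip s s' : `|cl s - cl s'| <= `|s - s'|.
  by apply: le_trans (max_lipschitz _ _ _) _; exact: min_lipschitz.
have dD (s : R) : is_derive s (1 : R) (D \o cl) 0.
  have h : h^-1 *: ((D \o cl) (h *: 1 + s) - (D \o cl) s) @[h --> 0^'] --> (0 : R).
    apply/cvgrPdist_le => e e0; have [d d0 sd] := Dflat _ (cl_in s) _ e0.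
    exists d => // h /=; rewrite !sub0r !normrN => hd h0.
    rewrite normrZ normfV ler_pdivrMl ?normr_gt0// mulrC.
    have -> : h *: 1 + s = h + s by rewrite -[h *: 1]/(h * 1) mulr1.
    have lip := cl_lip (h + s) s; rewrite addrK in lip.
    apply: le_trans (sd _ (cl_in _) (le_lt_trans lip hd)) _.
    by rewrite ler_pM2l.
  by split; [apply/cvg_ex; exists 0 | exact: cvg_lim h].
have := @is_derive_0_is_cst R (D \o cl) a b dD => /=.
have cla : cl a = a by rewrite /cl (min_idPr ab) maxxx.
have clb : cl b = b by rewrite /cl minxx (max_idPr ab).
by rewrite cla clb.
Qed.

Lemma integrable_normR (D : set R) (f : R -> R) :
  mu.-integrable D (EFin \o f) -> mu.-integrable D (EFin \o (fun x => `|f x|)).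
Proof. by move=> fi; exact: (integrable_norm fi). Qed.

Lemma Rintegral_itv_cst (a b c : R) : a <= b ->
  \int[mu]_(x in `[a, b]) c = c * (b - a).
Proof.
move=> ab; rewrite Rintegral_cst//= lebesgue_measure_itv/= lte_fin.
case: ltP => //= ba; rewrite (_ : b = a) ?subrr//.
by apply/eqP; rewrite eq_le ba ab.
Qed.

Lemma Rintegral_dist_le (a b e : R) (f g : R -> R) : a <= b ->
  mu.-integrable `[a, b] (EFin \o f) -> mu.-integrable `[a, b] (EFin \o g) ->
  (forall x, a <= x <= b -> `|f x - g x| <= e) ->
  `|\int[mu]_(x in `[a, b]) f x - \int[mu]_(x in `[a, b]) g x| <= e * (b - a).
Proof.
move=> ab fi gi fg; rewrite -RintegralB// -Rintegral_itv_cst//.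
have fgi : mu.-integrable `[a, b] (EFin \o (fun x => f x - g x)).
  exact: integrableBR.
apply: le_trans (le_normr_Rintegral _ _) _ => //.
apply: le_Rintegral => //; first exact: integrable_normR.
exact: integrable_cstR (lebesgue_itv_lty _ _).
Qed.

End RealFunctions.

(** * The integrated transport equation *)

Section TransportUniqueness.
Context {R : realType}.
Local Notation mu := (@lebesgue_measure R).

(* With [p r t = Q r t + alpha t], the integral of the 1-form p (dr + dt) from
   (0, 0) to (r, t) is path independent; hence it depends on [r + t] only, and so
   does [p]. *)
Lemma transport_uniqueness (Q : R -> R -> R) (alpha : R -> R) :
  (forall t : R, 0 <= t -> cont_on 0 1 (Q^~ t)) ->
  (forall t : R, 0 <= t -> forall e : R, 0 < e -> exists2 d : R, 0 < d &
    forall t' : R, 0 <= t' -> `|t' - t| < d ->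
      forall r : R, 0 <= r <= 1 -> `|Q r t' - Q r t| <= e) ->
  (forall t : R, 0 <= t -> Q 0 t = 0) ->
  (forall r t : R, 0 <= r <= 1 -> 0 <= t ->
    \int[mu]_(s in `[0, t]) Q r s =
    r * alpha t + \int[mu]_(rho in `[0, r]) (Q rho t - Q rho 0)) ->
  forall r t : R, 0 <= r <= 1 -> 0 <= t -> Q r t = alpha (r + t) - alpha t.
Proof.
move=> Qr Qt Q0 Qeq.
have Qtc (r N : R) : 0 <= r <= 1 -> cont_on 0 N (Q r).
  move=> r01 t /andP[t0 _] e e0; have [d d0 h] := Qt _ t0 _ e0.
  by exists d => // t' /andP[t'0 _] tt'; exact: h.
have Qri (t b : R) : 0 <= t -> b <= 1 -> mu.-integrable `[0, b] (EFin \o Q^~ t).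
  by move=> t0 b1; apply: cont_on_integrable; apply: cont_onS (Qr _ t0).
have i01 : (0 <= (1 : R) <= 1) by rewrite ler01 lexx.
have i00 : (0 <= (0 : R) <= 1) by rewrite lexx ler01.
have alpha0 : alpha 0 = 0.
  have := Qeq 1 0 i01 (lexx _); rewrite mul1r set_itv1 Rintegral_set1.
  under eq_Rintegral do rewrite subrr.
  by rewrite Rintegral_cst// mul0r addr0.
(* So far [alpha] is an arbitrary function; its continuity comes from the equation at r = 1, which
   expresses it through integrals of [Q]. *)
have alphat (t : R) : 0 <= t -> forall e : R, 0 < e -> exists2 d : R, 0 < d &
    forall t' : R, 0 <= t' -> `|t' - t| < d -> `|alpha t' - alpha t| <= e.
  move=> t0 e e0.
  have [d1 d10 h1] := Qt _ t0 _ (divr_gt0 e0 (ltr0n _ 2)).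
  have [d2 d20 h2] := Qt _ t0 _ ltr01.
  pose c := `|Q 1 t| + 1; have c0 : 0 < c by rewrite /c ltr_pwDr.
  (* Within [d2] the values of Q 1 stay within 1 of Q 1 t, so the time integral moves by at most c
     |t' - t|, hence by at most e / 2. The bound [d1] handles the space integral, and 1 keeps t'
     below t + 1. *)
  exists (Num.min d1 (Num.min (Num.min d2 1) (e / 2 / c))).
    by rewrite !lt_min d10 d20 ltr01 !divr_gt0.
  move=> t' t'0; rewrite !lt_min => /andP[dd1 /andP[/andP[dd2 dd3] dd4]].
  have aE (s : R) : 0 <= s -> alpha s = \int[mu]_(s in `[0, s]) Q 1 s -
      \int[mu]_(rho in `[0, 1]) (Q rho s - Q rho 0).
    by move=> s0; rewrite Qeq// mul1r addrK.
  rewrite (aE t')// (aE t)//.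
  have B1 : `|\int[mu]_(s in `[0, t']) Q 1 s - \int[mu]_(s in `[0, t]) Q 1 s| <= e / 2.
    have tt : 0 <= t <= t + 1 by lra.
    have tt' : 0 <= t' <= t + 1.
      by rewrite t'0/=; have := ler_norm (t' - t); lra.
    have := primitive_increment (cont_on_integrable (Qtc 1 (t + 1) i01)) tt tt'.
    move=> /(_ (Q 1 t) 1) h.
    have {}h := h _.
    have {h} : `|\int[mu]_(x in `[0, t']) Q 1 x - \int[mu]_(x in `[0, t]) Q 1 x -
         Q 1 t * (t' - t)| <= 1 * `|t' - t|.
      apply: h => x /andP[x0 xt] xtt; apply: h2 => //.
      exact: le_lt_trans dd2.
    rewrite ltr_pdivlMr// in dd4.
    set A := (X in `|X - _| <= _ -> _) => hA.
    have := ler_normD (A - Q 1 t * (t' - t)) (Q 1 t * (t' - t)).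
    rewrite subrK normrM => h3; move: hA dd4; rewrite /c mul1r; nra.
  have B2 : `|\int[mu]_(rho in `[0, 1]) (Q rho t' - Q rho 0) -
      \int[mu]_(rho in `[0, 1]) (Q rho t - Q rho 0)| <= e / 2.
    have i1 (s : R) : 0 <= s -> mu.-integrable `[0, 1] (EFin \o (fun rho => Q rho s - Q rho 0)).
      by move=> s0; apply: integrableBR => //; apply: Qri.
    apply: le_trans (Rintegral_dist_le (e := e / 2) ler01 (i1 _ t'0) (i1 _ t0) _) _.
      by move=> x x01; rewrite opprB addrA subrK; exact: h1.
    by rewrite subr0 mulr1.
  move: B1 B2; set A1 := \int[mu]_(_ in _) _; set A2 := \int[mu]_(_ in _) _.
  set A3 := \int[mu]_(_ in _) _; set A4 := \int[mu]_(_ in _) _ => B1 B2.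
  have -> : A1 - A3 - (A2 - A4) = (A1 - A2) - (A3 - A4) by ring.
  by apply: le_trans (ler_normB _ _) _; lra.
pose p r t := Q r t + alpha t.
have pt (t : R) : 0 <= t -> forall e : R, 0 < e -> exists2 d : R, 0 < d &
    forall t' : R, 0 <= t' -> `|t' - t| < d ->
      forall r : R, 0 <= r <= 1 -> `|p r t' - p r t| <= e.
  move=> t0 e e0; have [d1 d10 h1] := Qt _ t0 _ (divr_gt0 e0 (ltr0n _ 2)).
  have [d2 d20 h2] := alphat _ t0 _ (divr_gt0 e0 (ltr0n _ 2)).
  exists (Num.min d1 d2) => [|t' t'0]; first by rewrite lt_min d10.
  rewrite lt_min => /andP[tt1 tt2] r r01.
  have := h1 _ t'0 tt1 _ r01; have := h2 _ t'0 tt2.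
  rewrite /p; set A := alpha t' - _; set B := Q r t' - _ => hA hB.
  have -> : Q r t' + alpha t' - (Q r t + alpha t) = B + A by rewrite /A /B; ring.
  by apply: le_trans (ler_normD _ _) _; lra.
have prc (t : R) : 0 <= t -> cont_on 0 1 (p^~ t).
  move=> t0 r r01 e e0; have [d d0 h] := Qr _ t0 _ r01 _ e0.
  exists d => // r' r'01 rr'; rewrite /p.
  have -> : Q r' t + alpha t - (Q r t + alpha t) = Q r' t - Q r t by ring.
  exact: h.
have ptc (r N : R) : 0 <= r <= 1 -> cont_on 0 N (p r).
  move=> r01 t /andP[t0 _] e e0; have [d d0 h] := pt _ t0 _ e0.
  by exists d => // t' /andP[t'0 _] tt'; exact: h.
have pri (t b : R) : 0 <= t -> b <= 1 -> mu.-integrable `[0, b] (EFin \o p^~ t).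
  by move=> t0 b1; apply: cont_on_integrable; apply: cont_onS (prc _ t0).
have pti (r N : R) : 0 <= r <= 1 -> mu.-integrable `[0, N] (EFin \o p r).
  by move=> r01; apply: cont_on_integrable; exact: ptc.
have p0 (t : R) : 0 <= t -> p 0 t = alpha t by move=> t0; rewrite /p Q0// add0r.
pose Psi r t := \int[mu]_(rho in `[0, r]) p rho t + \int[mu]_(s in `[0, t]) p 0 s.
(* The two edge paths from (0, 0) to (r, t) give the same integral: this is the equation for [Q],
   rewritten for [p]. *)
have PsiE (r t : R) : 0 <= r <= 1 -> 0 <= t ->
    Psi r t = \int[mu]_(rho in `[0, r]) p rho 0 + \int[mu]_(s in `[0, t]) p r s.
  move=> r01 t0; have /andP[r0 r1] := r01.
  have E1 (s : R) : 0 <= s -> \int[mu]_(rho in `[0, r]) p rho s =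
      \int[mu]_(rho in `[0, r]) Q rho s + r * alpha s.
    move=> s0; rewrite /p RintegralD//; last 2 first.
    - exact: Qri.
    - exact: integrable_cstR (lebesgue_itv_lty _ _).
    by rewrite Rintegral_itv_cst// subr0 mulrC.
  have E2 : \int[mu]_(s in `[0, t]) p r s = \int[mu]_(s in `[0, t]) Q r s +
      \int[mu]_(s in `[0, t]) p 0 s.
    rewrite -RintegralD//; last 2 first.
    - by apply: cont_on_integrable; exact: Qtc.
    - exact: pti.
    apply: eq_Rintegral => s /[!inE] /=; rewrite in_itv/= => /andP[s0 _].
    by rewrite p0.
  rewrite /Psi E1// E1// E2 Qeq// RintegralB//; [|exact: Qri..].
  by rewrite alpha0; ring.
(* Moving along (r - s, t + s), the first-order terms of the two edge integrals are - v ds and v ds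
   with the same v; they cancel, so [Psi] is flat on this line. *)
have const (r t : R) : 0 <= r <= 1 -> 0 <= t -> Psi r t = Psi 0 (r + t).
  move=> /andP[r0 r1] t0; pose D s := Psi (r - s) (t + s).
  have -> : Psi r t = D 0 by rewrite /D subr0 addr0.
  have -> : Psi 0 (r + t) = D r by rewrite /D subrr addrC.
  apply: flat_cst => // s /andP[s0 sr] e e0.
  have e4 : 0 < e / 4 by lra.
  have x0 : 0 <= t + s by lra.
  have y01 : 0 <= r - s <= 1 by lra.
  have [d1 d10 h1] := pt _ x0 _ e4.
  have [d2 d20 h2] := prc _ x0 _ y01 _ e4.
  exists (Num.min d1 d2) => [|s' /andP[s'0 s'r]]; first by rewrite lt_min d10.
  rewrite lt_min => /andP[ss1 ss2].
  have x'0 : 0 <= t + s' by lra.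
  have y'01 : 0 <= r - s' <= 1 by lra.
  have close : `|p (r - s') (t + s) - p (r - s) (t + s)| <= e / 4.
    by apply: h2 => //; rewrite distrC (_ : _ - _ = s' - s)//; ring.
  pose v := p (r - s) (t + s).
  have /(_ _ _) K1 := @primitive_increment R (t + r) (t + s) (t + s') v (e / 2)
    (p (r - s')) (pti _ _ y'01).
  have {}K1 : `|\int[mu]_(x in `[0, t + s']) p (r - s') x -
      \int[mu]_(x in `[0, t + s]) p (r - s') x - v * (t + s' - (t + s))|
      <= e / 2 * `|t + s' - (t + s)|.
    apply: K1; [lra|lra|] => x /andP[xx0 _] xs.
    have := h1 _ xx0 (le_lt_trans xs _) _ y'01.
    have -> : t + s' - (t + s) = s' - s by ring.
    move=> /(_ ss1); move: close; rewrite -/v.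
    set A := p _ x; set B := p _ _ => c1 c2.
    have -> : A - v = (A - B) + (B - v) by ring.
    by apply: le_trans (ler_normD _ _) _; lra.
  have K2 : `|\int[mu]_(x in `[0, r - s']) p x (t + s) -
      \int[mu]_(x in `[0, r - s]) p x (t + s) - v * (r - s' - (r - s))|
      <= e / 2 * `|r - s' - (r - s)|.
    apply: (@primitive_increment R 1 _ _ v (e / 2)) => //; first exact: pri.
    move=> x x01 xs; apply: (@le_trans _ _ (e / 4)); last by lra.
    apply: h2 => //; apply: le_lt_trans xs _.
    by rewrite (_ : _ - _ = - (s' - s)) ?normrN//; ring.
  have e1 : t + s' - (t + s) = s' - s by ring.
  have e2 : r - s' - (r - s) = - (s' - s) by ring.
  rewrite e1 in K1; rewrite e2 normrN in K2.
  have P1 := PsiE _ _ y'01 x'0; have P2 := PsiE _ _ y'01 x0.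
  have P3 : Psi (r - s') (t + s) - Psi (r - s) (t + s) =
    \int[mu]_(x in `[0, r - s']) p x (t + s) - \int[mu]_(x in `[0, r - s]) p x (t + s).
    by rewrite /Psi; ring.
  have {}P1 : Psi (r - s') (t + s') - Psi (r - s') (t + s) =
    \int[mu]_(x in `[0, t + s']) p (r - s') x - \int[mu]_(x in `[0, t + s]) p (r - s') x.
    by rewrite P1 P2; ring.
  rewrite /D; rewrite -P1 in K1; rewrite -P3 in K2.
  have -> : Psi (r - s') (t + s') - Psi (r - s) (t + s) =
    (Psi (r - s') (t + s') - Psi (r - s') (t + s) - v * (s' - s)) +
    (Psi (r - s') (t + s) - Psi (r - s) (t + s) - v * - (s' - s)) by ring.
  apply: le_trans (ler_normD _ _) _; apply: le_trans (lerD K1 K2) _.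
  by rewrite -mulrDl -splitr.
move=> r t r01 t0; have /andP[r0 r1] := r01.
suff : `|p r t - alpha (r + t)| <= 0.
  by rewrite normr_le0 subr_eq0 => /eqP <-; rewrite /p addrK.
apply/ler_addgt0Pr => e e0; rewrite add0r.
have rt0 : 0 <= r + t by lra.
have [d1 d10 h1] := pt _ t0 _ (divr_gt0 e0 (ltr0n _ 2)).
have [d2 d20 h2] := alphat _ rt0 _ (divr_gt0 e0 (ltr0n _ 2)).
(* The increment Psi(r, t + h) - Psi(r, t) is close to h p(r, t) by [PsiE] and to h alpha(r + t) by
   [const]; both errors are at most h e / 2. *)
pose h := Num.min d1 d2 / 2.
have h0 : 0 < h by rewrite divr_gt0// lt_min d10.
have [hd1 hd2] : h < d1 /\ h < d2.
  have m1 : Num.min d1 d2 <= d1 by rewrite ge_min lexx.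
  have m2 : Num.min d1 d2 <= d2 by rewrite ge_min lexx orbT.
  by rewrite /h; split; lra.
have th0 : 0 <= t + h by lra.
have K1 := @primitive_increment_le R (t + h) t (t + h) (p r t) (e / 2) (p r) (pti _ _ r01) t0.
have {}K1 : `|\int[mu]_(x in `[0, t + h]) p r x - \int[mu]_(x in `[0, t]) p r x -
    p r t * (t + h - t)| <= e / 2 * (t + h - t).
  apply: K1; [lra|lra|] => x /andP[tx xh].
  by apply: h1 => //; [lra|rewrite ger0_norm; lra].
have K2 := @primitive_increment_le R (r + t + h) (r + t) (r + t + h) (alpha (r + t))
  (e / 2) (p 0) (pti _ _ i00) rt0.
have {}K2 : `|\int[mu]_(x in `[0, r + t + h]) p 0 x - \int[mu]_(x in `[0, r + t]) p 0 x -
    alpha (r + t) * (r + t + h - (r + t))| <= e / 2 * (r + t + h - (r + t)).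
  apply: K2; [lra|lra|] => x /andP[tx xh]; rewrite p0; last lra.
  by apply: h2 => //; [lra|rewrite ger0_norm; lra].
have C1 := const _ _ r01 t0; have C2 := const _ _ r01 th0.
rewrite PsiE// in C1; rewrite PsiE// in C2.
rewrite /Psi set_itv1 Rintegral_set1 add0r in C1.
rewrite /Psi set_itv1 Rintegral_set1 add0r addrA in C2.
rewrite -C1 -C2 in K2; move: K1 K2.
set A1 := \int[mu]_(_ in _) _; set A2 := \int[mu]_(_ in _) _.
set A3 := \int[mu]_(_ in _) _ => K1 K2.
have -> : p r t - alpha (r + t) =
    h^-1 * ((A3 + A1 - (A3 + A2) - alpha (r + t) * (r + t + h - (r + t))) -
            (A1 - A2 - p r t * (t + h - t))).
  by field; rewrite gt_eqF.
rewrite normrM gtr0_norm ?invr_gt0// ler_pdivrMl//.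
by apply: le_trans (ler_normB _ _) _; lra.
Qed.

End TransportUniqueness.

(** * Continuity of translations in L^2 *)

Section TranslationContinuity.
Context {R : realType}.
Local Notation mu := (@lebesgue_measure R).

Lemma continuous_uniform_itv (a b : R) (g : R -> R) : continuous g ->
  forall e : R, 0 < e -> exists2 d : R, 0 < d &
    forall x y : R, a <= x <= b -> `|y - x| < d -> `|g y - g x| <= e.
Proof.
move=> cg e e0; have cK := @segment_compact R a b.
have := cK; rewrite compact_near_coveringP => /(_ R (nbhs (0:R)^'+)
  (fun d x => forall y, `|y - x| < d -> `|g y - g x| <= e)) h.
have e2 : 0 < e / 2 by rewrite divr_gt0.
have {}h : \forall d \near (0:R)^'+, `[a, b]%classic `<=`
    (fun x => forall y, `|y - x| < d -> `|g y - g x| <= e).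
  apply: h => x _.
  have /cvgrPdist_lt/(_ _ e2)[d /= d0 gd] := cg x.
  exists (ball x (d / 2), [set r | r < d / 2]) => /=.
    split; first by exists (d / 2) => //=; rewrite divr_gt0.
    by apply: nbhs_right_lt; rewrite divr_gt0.
  move=> [x' r] /= [xx' rd] y yx'.
  have h1 : `|g x - g x'| < e / 2.
    by apply: gd => /=; apply: lt_trans xx' _; rewrite ltr_pdivrMr// ltr_pMr// ltr1n.
  have h2 : `|g x - g y| < e / 2.
    apply: gd => /=; rewrite [x - y](_ : _ = (x - x') + (x' - y)); last by ring.
    apply: le_lt_trans (ler_normD _ _) _; rewrite (distrC x').
    by rewrite (splitr d) ltrD// (lt_trans yx').
  rewrite [g y - g x'](_ : _ = (g x - g x') - (g x - g y)); last by ring.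
  by apply: le_trans (ler_normB _ _) _; rewrite (splitr e) ltW// ltrD.
have [d [hd d0]] := filter_ex (filterI h (nbhs_right_gt (0:R))).
by exists d => // x y xab yx; apply: (hd x) => //; rewrite /= in_itv.
Qed.

Let clip (N x : R) : R := Num.max (- N) (Num.min N x).

Let clip_le N x : 0 <= N -> `|clip N x| <= N.
Proof.
move=> N0; rewrite ler_norml /clip le_max lexx/= ge_max ge_min lexx/= andbT.
by rewrite (le_trans _ N0)// oppr_le0.
Qed.

Let clip_lip N x y : `|clip N x - clip N y| <= `|x - y|.
Proof. by apply: le_trans (max_lipschitz _ _ _) _; exact: min_lipschitz. Qed.

Let clip_id N x : `|x| <= N -> clip N x = x.
Proof. by rewrite ler_norml => /andP[h1 h2]; rewrite /clip (min_idPr h2) (max_idPr h1). Qed.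

Let clip_dist N x : 0 <= N -> `|x - clip N x| <= `|x|.
Proof.
move=> N0; rewrite /clip; have [Nx|xN] := leP N x.
  rewrite (max_idPr _); last by lra.
  by rewrite !ger0_norm; lra.
have [Nx|xN'] := leP (- N) x; first by rewrite subrr normr0.
by rewrite !ler0_norm; lra.
Qed.

(** Dominated convergence: the truncation error at a point vanishes once N exceeds |f|, and its
    square is at most f^2. *)
Lemma sqr_truncation (B : R) (f : R -> R) (e : R) : 0 < e ->
  L2fun `[0, B] f -> exists2 N : R, 0 < N &
    \int[mu]_(x in `[0, B]) (f x - clip N (f x)) ^+ 2 <= e.
Proof.
move=> e0 /L2funP[]// mf f2.
have mclip N : measurable_fun `[0, B] (fun x => clip N (f x)).
  by apply: measurable_maxr => //; apply: measurable_minr.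
pose F n x := ((f x - clip n%:R (f x)) ^+ 2)%:E.
have mF n : measurable_fun `[0, B] (F n).
  by apply/measurable_EFinP; apply: measurable_funX; exact: measurable_funB.
have [||||_ _ cvg0] := @dominated_convergence _ _ R mu `[0, B] _ F (cst 0%E)
    (EFin \o (fun x => f x ^+ 2)) mF _ _ f2 _ => //.
- apply: aeW => x _.
  apply: cvg_near_cst; near=> n.
  rewrite /F clip_id ?subrr ?expr0n//.
  near: n; exists (Num.truncn `|f x|).+1 => // n /= xn.
  by apply: le_trans (ltW (truncnS_gt _)) _; rewrite ler_nat.
- apply: aeW => x n _ /=; rewrite lee_fin ger0_norm ?sqr_ge0//.
  rewrite -[leLHS]real_normK ?num_real// -[leRHS]real_normK ?num_real//.
  by rewrite lerXn2r// ?nnegrE// clip_dist.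
move: cvg0; rewrite integral0 => /fine_cvgP[_ /cvgrPdist_le/(_ _ e0)].
move=> [n _ /(_ n.+1 (leqnSn n))] /=; rewrite sub0r normrN => h.
exists n.+1%:R => //; apply: le_trans h; exact: ler_norm.
Unshelve. all: by end_near.
Qed.

(** Density of continuous functions is used in L^1, for the truncated function. Clipping the
    approximant to [-N, N] bounds the difference by 2 N, which turns closeness in L^1 into closeness
    in L^2. *)
Lemma continuous_approx_sqr (B : R) (f : R -> R) (e : R) : 0 < e ->
  L2fun `[0, B] f -> exists2 g : R -> R, continuous g &
    mu.-integrable `[0, B] (EFin \o (fun x => (f x - g x) ^+ 2)) /\
    \int[mu]_(x in `[0, B]) (f x - g x) ^+ 2 <= e.
Proof.
move=> e0 fL; have [mf f2] := (L2funP f (measurable_itv `[0, B])).1 fL.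
have e4 : 0 < e / 4 by rewrite divr_gt0.
have [N N0 fN] := sqr_truncation e4 fL.
have mclip : measurable_fun `[0, B] (fun x => clip N (f x)).
  by apply: measurable_maxr => //; apply: measurable_minr.
have ci : mu.-integrable `[0, B] (EFin \o (fun x => clip N (f x))).
  apply: (@integrable_dominated _ _ _ (fun=> N)) => //.
    by move=> x _; rewrite clip_le// ltW.
  exact: integrable_cstR (lebesgue_itv_lty _ _).
have [G [cG iG]] := approximation_continuous_integrable (measurable_itv `[0, B]) (lebesgue_itv_lty _ _) ci.
(* The constants fit (f - g)^2 <= 2 (f - clip f)^2 + 4 N |clip f - G n|, where each term contributes
   e / 2. *)
have e4N : 0 < e / 4 / (2 * N) by rewrite !divr_gt0// mulr_gt0.
move=> /fine_cvgP[_ /cvgrPdist_le/(_ _ e4N)] [n _ /(_ n (leqnn n))] /=.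
rewrite sub0r normrN => hn.
pose g x := clip N (G n x).
have cg : continuous g.
  move=> x; apply/cvgrPdist_le => d d0.
  have /cvgrPdist_le/(_ _ d0) := cG n x; apply: filterS => y.
  exact: le_trans (clip_lip _ _ _).
have cn : mu.-integrable `[0, B] (EFin \o (fun x => `|clip N (f x) - G n x|)).
  by apply: integrable_normR; exact: integrableBR.
have mg : measurable_fun `[0, B] g.
  apply: measurable_funTS; exact: continuous_measurable_fun.
have gL : L2fun `[0, B] g.
  apply: (@L2fun_le_sqr _ _ _ (fun=> N ^+ 2)) => //.
    by move=> x _; rewrite lerXn2r ?nnegrE// ?clip_le// ltW.
  exact: integrable_cstR (lebesgue_itv_lty _ _).
have fcL : L2fun `[0, B] (fun x => f x - clip N (f x)).
  apply: (@L2fun_dominated _ _ _ f) => //; first exact: measurable_funB.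
  by move=> x _; apply: clip_dist; exact: ltW.
have [_ fgi] := (L2funP _ (measurable_itv `[0, B])).1 (L2fun_sub (measurable_itv `[0, B]) fL gL).
have [_ fci] := (L2funP _ (measurable_itv `[0, B])).1 fcL.
exists g => //; split=> //.
apply: (@le_trans _ _ (\int[mu]_(x in `[0, B]) (2 * (f x - clip N (f x)) ^+ 2 +
    2 * (2 * N) * `|clip N (f x) - G n x|))).
  apply: le_Rintegral => //; first by apply: integrableDR => //; exact: integrableZR.
  move=> x _.
  have h1 : `|clip N (f x) - g x| <= `|clip N (f x) - G n x|.
    rewrite -{1}[clip N (f x)](@clip_id N)//; first exact: clip_lip.
    by rewrite clip_le// ltW.
  have h2 : `|clip N (f x) - g x| <= 2 * N.
    apply: le_trans (ler_normB _ _) _; rewrite mulr_natl mulr2n.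
    by rewrite lerD// clip_le// ltW.
  have h3 : `|clip N (f x) - g x| ^+ 2 <= 2 * N * `|clip N (f x) - G n x|.
    by rewrite expr2 ler_pM.
  rewrite real_normK ?num_real// in h3.
  have := sqr_ge0 ((f x - clip N (f x)) - (clip N (f x) - g x)).
  move: h3; set a := clip N (f x); set b := g x; nra.
rewrite RintegralD//; [|exact: integrableZR..].
rewrite !RintegralZl//.
have {}hn : \int[mu]_(x in `[0, B]) `|clip N (f x) - G n x| <= e / 4 / (2 * N).
  exact: le_trans (ler_norm _) hn.
rewrite ler_pdivlMr ?mulr_gt0// in hn.
have aux (a b c d : R) : a <= d / 4 -> b * c <= d / 4 -> 2 * a + 2 * c * b <= d by lra.
exact: aux fN hn.
Qed.

Lemma shift_substitution (a b s : R) : a <= b ->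
  substitution a b (a + s) (b + s) (fun x => x + s) (fun=> 1).
Proof.
move=> ab; have := affine_substitution s ab ltr01; rewrite !mul1r.
by congr substitution; apply/funext => x; rewrite mul1r.
Qed.

Lemma Rintegral_subitv_le (a b c d : R) (h : R -> R) : a <= c -> c <= d -> d <= b ->
  (forall x, 0 <= h x) -> mu.-integrable `[a, b] (EFin \o h) ->
  \int[mu]_(x in `[c, d]) h x <= \int[mu]_(x in `[a, b]) h x.
Proof.
move=> ac cd db h0 hi; have ad := le_trans ac cd.
rewrite (@Rintegral_itv_cat _ a d b)//.
rewrite (@Rintegral_itv_cat _ a c d)//; last exact: integrable_subitv hi.
rewrite addrAC lerDr addr_ge0//; exact: Rintegral_ge0.
Qed.

Lemma L2fun_shift (a b s : R) (f : R -> R) : a <= b ->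
  L2fun `[a + s, b + s] f -> L2fun `[a, b] (fun x => f (x + s)).
Proof.
move=> ab; apply: (substitution_L2fun (shift_substitution s ab) ltr01) => x _.
exact: lexx.
Qed.

(** f is replaced by a continuous g close to it in L^2; g is uniformly continuous on [0, t + 2],
    which contains every translate of [0, 1] by at most t + 1. The 9 comes from (a + b + c)^2 <= 3
    (a^2 + b^2 + c^2), with three integrals of at most e / 9. *)
Lemma translation_continuity (f : R -> R) (t : R) : 0 <= t ->
  (forall B, L2fun `[0, B] f) -> forall e : R, 0 < e -> exists2 d : R, 0 < d &
  forall s : R, 0 <= s -> `|s - t| < d ->
    \int[mu]_(r in `[0, 1]) (f (r + s) - f (r + t)) ^+ 2 <= e.
Proof.
move=> t0 fL e e0; have e9 : 0 < e / 9 by rewrite divr_gt0.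
have [g cg [fgi fge]] := continuous_approx_sqr e9 (fL (t + 2)).
(* A number of absolute value at most 1 and at most e / 9 has a square of at most e / 9. *)
have b1 : 0 < Num.min 1 (e / 9) by rewrite lt_min ltr01.
have [d d0 gd] := @continuous_uniform_itv 0 (t + 2) g cg _ b1.
exists (Num.min d 1) => [|s s0]; first by rewrite lt_min d0 ltr01.
rewrite lt_min => /andP[sd s1].
have st : s <= t + 1 by have := ler_norm (s - t); lra.
pose h x := (f x - g x) ^+ 2.
have shift (q : R) : 0 <= q -> q <= t + 1 ->
    mu.-integrable `[0, 1] (EFin \o (fun r => h (r + q))) /\
    \int[mu]_(r in `[0, 1]) h (r + q) <= e / 9.
  move=> q0 qt; have sub := shift_substitution q (@ler01 R).
  have hi : mu.-integrable `[0 + q, 1 + q] (EFin \o h).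
    by apply: integrable_subitv fgi; lra.
  split.
    have := substitution_integrable sub hi; apply: eq_integrableR => // x _.
    by rewrite mul1r.
  have := substitution_Rintegral sub hi.
  under [in X in _ = X -> _]eq_Rintegral do rewrite mul1r.
  move=> <-; apply: le_trans fge.
  apply: Rintegral_subitv_le => //; [lra|lra|lra|].
  by move=> x; exact: sqr_ge0.
have [hs1 hs2] := shift s s0 st.
have tt : t <= t + 1 by rewrite lerDl.
have [ht1 ht2] := shift t t0 tt.
have fq (q : R) : 0 <= q -> L2fun `[0, 1] (fun r => f (r + q)).
  move=> q0; apply: L2fun_shift => //.
  by apply: L2fun_sub_set (fL (1 + q)) => //; apply: subset_itv; rewrite bnd_simp// add0r.
have [_ fst2] := (L2funP _ (measurable_itv `[0, 1])).1
  (L2fun_sub (measurable_itv `[0, 1]) (fq s s0) (fq t t0)).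
have hsum : mu.-integrable `[0, 1] (EFin \o (fun r => h (r + s) + h (r + t) + e / 9)).
  apply: integrableDR => //; first exact: integrableDR.
  exact: integrable_cstR (lebesgue_itv_lty _ _).
apply: (@le_trans _ _ (\int[mu]_(r in `[0, 1]) (3 * (h (r + s) + h (r + t) + e / 9)))).
  apply: le_Rintegral => //; first exact: integrableZR.
  move=> r; rewrite /= in_itv/= => /andP[r0 r1].
  have [] : `|g (r + s) - g (r + t)| <= 1 /\ `|g (r + s) - g (r + t)| <= e / 9.
    have : `|g (r + s) - g (r + t)| <= Num.min 1 (e / 9).
      apply: gd; first lra.
      by rewrite [X in `|X|](_ : _ = s - t)//; ring.
    by rewrite le_min => /andP.
  move=> g1 g9; have : `|g (r + s) - g (r + t)| ^+ 2 <= e / 9.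
    by apply: le_trans g9; rewrite expr2 ler_piMr.
  rewrite real_normK ?num_real// /h.
  set A := f (r + s); set B := f (r + t); set C := g (r + s); set D := g (r + t).
  have := sqr_ge0 ((A - C) - (C - D)); have := sqr_ge0 ((A - C) - (D - B)).
  have := sqr_ge0 ((C - D) - (D - B)); nra.
rewrite RintegralZl// RintegralD//; last 2 first.
- exact: integrableDR.
- exact: integrable_cstR (lebesgue_itv_lty _ _).
rewrite RintegralD// Rintegral_itv_cst//; lra.
Qed.

End TranslationContinuity.

(** * The coordinate kappa *)

Section TravelTime.
Context {R : realType}.
Local Notation mu := (@lebesgue_measure R).

Lemma EFin_Rintegral (D : set R) (f : R -> R) : measurable D ->
  mu.-integrable D (EFin \o f) ->
  (\int[mu]_(x in D) (f x)%:E)%E = (\int[mu]_(x in D) f x)%:E.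
Proof. by move=> mD fi; rewrite /Rintegral fineK//; exact: integrable_fin_num. Qed.

Variables (lambda : R -> R) (eps M : R).
Hypotheses (eps0 : 0 < eps) (mlambda : measurable_fun setT lambda).
Hypothesis lambda_bounds : forall x, eps <= lambda x <= M.

Let lambda_gt0 x : 0 < lambda x.
Proof. by have /andP[/(lt_le_trans eps0)] := lambda_bounds x. Qed.

Let M0 : 0 < M.
Proof. by have /andP[_] := lambda_bounds 0; apply: lt_le_trans. Qed.

Local Notation c := (fun x => (lambda x)^-1).
Local Notation T := (tau lambda 1).
Local Notation kap := (kappa lambda).

Lemma slowness_gt0 (x : R) : 0 < c x. Proof. by rewrite invr_gt0. Qed.

Lemma slowness_le (x : R) : c x <= eps^-1.
Proof. by rewrite lef_pV2// ?posrE//; have /andP[] := lambda_bounds x. Qed.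

Lemma slowness_ge (x : R) : M^-1 <= c x.
Proof. by rewrite lef_pV2// ?posrE//; have /andP[] := lambda_bounds x. Qed.

Lemma measurable_slowness : measurable_fun setT c.
Proof.
rewrite (_ : c = (fun x => lambda x `^ (-1))); last first.
  by apply/funext => x; rewrite powR_inv1// ltW.
exact: (measurableT_comp (measurable_powR _)).
Qed.

Lemma slowness_integrable (a b : R) : mu.-integrable `[a, b] (EFin \o c).
Proof.
apply: (@integrable_dominated _ _ _ (fun=> eps^-1)) => //.
- exact: measurable_funTS measurable_slowness.
- by move=> x _; rewrite gtr0_norm ?slowness_gt0// slowness_le.
- exact: integrable_cstR (lebesgue_itv_lty _ _).
Qed.

Lemma tau_incr (a b : R) : 0 <= a -> a <= b ->
  tau lambda b - tau lambda a = \int[mu]_(x in `[a, b]) c x.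
Proof.
move=> a0 ab; rewrite /tau (@Rintegral_itv_cat _ 0 a b)//; last exact: slowness_integrable.
by rewrite addrAC subrr add0r.
Qed.

Lemma tau_incr_le (a b : R) : 0 <= a -> a <= b ->
  M^-1 * (b - a) <= tau lambda b - tau lambda a <= eps^-1 * (b - a).
Proof.
move=> a0 ab; rewrite tau_incr// -!Rintegral_itv_cst//.
apply/andP; split; apply: le_Rintegral => //; try exact: slowness_integrable;
  try (by exact: integrable_cstR (lebesgue_itv_lty _ _)) => x _.
- by move=> x _; exact: slowness_ge.
- by move=> x _; exact: slowness_le.
Qed.

Lemma tau0 : tau lambda 0 = 0.
Proof. by rewrite /tau set_itv1 Rintegral_set1. Qed.

Lemma tau1_gt0 : 0 < T.
Proof.
have /andP[+ _] := tau_incr_le (lexx 0) ler01; rewrite tau0 !subr0 mulr1.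
by apply: lt_le_trans; rewrite invr_gt0.
Qed.

Lemma kappa0 : kap 0 = 1.
Proof. by rewrite /kappa tau0 mul0r subr0. Qed.

Lemma kappa1 : kap 1 = 0.
Proof. by rewrite /kappa divff ?subrr// gt_eqF// tau1_gt0. Qed.

(** The upper bound yields the continuity of [kappa], the lower one its injectivity and the
    continuity of its inverse. *)
Lemma kappa_decr (a b : R) : 0 <= a -> a <= b ->
  (M * T)^-1 * (b - a) <= kap a - kap b <= (eps * T)^-1 * (b - a).
Proof.
move=> a0 ab.
have -> : kap a - kap b = T^-1 * (tau lambda b - tau lambda a) by rewrite /kappa; ring.
have E d : (d * T)^-1 * (b - a) = T^-1 * (d^-1 * (b - a)) by rewrite invfM; ring.
by rewrite !E !ler_pM2l ?invr_gt0 ?tau1_gt0//; exact: tau_incr_le.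
Qed.

Lemma kappa_itv (x : R) : 0 <= x <= 1 -> 0 <= kap x <= 1.
Proof.
move=> /andP[x0 x1].
have /andP[h1 _] := kappa_decr x0 x1; have /andP[h2 _] := kappa_decr (lexx 0) x0.
rewrite kappa1 subr0 in h1; rewrite kappa0 subr0 in h2.
have MT : 0 <= (M * T)^-1 by rewrite invr_ge0 ltW// mulr_gt0// tau1_gt0.
apply/andP; split.
  by apply: le_trans h1; rewrite mulr_ge0// subr_ge0.
by rewrite -subr_ge0; apply: le_trans h2; rewrite mulr_ge0.
Qed.

Lemma kappa_cont : cont_on 0 1 kap.
Proof.
move=> x /andP[x0 x1] e e0; have k0 : 0 < eps * T by rewrite mulr_gt0// tau1_gt0.
exists (e * (eps * T)); first by rewrite mulr_gt0.
move=> y /andP[y0 y1] yx.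
have lip (a b : R) : 0 <= a -> a <= b -> `|kap a - kap b| <= (eps * T)^-1 * `|b - a|.
  move=> a0 ab; have /andP[h1 h2] := kappa_decr a0 ab.
  rewrite (ger0_norm (_ : 0 <= b - a)) ?subr_ge0// ger0_norm//.
  apply: le_trans h1; rewrite mulr_ge0 ?subr_ge0// invr_ge0 ltW// mulr_gt0//.
  exact: tau1_gt0.
suff : `|kap y - kap x| <= (eps * T)^-1 * `|y - x|.
  by move/le_trans; apply; rewrite ler_pdivrMl// mulrC ltW.
have [xy|/ltW yx'] := leP x y.
  by rewrite distrC; exact: lip.
by rewrite (distrC y); exact: lip.
Qed.

Lemma measurable_kappa (a b : R) : 0 <= a -> b <= 1 -> measurable_fun `[a, b] kap.
Proof.
move=> a0 b1; have := integrable_measurable (cont_on_integrable kappa_cont).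
by apply: measurable_funS => //; apply: subset_itv; rewrite bnd_simp.
Qed.

Definition kappa_inv (r : R) : R := xget 0 [set x | 0 <= x <= 1 /\ kap x = r].
Local Notation sigma := kappa_inv.

Lemma kappa_invP (r : R) : 0 <= r <= 1 -> 0 <= sigma r <= 1 /\ kap (sigma r) = r.
Proof.
move=> r01; rewrite /kappa_inv; case: xgetP => [x _ //|].
have [|x] := IVT (v := r) (@ler01 R) (cont_onP kappa_cont).
  by rewrite kappa0 kappa1 min_r// max_l.
by rewrite in_itv/= => x01 kx /(_ x)[]; split.
Qed.

Lemma kappa_inj (x y : R) : 0 <= x <= 1 -> 0 <= y <= 1 -> kap x = kap y -> x = y.
Proof.
have MT : 0 < (M * T)^-1 by rewrite invr_gt0 mulr_gt0// tau1_gt0.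
wlog xy : x y / x <= y.
  by move=> H x01 y01 kxy; have [|/ltW] := leP x y => h; [|symmetry]; exact: H.
move=> /andP[x0 x1] /andP[y0 y1] kxy.
have /andP[+ _] := kappa_decr x0 xy; rewrite kxy subrr pmulr_rle0// subr_le0 => yx.
by apply/eqP; rewrite eq_le xy.
Qed.

Lemma kappaK (x : R) : 0 <= x <= 1 -> sigma (kap x) = x.
Proof.
move=> x01; have [s01 ks] := kappa_invP (kappa_itv x01).
exact: kappa_inj.
Qed.

Lemma kappa_le (x y : R) : 0 <= x <= 1 -> 0 <= y <= 1 -> (kap x <= kap y) = (y <= x).
Proof.
have MT : 0 < (M * T)^-1 by rewrite invr_gt0 mulr_gt0// tau1_gt0.
move=> /andP[x0 x1] /andP[y0 y1]; have [yx|xy] := leP y x.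
  have /andP[h _] := kappa_decr y0 yx; apply/idP; rewrite -subr_ge0; apply: le_trans h.
  by rewrite mulr_ge0 ?subr_ge0// ltW.
apply/negbTE; rewrite -ltNge.
have /andP[h _] := kappa_decr x0 (ltW xy); rewrite -subr_gt0; apply: lt_le_trans h.
by rewrite mulr_gt0 ?subr_gt0.
Qed.

Lemma kappa_inv_cont : cont_on 0 1 sigma.
Proof.
have MT : 0 < M * T by rewrite mulr_gt0// tau1_gt0.
move=> x x01 e e0; exists (e / (M * T)); first by rewrite divr_gt0.
move=> y y01 yx.
have lip (a b : R) : 0 <= a <= 1 -> 0 <= b <= 1 -> sigma a <= sigma b ->
    `|sigma a - sigma b| <= (M * T) * `|a - b|.
  move=> a01 b01 ab; have [/andP[a0 a1] ka] := kappa_invP a01.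
  have [/andP[b0 b1] kb] := kappa_invP b01.
  have /andP[h _] := kappa_decr a0 ab; rewrite ka kb ler_pdivrMl// in h.
  rewrite distrC ger0_norm ?subr_ge0//; apply: le_trans h _.
  by rewrite ler_pM2l// ler_norm.
suff : `|sigma y - sigma x| <= M * T * `|y - x|.
  by move/le_trans; apply; rewrite mulrC -ler_pdivlMr// ltW.
have [xy|/ltW yx'] := leP (sigma x) (sigma y).
  by rewrite distrC (distrC y); exact: lip.
exact: lip.
Qed.

Lemma measurable_kappa_inv : measurable_fun `[(0 : R), 1] sigma.
Proof. exact: integrable_measurable (cont_on_integrable kappa_inv_cont). Qed.

(** The weight is minus the derivative of [kappa] wherever that exists. As [kappa] decreases, the
    points sent below y form ]sigma y, b], and the weight of this set is an increment of [tau]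
    divided by T. *)
Lemma kappa_substitution (a b : R) : 0 <= a -> a <= b -> b <= 1 ->
  substitution a b (kap b) (kap a) kap (fun x => c x / T).
Proof.
move=> a0 ab b1; have T0 := tau1_gt0.
have in01 (x : R) : a <= x <= b -> 0 <= x <= 1.
  by move=> /andP[ax xb]; rewrite (le_trans a0 ax) (le_trans xb b1).
have a01 : 0 <= a <= 1 by apply: in01; rewrite lexx.
have b01 : 0 <= b <= 1 by apply: in01; rewrite lexx andbT.
have mk := measurable_kappa a0 b1.
have mw : measurable_fun `[a, b] (fun x => c x / T).
  by apply: measurable_funM => //; exact: measurable_funTS measurable_slowness.
have w0 (x : R) : 0 < c x / T by rewrite divr_gt0// slowness_gt0.
have kcd (x : R) : a <= x <= b -> kap b <= kap x <= kap a.
  move=> xab; have x01 := in01 _ xab; have /andP[ax xb] := xab.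
  by apply/andP; split; rewrite kappa_le.
have wi (u v : R) : mu.-integrable `[u, v] (EFin \o (fun x => c x / T)).
  have := integrableZR T^-1 (measurable_itv `[u, v]) (slowness_integrable u v).
  by apply: eq_integrableR => // x _; rewrite mulrC.
have wE (u v : R) : 0 <= u -> u <= v ->
    (\int[mu]_(x in `[u, v]) (c x / T)%:E = (kap u - kap v)%:E)%E.
  move=> u0 uv; rewrite EFin_Rintegral// RintegralZr//; last exact: slowness_integrable.
  by rewrite -tau_incr// /kappa; congr EFin; field; rewrite gt_eqF.
split => //; move=> g mg g0; apply: ge0_change_of_variables => //.
- by rewrite kappa_le.
- by move=> x _; exact: ltW.
- exact: wE.
- move=> y yab; have y01 : 0 <= y <= 1.
    move: yab => /andP[h1 h2]; have /andP[h3 _] := kappa_itv b01.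
    by have /andP[_ h4] := kappa_itv a01; rewrite (le_trans h3 h1) (le_trans h2 h4).
  have [s01 ks] := kappa_invP y01.
  have /andP[bs sa] : kap b <= kap (sigma y) <= kap a by rewrite ks.
  rewrite kappa_le// in bs; rewrite kappa_le// in sa.
  have klt (x : R) : 0 <= x <= 1 -> (kap x < y) = (sigma y < x).
    by move=> x01; rewrite ltNge -{1}ks kappa_le// -ltNge.
  have -> : `[a, b] `&` [set x | kap x < y] = `]sigma y, b]%classic.
    apply/seteqP; split => x /=; rewrite !in_itv/=.
      by move=> [xab]; rewrite klt ?in01// => ->; case/andP: xab.
    move=> /andP[sx xb]; have xab : a <= x <= b by rewrite xb (le_trans sa (ltW sx)).
    by rewrite klt ?in01.
  have -> : (\int[mu]_(x in `]sigma y, b]) (c x / T)%:E =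
      \int[mu]_(x in `[sigma y, b]) (c x / T)%:E)%E.
    apply: integral_itv_obnd_cbnd; apply/measurable_EFinP.
    by apply: measurable_funM => //; exact: measurable_funTS measurable_slowness.
  rewrite wE ?ks//.
  by case/andP: s01.
Qed.

End TravelTime.

(** * Integrals along the characteristics *)

Section Characteristics.
Context {R : realType}.
Local Notation mu := (@lebesgue_measure R).
Variables (lambda : R -> R) (eps M : R).
Hypotheses (eps0 : 0 < eps) (mlambda : measurable_fun setT lambda).
Hypothesis lambda_bounds : forall x, eps <= lambda x <= M.
Local Notation c := (fun x => (lambda x)^-1).
Local Notation T := (tau lambda 1).
Local Notation kap := (kappa lambda).
Let T0 : 0 < T := tau1_gt0 eps0 mlambda lambda_bounds.
Let kap_itv x : 0 <= x <= 1 -> 0 <= kap x <= 1 :=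
  @kappa_itv _ _ _ _ eps0 mlambda lambda_bounds x.
Let ksub := kappa_substitution eps0 mlambda lambda_bounds.
Let cgt0 := slowness_gt0 eps0 lambda_bounds.
Let cle := slowness_le eps0 lambda_bounds.
Let cge := slowness_ge eps0 lambda_bounds.
Let mc := measurable_slowness eps0 mlambda lambda_bounds.

Variable f : R -> R.
Hypothesis fL : forall B, L2fun `[0, B] f.

Let fi (a b : R) : 0 <= a -> mu.-integrable `[a, b] (EFin \o f).
Proof.
move=> a0; have := L2fun_integrable (measurable_itv `[0, b]) (lebesgue_itv_lty _ _) (fL b).
exact: integrable_subitv.
Qed.

Lemma L2fun_shift_unit (s : R) : 0 <= s -> L2fun `[0, 1] (fun r => f (r + s)).
Proof.
move=> s0; apply: L2fun_shift => //.
by apply: L2fun_sub_set (fL (1 + s)) => //; apply: subset_itv; rewrite bnd_simp// add0r.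
Qed.

Lemma L2fun_kappa (g : R -> R) : L2fun `[0, 1] g -> L2fun `[0, 1] (fun x => g (kap x)).
Proof.
have := ksub (lexx 0) ler01 (lexx 1).
rewrite (kappa0 lambda) (kappa1 eps0 mlambda lambda_bounds) => sub.
have M0 : 0 < M by have /andP[h] := lambda_bounds 0; apply: lt_le_trans; exact: lt_le_trans h.
apply: (substitution_L2fun sub (delta := M^-1 / T)) => [|x _].
  by rewrite divr_gt0// invr_gt0.
by rewrite ler_pM2r ?invr_gt0//; exact: cge.
Qed.

Lemma L2fun_characteristic (s : R) : 0 <= s ->
  L2fun `[0, 1] (fun x => c x * f (kap x + s)).
Proof.
move=> s0; apply: (@L2fun_boundedM _ _ _ _ eps^-1) => //.
- exact: measurable_funTS.
- by move=> x _; rewrite gtr0_norm.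
- exact: L2fun_kappa (L2fun_shift_unit s0).
Qed.

(** In the coordinate r = kap y the measure c y dy becomes T dr, and the interval [0, x] becomes
    [kap x, 1]. *)
Lemma Rintegral_characteristic (x s : R) : 0 <= x <= 1 -> 0 <= s ->
  \int[mu]_(y in `[0, x]) (c y * f (kap y + s)) =
  T * \int[mu]_(r in `[kap x + s, 1 + s]) f r.
Proof.
move=> x01 s0; have /andP[x0 x1] := x01; have /andP[k0 k1] := kap_itv x01.
have sh := shift_substitution s k1.
rewrite (substitution_Rintegral sh); last by apply: fi; rewrite addr_ge0.
have := ksub (lexx 0) x0 x1; rewrite (kappa0 lambda) => sub.
have fsi : mu.-integrable `[kap x, 1] (EFin \o (fun r => f (r + s))).
  have := L2fun_integrable (measurable_itv _) (lebesgue_itv_lty _ _) (L2fun_shift_unit s0).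
  exact: integrable_subitv.
under [in RHS]eq_Rintegral do rewrite mul1r.
rewrite (substitution_Rintegral sub fsi) -RintegralZl//; last first.
  exact: (substitution_integrable sub fsi).
apply: eq_Rintegral => y _ /=.
by field; rewrite !gt_eqF//= ?(lt_le_trans eps0)//; have /andP[] := lambda_bounds y.
Qed.

Lemma Rintegral_time (k t : R) (g : R -> R) : 0 <= t ->
  mu.-integrable `[k, k + t / T] (EFin \o g) ->
  mu.-integrable `[0, t] (EFin \o (fun s => g (k + s / T))) /\
  \int[mu]_(s in `[0, t]) g (k + s / T) = T * \int[mu]_(r in `[k, k + t / T]) g r.
Proof.
move=> t0 gi; have iT : 0 < T^-1 by rewrite invr_gt0.
have := affine_substitution k t0 iT; rewrite mulr0 add0r.
rewrite (_ : T^-1 * t + k = k + t / T); last by rewrite addrC mulrC.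
move=> sub; split.
  have := integrableZR T (measurable_itv _) (substitution_integrable sub gi).
  apply: eq_integrableR => // s _.
  by rewrite mulrA divff ?gt_eqF// mul1r addrC mulrC.
rewrite (substitution_Rintegral sub gi) -RintegralZl//; last first.
  exact: (substitution_integrable sub gi).
apply: eq_Rintegral => s _; rewrite mulrA divff ?gt_eqF// mul1r.
by rewrite addrC mulrC.
Qed.

(** Exchanges the time integral with the pairing against a test function, as the Pettis integral
    requires. Joint integrability holds because c <= eps^-1 and the time integral of |f(kap x + s /
    T)| is at most T times the integral of |f| over [0, B], uniformly in x. *)
Lemma Fubini_characteristic (phi : R -> R) (t : R) : 0 <= t -> L2fun `[0, 1] phi ->
  mu.-integrable `[0, t] (EFin \o (fun s =>
    \int[mu]_(x in `[0, 1]) (phi x * (c x * f (kap x + s / T))))) /\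
  \int[mu]_(s in `[0, t]) \int[mu]_(x in `[0, 1]) (phi x * (c x * f (kap x + s / T))) =
  \int[mu]_(x in `[0, 1])
    (phi x * (c x * (T * \int[mu]_(r in `[kap x, kap x + t / T]) f r))).
Proof.
move=> t0 phiL; have mphi := ((L2funP _ (measurable_itv `[0, 1])).1 phiL).1.
pose B := 1 + t / T.
have tT : 0 <= t / T by rewrite divr_ge0// ltW.
(* With every factor extended by 0, the integrand becomes a measurable function on the whole
   plane. *)
pose f0 := f \_ `[0, B].
have mf0 : measurable_fun setT f0.
  apply: (measurable_restrictT _ _).1 => //.
  by have [] := (L2funP _ (measurable_itv `[0, B])).1 (fL B).
pose k0 := kap \_ `[0, 1].
have mk0 : measurable_fun setT k0.
  apply: (measurable_restrictT _ _).1 => //.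
  exact: (measurable_kappa eps0 mlambda lambda_bounds).
pose a0 := (fun x => phi x * c x) \_ `[0, 1].
have ma0 : measurable_fun setT a0.
  apply: (measurable_restrictT _ _).1 => //.
  by apply: measurable_funM => //; exact: measurable_funTS.
pose i0 : R -> R := \1_(`[0, t]%classic).
have mi0 : measurable_fun setT i0 by exact: measurable_indic.
have i00 s : 0 <= i0 s by rewrite /i0.
pose H (z : measurableTypeR R * measurableTypeR R) := a0 z.1 * (f0 (k0 z.1 + z.2 / T) * i0 z.2).
have mH : measurable_fun setT H.
  apply: measurable_funM; first exact: measurableT_comp.
  apply: measurable_funM; last exact: measurableT_comp.
  apply: (measurableT_comp mf0); apply: measurable_funD.
    exact: measurableT_comp.
  by apply: measurable_funM.
have range x s : 0 <= x <= 1 -> 0 <= s <= t -> 0 <= kap x + s / T <= B.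
  move=> x01 /andP[s0 st]; have /andP[h1 h2] := kap_itv x01.
  have sT : 0 <= s / T by rewrite divr_ge0// ltW.
  have : s / T <= t / T by rewrite ler_pM2r// invr_gt0.
  rewrite /B; lra.
have HE x s : 0 <= x <= 1 -> 0 <= s <= t -> H (x, s) = phi x * (c x * f (kap x + s / T)).
  move=> x01 st; rewrite /H /a0 /k0 /i0 /f0 /= !patchE indicE.
  rewrite !mem_set//=; try by rewrite in_itv.
    by rewrite mulr1 mulrA.
  by rewrite in_itv/=; exact: range.
have H0 x s : ~~ ((0 <= x <= 1) && (0 <= s <= t)) -> H (x, s) = 0.
  rewrite negb_and /H /a0 /i0 /= => /orP[xn|sn].
    by rewrite patchE memNset ?mul0r//= in_itv/=; exact/negP.
  by rewrite indicE memNset ?mulr0//= in_itv/=; exact/negP.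
have iH : ((@lebesgue_measure R) \x (@lebesgue_measure R))%E.-integrable setT (EFin \o H).
  have mHn : measurable_fun setT (fun z => `|(EFin \o H) z|%E).
    by apply: measurableT_comp => //; exact/measurable_EFinP.
  apply/integrableP; split; first exact/measurable_EFinP.
  rewrite (fubini_tonelli1 _ mHn)//.
  pose C0 := \int[mu]_(r in `[0, B]) `|f r|.
  have nfi (u v : R) : 0 <= u -> mu.-integrable `[u, v] (EFin \o (fun r => `|f r|)).
    by move=> u0; apply: integrable_normR; exact: fi.
  pose G := (fun x => `|phi x| * (eps^-1 * (T * C0))) \_ `[0, 1].
  have Gi : mu.-integrable `[0, 1] (EFin \o (fun x => `|phi x| * (eps^-1 * (T * C0)))).
    have := integrableZR (eps^-1 * (T * C0)) (measurable_itv _) (integrable_normR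
      (L2fun_integrable (measurable_itv _) (lebesgue_itv_lty _ _) phiL)).
    by apply: eq_integrableR => // x _; rewrite mulrC.
  have GiT := (integrable_patch _ (measurable_itv `[0, 1])).1 Gi.
  apply: (@le_lt_trans _ _ (\int[mu]_x (G x)%:E)%E); last first.
    by apply: integrable_lty.
  apply: ge0_le_integral => //.
  - by move=> x _; apply: integral_ge0.
  - exact: measurable_fun_fubini_tonelli_F.
  - exact: measurable_int GiT.
  - move=> x _; rewrite /fubini_F /G patchE; case: ifPn => [/[!inE]/=|/negP/[!inE]/= xn]; last first.
      rewrite integral0_eq// => s _; rewrite /= H0 ?normr0//.
      by rewrite negb_and; apply/orP; left; apply/negP; rewrite in_itv/= in xn.
    rewrite in_itv/= => x01; have /andP[kx0 kx1] := kap_itv x01.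
    have [gi gE] := Rintegral_time t0 (nfi _ (kap x + t / T) kx0).
    have -> : (\int[mu]_s `|(EFin \o H) (x, s)| =
        \int[mu]_(s in `[(0:R)%R, t]) (`|phi x * c x| * `|f (kap x + s / T)|)%:E)%E.
      rewrite [RHS]integral_mkcond; apply: eq_integral => s _.
      rewrite patchE; case: ifPn => [/[!inE]/=|/negP/[!inE]/= sn].
        by rewrite in_itv/= => s0t; rewrite HE// mulrA normrM.
      by rewrite /= H0 ?normr0// negb_and; apply/orP; right; apply/negP; rewrite in_itv/= in sn.
    rewrite EFin_Rintegral//; last exact: integrableZR.
    rewrite RintegralZl// gE lee_fin normrM -mulrA ler_wpM2l//.
    have I0 : 0 <= \int[mu]_(r in `[kap x, kap x + t / T]) `|f r|.
      by apply: Rintegral_ge0.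
    rewrite gtr0_norm// ler_pM//; first exact: ltW.
      by rewrite mulr_ge0// ltW.
    rewrite ler_pM2l//; apply: Rintegral_subitv_le => //.
    - by rewrite lerDl.
    - by rewrite /B lerD2r.
    - exact: nfi.
have := @Fubini _ _ _ _ _ (@lebesgue_measure R) (@lebesgue_measure R) _ iH.
have E1 s : (\int[mu]_x (EFin \o H) (x, s) =
   ((fun s => \int[mu]_(x in `[0, 1]) (phi x * (c x * f (kap x + s / T)))) \_ `[0, t] s)%:E)%E.
  rewrite patchE; case: ifPn => [/[!inE]/=|/negP/[!inE]/= sn]; last first.
    apply: integral0_eq => x _; rewrite /= H0// negb_and.
    by apply/orP; right; apply/negP; rewrite in_itv/= in sn.
  rewrite in_itv/= => st; rewrite -EFin_Rintegral//; last first.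
    apply: L2fun_mul => //; apply: L2fun_characteristic.
    by have /andP[s0 _] := st; rewrite divr_ge0// ltW.
  rewrite [RHS]integral_mkcond; apply: eq_integral => x _.
  rewrite patchE; case: ifPn => [/[!inE]/=|/negP/[!inE]/= xn].
    by rewrite in_itv/= => x01; rewrite HE.
  by rewrite /= H0// negb_and; apply/orP; left; apply/negP; rewrite in_itv/= in xn.
have E2 x : (\int[mu]_s (EFin \o H) (x, s) =
   ((fun x => phi x * (c x * (T * \int[mu]_(r in `[kap x, kap x + t / T]) f r))) \_ `[0, 1] x)%:E)%E.
  rewrite patchE; case: ifPn => [/[!inE]/=|/negP/[!inE]/= xn]; last first.
    apply: integral0_eq => s _; rewrite /= H0// negb_and.
    by apply/orP; left; apply/negP; rewrite in_itv/= in xn.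
  rewrite in_itv/= => x01; have /andP[kx0 _] := kap_itv x01.
  have [gi <-] := Rintegral_time t0 (fi _ kx0).
  rewrite -!RintegralZl//; last exact: integrableZR.
  rewrite -EFin_Rintegral//; last by apply: integrableZR => //; exact: integrableZR.
  rewrite [RHS]integral_mkcond; apply: eq_integral => s _.
  rewrite patchE; case: ifPn => [/[!inE]/=|/negP/[!inE]/= sn].
    by rewrite in_itv/= => s0t; rewrite HE.
  by rewrite /= H0// negb_and; apply/orP; right; apply/negP; rewrite in_itv/= in sn.
have mHE : measurable_fun setT (EFin \o H) by exact/measurable_EFinP.
(* Integrability of the marginal in s is part of the claim: its absolute value is at most the
   marginal of |H|, which is integrable by Tonelli. *)
have Gi : (@lebesgue_measure R).-integrable setT (fubini_G (@lebesgue_measure R) (EFin \o H)).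
  have mG := measurable_fubini_G iH.
  have h : (\int[mu]_s \int[mu]_x `|(EFin \o H) (x, s)| < +oo)%E.
    exact/integrable21ltyP.
  apply/integrableP; split => //; apply: le_lt_trans h.
  apply: ge0_le_integral => //.
  - exact: measurableT_comp.
  - apply: (measurable_fun_fubini_tonelli_G (abse \o (EFin \o H))).
      exact: measurableT_comp.
    by move=> z; exact: abse_ge0.
  - move=> s _; apply: le_abse_integral => //.
    by apply: measurableT_comp.
under eq_integral do rewrite E2.
under [in X in _ = X -> _]eq_integral do rewrite E1.
move=> EE; split.
  apply/integrable_patch => //; apply: eq_integrable Gi => // s _.
  exact: E1.
rewrite [LHS]Rintegral_mkcond [RHS]Rintegral_mkcond /Rintegral.
by rewrite EE.
Qed.

End Characteristics.

(** * Almost everywhere equality, continuity in time, vector-valued functions *)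

Section AlmostEverywhere.
Context {R : realType}.
Local Notation mu := (@lebesgue_measure R).

Lemma ae_eq_Rintegral (D : set R) (f g : R -> R) : measurable D ->
  measurable_fun D f -> measurable_fun D g ->
  ae_on D (fun x => f x = g x) ->
  \int[mu]_(x in D) f x = \int[mu]_(x in D) g x.
Proof.
move=> mD mf mg fg; rewrite /Rintegral; congr fine.
apply: ae_eq_integral => //; try exact/measurable_EFinP.
by apply: ae_onS fg => x _ /= ->.
Qed.

Lemma primitive_cont (B : R) (f : R -> R) : 0 <= B ->
  mu.-integrable `[0, B] (EFin \o f) ->
  cont_on 0 B (fun r => \int[mu]_(x in `[0, r]) f x).
Proof.
move=> B0 fi x x0B e e0.
have /subspace_continuousP/(_ x) := parameterized_integral_continuous B0 fi.
rewrite /= in_itv/= => /(_ x0B) /cvgrPdist_le/(_ _ e0)[d /= d0 h].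
exists d => // y y0B yx; rewrite distrC; apply: h; first by rewrite /= distrC.
by rewrite /= in_itv.
Qed.

(** The primitive of g - h vanishes, whereas by continuity its increments near x are close to (g -
    h)(x) times the step. *)
Lemma cont_on_ae_eq (g h : R -> R) : cont_on 0 1 g -> cont_on 0 1 h ->
  ae_on `[0, 1] (fun x => g x = h x) -> forall x, 0 <= x <= 1 -> g x = h x.
Proof.
move=> gc hc gh x x01; have /andP[x0 x1] := x01.
have gi := cont_on_integrable gc; have hi := cont_on_integrable hc.
pose D y := g y - h y.
have Di : mu.-integrable `[0, 1] (EFin \o D) by exact: integrableBR.
have D0 s : 0 <= s <= 1 -> \int[mu]_(y in `[0, s]) D y = 0.
  move=> /andP[s0 s1]; have s01 : `[0, s] `<=` `[(0:R), 1].
    by apply: subset_itv; rewrite bnd_simp.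
  have mD : measurable_fun `[0, s] D.
    by apply: measurable_funS (integrable_measurable Di).
  rewrite (@ae_eq_Rintegral _ _ (fun=> 0))// ?Rintegral_cst// ?mul0r//.
  by apply: ae_onS (ae_on_subset s01 gh) => y _; rewrite /D => ->; rewrite subrr.
suff : `|D x| <= 0 by rewrite normr_le0 subr_eq0 => /eqP.
apply/ler_addgt0Pr => e e0; rewrite add0r.
have [d1 d10 h1] := gc _ x01 _ (divr_gt0 e0 (ltr0n _ 2)).
have [d2 d20 h2] := hc _ x01 _ (divr_gt0 e0 (ltr0n _ 2)).
(* As d <= 1 / 2, one of x + d and x - d lies in [0, 1]. *)
pose d := Num.min (Num.min d1 d2) 1 / 2.
have [d0 dd1 dd2 dle] : [/\ 0 < d, d < d1, d < d2 & d <= 1 / 2].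
  have m0 : 0 < Num.min (Num.min d1 d2) 1 by rewrite !lt_min d10 d20 ltr01.
  have m1 : Num.min (Num.min d1 d2) 1 <= d1 by rewrite !ge_min lexx.
  have m2 : Num.min (Num.min d1 d2) 1 <= d2 by rewrite !ge_min lexx orbT.
  have m3 : Num.min (Num.min d1 d2) 1 <= 1 by rewrite !ge_min lexx orbT.
  by rewrite /d; split; lra.
have [y y01 yx] : exists2 y, 0 <= y <= 1 & `|y - x| = d.
  have [xh|hx] := leP x (1 / 2).
    by exists (x + d); [lra|rewrite addrAC subrr add0r gtr0_norm].
  by exists (x - d); [lra|rewrite addrAC subrr sub0r normrN gtr0_norm].
have := @primitive_increment R 1 x y (D x) e D Di x01 y01.
rewrite (D0 _ x01) (D0 _ y01) subrr sub0r normrN normrM yx => H.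
have {}H : `|D x| * d <= e * d.
  apply: H => w w01 wx; have a1 := h1 w w01 (le_lt_trans wx dd1).
  have a2 := h2 w w01 (le_lt_trans wx dd2).
  rewrite /D [X in `|X|](_ : _ = (g w - g x) - (h w - h x)); last by ring.
  by apply: le_trans (ler_normB _ _) _; lra.
by rewrite ler_pM2r in H.
Qed.

Lemma L2fun_sqr_eq0 (D : set R) (h : R -> R) : measurable D -> L2fun D h ->
  \int[mu]_(x in D) h x ^+ 2 = 0 -> ae_on D (fun x => h x = 0).
Proof.
move=> mD hL h0; have [mh h2] := (L2funP _ mD).1 hL.
have m2 : measurable_fun D (EFin \o (fun x => h x ^+ 2)).
  by apply/measurable_EFinP; exact: measurable_funX.
have H : (\int[mu]_(x in D) `|(h x ^+ 2)%:E| = 0)%E.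
  rewrite -[RHS](_ : (\int[mu]_(x in D) (h x ^+ 2)%:E)%E = _); last first.
    by rewrite EFin_Rintegral// h0.
  by apply: eq_integral => x _; rewrite gee0_abs// lee_fin sqr_ge0.
have := (ae_eq_integral_abs mu mD m2).1 H.
apply: (@filterS _ _ (ae_filter_ringOfSetsType mu)) => x /= h' Dx.
by have [] := h' Dx => /eqP; rewrite sqrf_eq0 => /eqP.
Qed.

Lemma Rintegral_sum (D : set R) (I : finType) (F : I -> R -> R) : measurable D ->
  (forall i, mu.-integrable D (EFin \o F i)) ->
  mu.-integrable D (EFin \o (fun x => \sum_i F i x)) /\
  \int[mu]_(x in D) \sum_i F i x = \sum_i \int[mu]_(x in D) F i x.
Proof.
move=> mD Fi; elim: (index_enum I) => [|i s [ih1 ih2]].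
  have -> : (fun x => \sum_(i <- [::]) F i x) = (fun=> 0).
    by apply/funext => x; rewrite big_nil.
  by rewrite big_nil Rintegral_cst// mul0r; split => //; exact: integrable0.
have -> : (fun x => \sum_(j <- i :: s) F j x) = (fun x => F i x + \sum_(j <- s) F j x).
  by apply/funext => x; rewrite big_cons.
rewrite big_cons RintegralD// ih2; split => //.
exact: integrableDR.
Qed.

End AlmostEverywhere.

Section CharacteristicContinuity.
Context {R : realType}.
Local Notation mu := (@lebesgue_measure R).
Variables (lambda : R -> R) (eps M : R).
Hypotheses (eps0 : 0 < eps) (mlambda : measurable_fun setT lambda).
Hypothesis lambda_bounds : forall x, eps <= lambda x <= M.
Local Notation c := (fun x => (lambda x)^-1).
Local Notation T := (tau lambda 1).
Local Notation kap := (kappa lambda).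
Let T0 : 0 < T := tau1_gt0 eps0 mlambda lambda_bounds.

(** In the coordinate [kappa] this is continuity of translations. Of the two factors c in the
    square, one is at most eps^-1 and the other, divided by T, is the weight of the substitution;
    hence the tolerance e * eps / T. *)
Lemma characteristic_continuity (f : R -> R) (t : R) : 0 <= t ->
  (forall B, L2fun `[0, B] f) -> forall e : R, 0 < e -> exists2 d : R, 0 < d &
  forall s : R, 0 <= s -> `|s - t| < d ->
    \int[mu]_(x in `[0, 1]) (c x * f (kap x + s / T) - c x * f (kap x + t / T)) ^+ 2 <= e.
Proof.
move=> t0 fL e e0; have tT : 0 <= t / T by rewrite divr_ge0// ltW.
have e'0 : 0 < e * eps / T by rewrite divr_gt0// mulr_gt0.
have [d d0 h] := translation_continuity tT fL e'0.
exists (d * T) => [|s s0 st]; first by rewrite mulr_gt0.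
have sT : 0 <= s / T by rewrite divr_ge0// ltW.
have {h} := h _ sT; rewrite -mulrBl normrM (gtr0_norm (_ : 0 < T^-1)) ?invr_gt0//.
rewrite ltr_pdivrMr// => /(_ st) h.
have fq (q : R) : 0 <= q -> L2fun `[0, 1] (fun r => f (r + q)).
  exact: L2fun_shift_unit.
have [mD Di] := (L2funP _ (measurable_itv `[0, 1])).1
  (L2fun_sub (measurable_itv `[0, 1]) (fq _ sT) (fq _ tT)).
have := kappa_substitution eps0 mlambda lambda_bounds (lexx 0) ler01 (lexx 1).
rewrite (kappa0 lambda) (kappa1 eps0 mlambda lambda_bounds) => sub.
rewrite (substitution_Rintegral sub Di) in h.
have Dki := substitution_integrable sub Di.
apply: (@le_trans _ _ (\int[mu]_(x in `[0, 1]) (T / eps *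
  (c x / T * (f (kap x + s / T) - f (kap x + t / T)) ^+ 2)))); last first.
  rewrite RintegralZl// -ler_pdivlMl ?divr_gt0//.
  by apply: le_trans h _; rewrite invf_div (mulrC (eps / T)) mulrA.
have cL q : 0 <= q -> L2fun `[0, 1] (fun x => c x * f (kap x + q)).
  exact: (L2fun_characteristic eps0 mlambda lambda_bounds fL).
apply: le_Rintegral => //.
- exact: ((L2funP _ (measurable_itv _)).1 (L2fun_sub (measurable_itv _) (cL _ sT) (cL _ tT))).2.
- exact: integrableZR.
- move=> x _; rewrite -mulrBr exprMn.
  have c0 := slowness_gt0 eps0 lambda_bounds x.
  have cle := slowness_le eps0 lambda_bounds x.
  rewrite [leRHS](_ : _ = eps^-1 * c x * (f (kap x + s / T) - f (kap x + t / T)) ^+ 2); last first.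
    by field; rewrite !gt_eqF//= ?(lt_le_trans eps0)//; have /andP[] := lambda_bounds x.
  by rewrite ler_wpM2r ?sqr_ge0// expr2 ler_pM2r.
Qed.

End CharacteristicContinuity.

Section VectorFunctions.
Context {R : realType}.
Local Notation mu := (@lebesgue_measure R).

Lemma L2loc_L2fun n (f : R -> 'cV[R]_n) : L2loc f ->
  forall i B, L2fun `[0, B] (fun r => f r i 0).
Proof.
(* [L2loc] speaks of positive horizons only, hence the maximum with 1. *)
move=> fL i B; have B1 : 0 < Num.max B 1 by rewrite lt_max ltr01 orbT.
have /= fB : L2fun `[0, Num.max B 1] (fun r => f r i 0) := fL _ B1 i.
apply: L2fun_sub_set fB => //; apply: subset_itv; rewrite bnd_simp//.
by rewrite le_max lexx.
Qed.

Lemma ae_on_forall (I : finType) (D : set R) (P : I -> R -> Prop) :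
  (forall i, ae_on D (P i)) -> ae_on D (fun x => forall i, P i x).
Proof.
move=> h; have := @filter_forall _ _ _ _ (ae_filter_ringOfSetsType mu) h.
apply: (@filterS _ _ (ae_filter_ringOfSetsType mu)) => x /= hx Dx i.
exact: hx.
Qed.

Lemma ipX_sum n (v w : R -> 'cV[R]_n) : L2on `[0, 1] v -> L2on `[0, 1] w ->
  ipX v w = \sum_i \int[mu]_(s in `[0, 1]) (v s i 0 * w s i 0).
Proof.
move=> vL wL; rewrite /ipX.
have H i : mu.-integrable `[0, 1] (EFin \o (fun s => v s i 0 * w s i 0)).
  by apply: L2fun_mul => //; [exact: vL|exact: wL].
by have [_ ->] := Rintegral_sum (measurable_itv `[0, 1]) H.
Qed.

Lemma L2on_sub n (D : set R) (v w : R -> 'cV[R]_n) : measurable D ->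
  L2on D v -> L2on D w -> L2on D (fun s => v s - w s).
Proof.
move=> mD vL wL i; apply: (L2fun_eq (f := fun s => v s i 0 - w s i 0)).
  by move=> s _; rewrite !mxE.
by apply: L2fun_sub => //; [exact: vL|exact: wL].
Qed.

End VectorFunctions.

Lemma eq_cont_on (R : realType) (a b : R) (g h : R -> R) :
  (forall x, a <= x <= b -> g x = h x) -> cont_on a b g -> cont_on a b h.
Proof.
move=> gh gc x xab e e0; have [d d0 hd] := gc x xab e e0.
by exists d => // y yab yx; rewrite -!gh//; exact: hd.
Qed.

Lemma L2fun_cont (R : realType) (a b : R) (g : R -> R) :
  cont_on a b g -> L2fun `[a, b] g.
Proof.
move=> gc; have mg := integrable_measurable (cont_on_integrable gc).
have /compact_bounded[N [_ gN]] := continuous_compact (cont_onP gc) (@segment_compact R a b).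
apply: (@L2fun_le_sqr _ _ _ (fun=> (N + 1) ^+ 2)) => //.
  move=> x xab; have gx : `|g x| <= N + 1.
    by apply: gN; [rewrite ltrDl|exists x].
  by rewrite lerXn2r ?nnegrE// (le_trans _ gx).
exact: integrable_cstR (lebesgue_itv_lty _ _).
Qed.

(** With G a primitive of f and k = [kappa], this is the continuity of [transported] below. *)
Lemma cont_on_increment (R : realType) (T th : R) (G k : R -> R) : 0 < T ->
  0 <= th -> cont_on 0 (1 + th) G -> (forall y, 0 <= y <= 1 -> 0 <= k y <= 1) ->
  cont_on 0 1 k -> cont_on 0 1 (fun y => T * (G (k y + th) - G (k y))).
Proof.
move=> T0 th0 Gc k01 kc y y01 e e0; have /andP[k0 k1] := k01 _ y01.
have kB : 0 <= k y <= 1 + th by rewrite k0 (le_trans k1)// lerDl.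
have ktB : 0 <= k y + th <= 1 + th by rewrite addr_ge0//= lerD2r.
have e2 : 0 < e / 2 / T by rewrite !divr_gt0.
have [d1 d10 h1] := Gc _ kB _ e2; have [d2 d20 h2] := Gc _ ktB _ e2.
pose m := Num.min d1 d2 / 2.
have m0 : 0 < m by rewrite divr_gt0// lt_min d10.
have [md1 md2] : m < d1 /\ m < d2.
  have m0' : 0 < Num.min d1 d2 by rewrite lt_min d10.
  have m1 : Num.min d1 d2 <= d1 by rewrite ge_min lexx.
  have m2 : Num.min d1 d2 <= d2 by rewrite ge_min lexx orbT.
  by rewrite /m; split; lra.
have [d d0 hd] := kc _ y01 _ m0.
exists d => // y' y'01 yy; have k2 := hd _ y'01 yy.
have /andP[k'0 k'1] := k01 _ y'01.
have ha : `|G (k y') - G (k y)| <= e / 2 / T.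
  by apply: h1; [rewrite k'0 (le_trans k'1)// lerDl|exact: le_lt_trans md1].
have hb : `|G (k y' + th) - G (k y + th)| <= e / 2 / T.
  apply: h2; first by rewrite addr_ge0//= lerD2r.
  rewrite [X in `|X|](_ : _ = k y' - k y); last by ring.
  exact: le_lt_trans md2.
rewrite -mulrBr normrM gtr0_norm// -ler_pdivlMl//.
rewrite [X in `|X|](_ : _ = (G (k y' + th) - G (k y + th)) - (G (k y') - G (k y))); last by ring.
apply: le_trans (ler_normB _ _) _; apply: le_trans (lerD hb ha) _.
by rewrite -mulrDl -splitr mulrC.
Qed.

(** * Mild solutions transported along the characteristics *)

Section MildTransport.
Context {R : realType}.
Local Notation mu := (@lebesgue_measure R).
Variables (lambda : R -> R) (eps M : R).
Hypotheses (eps0 : 0 < eps) (mlambda : measurable_fun setT lambda).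
Hypothesis lambda_bounds : forall x, eps <= lambda x <= M.
Local Notation c := (fun x => (lambda x)^-1).
Local Notation T := (tau lambda 1).
Local Notation kap := (kappa lambda).
Let T0 : 0 < T := tau1_gt0 eps0 mlambda lambda_bounds.
Let kap_itv (x : R) : 0 <= x <= 1 -> 0 <= kap x <= 1 :=
  @kappa_itv _ _ _ _ eps0 mlambda lambda_bounds x.
Let lambda0 (x : R) : 0 < lambda x.
Proof. by have /andP[] := lambda_bounds x => /(lt_le_trans eps0). Qed.

Variables (n : nat) (f : R -> 'cV[R]_n) (x : R -> R -> 'cV[R]_n).
Hypotheses (fL : L2loc f) (xX : state_in_X x).
Hypothesis fx : forall t : R, 0 <= t -> ae_on `[0, 1] (fun zeta =>
  f (kap zeta + T^-1 * t) = lambda zeta *: x zeta t).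

Let fi i (r : R) : R := f r i 0.
Let fLi i B : L2fun `[0, B] (fi i) := L2loc_L2fun fL i B.
Let cL i (s : R) : 0 <= s -> L2fun `[0, 1] (fun y => c y * fi i (kap y + s / T)).
Proof.
move=> s0; apply: (L2fun_characteristic eps0 mlambda lambda_bounds (fLi i)).
by rewrite divr_ge0// ltW.
Qed.

Let xLi i (t : R) : 0 <= t -> L2fun `[0, 1] (fun y => x y t i 0).
Proof. by move=> t0; exact: (xX t0 i). Qed.

Lemma state_characteristic i (t : R) : 0 <= t ->
  ae_on `[0, 1] (fun y => x y t i 0 = c y * fi i (kap y + t / T)).
Proof.
move=> t0; apply: ae_onS (fx t0) => y _ /= E.
by rewrite /fi mulrC [t / T]mulrC E mxE mulrAC divff ?mul1r// gt_eqF.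
Qed.

Lemma mild_continuous : continuous_in_X x.
Proof.
move=> t t0; apply/cvgrPdist_le => e e0.
(* One share for each component; n.+1 keeps the denominator positive when n = 0. *)
have en : 0 < e / n.+1%:R by rewrite divr_gt0.
have H : \forall s \near within [set s | 0 <= s] (nbhs t), forall i,
    \int[mu]_(y in `[0, 1]) (x y s i 0 - x y t i 0) ^+ 2 <= e / n.+1%:R.
  apply: filter_forall => i.
  have [d d0 hd] := characteristic_continuity eps0 mlambda lambda_bounds t0 (fLi i) en.
  exists d => // s /= ts s0.
  have msub (g h : R -> R) : L2fun `[0, 1] g -> L2fun `[0, 1] h ->
      measurable_fun `[(0 : R), 1] (fun y => (g y - h y) ^+ 2).
    move=> gL hL; apply: measurable_funX.
    by have [] := (L2funP _ (measurable_itv `[0, 1])).1 (L2fun_sub (measurable_itv _) gL hL).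
  have -> : \int[mu]_(y in `[0, 1]) (x y s i 0 - x y t i 0) ^+ 2 =
      \int[mu]_(y in `[0, 1]) (c y * fi i (kap y + s / T) - c y * fi i (kap y + t / T)) ^+ 2.
    apply: ae_eq_Rintegral => //.
    - by apply: msub; exact: xLi.
    - by apply: msub; exact: cL.
    - apply: ae_onS (ae_onI (state_characteristic i s0) (state_characteristic i t0)).
      by move=> y _ [-> ->].
  by apply: hd => //; rewrite distrC.
have t1 : \forall s \near within [set s | 0 <= s] (nbhs t), 0 <= s.
  exact: withinT.
apply: filterS2 H t1 => s Hs s0.
have E : ipX (fun y => x y s - x y t) (fun y => x y s - x y t) =
    \sum_i \int[mu]_(y in `[0, 1]) (x y s i 0 - x y t i 0) ^+ 2.
  have xst := L2on_sub (measurable_itv `[0, 1]) (xX s0) (xX t0).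
  rewrite ipX_sum//; apply: eq_bigr => i _; apply: eq_Rintegral => y _.
  by rewrite !mxE expr2.
rewrite sub0r normrN E ger0_norm; last first.
  by apply: sumr_ge0 => i _; apply: Rintegral_ge0 => y _; exact: sqr_ge0.
apply: (@le_trans _ _ (\sum_(i < n) e / n.+1%:R)); first exact: ler_sum.
rewrite sumr_const card_ord -[leLHS]mulr_natr mulrAC ler_pdivrMr// ler_pM2l//.
by rewrite ler_nat.
Qed.

Definition transported (t zeta : R) : 'cV[R]_n :=
  T *: vint `[kap zeta, kap zeta + t / T] f.

Lemma transportedE (t zeta : R) i :
  transported t zeta i 0 = T * \int[mu]_(r in `[kap zeta, kap zeta + t / T]) fi i r.
Proof. by rewrite /transported /vint !mxE. Qed.

Let fint i (a b : R) : 0 <= a -> mu.-integrable `[a, b] (EFin \o fi i).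
Proof.
move=> a0; have := L2fun_integrable (measurable_itv `[0, b]) (lebesgue_itv_lty _ _) (fLi i b).
exact: integrable_subitv.
Qed.

Let prim i (r : R) : R := \int[mu]_(s in `[0, r]) fi i s.

Let primB i (a b : R) : 0 <= a -> a <= b -> \int[mu]_(r in `[a, b]) fi i r = prim i b - prim i a.
Proof.
move=> a0 ab; rewrite /prim (@Rintegral_itv_cat _ 0 a b)//; last exact: fint.
by rewrite addrAC subrr add0r.
Qed.

Lemma transported_prim (t zeta : R) i : 0 <= t -> 0 <= zeta <= 1 ->
  transported t zeta i 0 = T * (prim i (kap zeta + t / T) - prim i (kap zeta)).
Proof.
move=> t0 z01; have /andP[k0 _] := kap_itv z01.
by rewrite transportedE primB// lerDl divr_ge0// ltW.
Qed.

Lemma transported_cont (t : R) i : 0 <= t -> cont_on 0 1 (fun y => transported t y i 0).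
Proof.
move=> t0; have tT : 0 <= t / T by rewrite divr_ge0// ltW.
have B0 : 0 <= 1 + t / T by rewrite addr_ge0.
have pc := primitive_cont B0 (fint i (1 + t / T) (lexx 0)).
have := cont_on_increment T0 tT pc kap_itv (kappa_cont eps0 mlambda lambda_bounds).
by apply: eq_cont_on => y y01; rewrite (transported_prim i t0 y01).
Qed.

Let ctL (t : R) i : 0 <= t -> L2fun `[0, 1] (fun y => c y * transported t y i 0).
Proof.
move=> t0; apply: (@L2fun_boundedM _ _ _ _ eps^-1) => //.
- apply: measurable_funTS; exact: measurable_slowness eps0 mlambda lambda_bounds.
- move=> y _; rewrite gtr0_norm; first exact: slowness_le eps0 lambda_bounds y.
  exact: slowness_gt0 eps0 lambda_bounds y.
- exact: L2fun_cont (transported_cont i t0).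
Qed.

Let phi_state (t : R) i (phi : R -> R) : 0 <= t -> L2fun `[0, 1] phi ->
  \int[mu]_(s in `[0, t]) \int[mu]_(y in `[0, 1]) (phi y * x y s i 0) =
  \int[mu]_(y in `[0, 1]) (phi y * (c y * transported t y i 0)).
Proof.
move=> t0 phiL.
have [_ H] := Fubini_characteristic eps0 mlambda lambda_bounds (fLi i) t0 phiL.
under [RHS]eq_Rintegral do rewrite transportedE.
rewrite -H; apply: eq_Rintegral => s /[!inE]/=; rewrite in_itv/= => /andP[s0 _].
apply: ae_eq_Rintegral => //.
- exact: integrable_measurable (L2fun_mul (measurable_itv _) phiL (xLi i s0)).
- exact: integrable_measurable (L2fun_mul (measurable_itv _) phiL (cL i s0)).
- by apply: ae_onS (state_characteristic i s0) => y _ ->.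
Qed.

Lemma integral_in_X_transported (t : R) (I : R -> 'cV[R]_n) : 0 <= t ->
  integral_in_X x t I -> ae_on `[0, 1] (fun y => lambda y *: I y = transported t y).
Proof.
move=> t0 [IL Ieq].
have H i : ae_on `[0, 1] (fun y => I y i 0 - c y * transported t y i 0 = 0).
  have DL : L2fun `[0, 1] (fun y => I y i 0 - c y * transported t y i 0).
    by apply: L2fun_sub => //; [exact: (IL i)|exact: ctL].
  apply: L2fun_sqr_eq0 => //; move: (DL) => /= DL'.
  pose D y := I y i 0 - c y * transported t y i 0.
  (* The test function is the difference itself, placed in component i: the Pettis identity then
     says that the integral of D^2 is 0. *)
  pose phi y : 'cV[R]_n := D y *: delta_mx i 0.
  have phiE (y : R) j : phi y j 0 = if j == i then D y else 0.
    by rewrite /phi !mxE eqxx andbT; case: (j == i); rewrite ?mulr1 ?mulr0.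
  have phiL : L2on `[0, 1] phi.
    move=> j; case: (eqVneq j i) => ji.
      by apply: (L2fun_eq (f := D)) => // y _; rewrite phiE ji eqxx.
    apply: (L2fun_eq (f := fun=> 0)); first by move=> y _; rewrite phiE (negbTE ji).
    exact: L2fun_cst (measurable_itv _) (lebesgue_itv_lty _ _).
  have single (v : R -> 'cV[R]_n) : ipX phi v = \int[mu]_(y in `[0, 1]) (D y * v y i 0).
    apply: eq_Rintegral => y _; rewrite (bigD1 i)//= big1 ?addr0.
      by rewrite phiE eqxx.
    by move=> j ji; rewrite phiE (negbTE ji) mul0r.
  have := Ieq _ phiL; rewrite single.
  under [in RHS]eq_Rintegral do rewrite single.
  rewrite phi_state// => E.
  have -> : \int[mu]_(y in `[0, 1]) (I y i 0 - c y * transported t y i 0) ^+ 2 =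
    \int[mu]_(y in `[0, 1]) (D y * I y i 0) -
    \int[mu]_(y in `[0, 1]) (D y * (c y * transported t y i 0)).
    rewrite -RintegralB//; last 2 first.
    - by apply: L2fun_mul => //; exact: (IL i).
    - by apply: L2fun_mul => //; exact: ctL.
    by apply: eq_Rintegral => y _; rewrite -mulrBr expr2.
  by rewrite E subrr.
have {}H : ae_on `[0, 1] (fun y => forall i, I y i 0 - c y * transported t y i 0 = 0).
  exact: ae_on_forall.
apply: ae_onS H => y _ H; apply/colP => i; rewrite mxE.
have /eqP := H i; rewrite subr_eq0 => /eqP ->.
by rewrite mulrA divff ?mul1r// gt_eqF.
Qed.

Let phi_state_integrable (t : R) i (phi : R -> R) : 0 <= t -> L2fun `[0, 1] phi ->
  mu.-integrable `[0, t] (EFin \o (fun s =>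
    \int[mu]_(y in `[0, 1]) (phi y * x y s i 0))).
Proof.
move=> t0 phiL.
have [H _] := Fubini_characteristic eps0 mlambda lambda_bounds (fLi i) t0 phiL.
apply: eq_integrableR H => // s /=; rewrite in_itv/= => /andP[s0 _].
apply/esym; apply: ae_eq_Rintegral => //.
- exact: integrable_measurable (L2fun_mul (measurable_itv _) phiL (xLi i s0)).
- exact: integrable_measurable (L2fun_mul (measurable_itv _) phiL (cL i s0)).
- by apply: ae_onS (state_characteristic i s0) => y _ ->.
Qed.

(** Both sides are continuous and agree almost everywhere, hence also at 0 and 1, where the traces
    are read off. *)
Lemma mild_representative (t : R) (I w v : R -> 'cV[R]_n) : 0 <= t ->
  integral_in_X x t I -> H1_with_deriv w v ->
  ae_on `[0, 1] (fun zeta => w zeta = lambda zeta *: I zeta) ->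
  forall zeta : R, 0 <= zeta <= 1 -> w zeta = transported t zeta.
Proof.
move=> t0 xI [vL wv] wI zeta z01; apply/colP => i.
have vi : mu.-integrable `[0, 1] (EFin \o (fun y => v y i 0)).
  exact: L2fun_integrable (measurable_itv _) (lebesgue_itv_lty _ _) (vL i).
have wc : cont_on 0 1 (fun y => w y i 0).
  apply: (@eq_cont_on _ _ _ (fun y => w 0 i 0 + \int[mu]_(s in `[0, y]) v s i 0)).
    by move=> y y01; rewrite [in RHS]wv ?mxE//= in_itv.
  move=> y y01 e e0; have [d d0 hd] := primitive_cont ler01 vi y01 e0.
  exists d => // y' y'01 yy; rewrite [X in `|X|](_ : _ =
    \int[mu]_(s in `[0, y']) v s i 0 - \int[mu]_(s in `[0, y]) v s i 0); last by ring.
  exact: hd.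
apply: (cont_on_ae_eq wc (transported_cont i t0)) => //.
by apply: ae_onS (ae_onI wI (integral_in_X_transported t0 xI)) => y _ [-> ->].
Qed.

Let state_primitive i (s zeta : R) : 0 <= s -> 0 <= zeta <= 1 ->
  \int[mu]_(y in `[0, zeta]) x y s i 0 =
  T * (prim i (1 + s / T) - prim i (kap zeta + s / T)).
Proof.
move=> s0 z01; have /andP[z0 z1] := z01; have sT : 0 <= s / T by rewrite divr_ge0// ltW.
have /andP[k0 k1] := kap_itv z01.
have sub : `[0, zeta] `<=` `[(0:R), 1] by apply: subset_itv; rewrite bnd_simp.
have ms (g : R -> R) : L2fun `[0, 1] g -> measurable_fun `[0, zeta] g.
  move=> /(L2funP _ (measurable_itv _))[mg _]; exact: measurable_funS mg.
transitivity (\int[mu]_(y in `[0, zeta]) (c y * fi i (kap y + s / T))).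
  apply: ae_eq_Rintegral => //.
  - by apply: ms; exact: xLi.
  - by apply: ms; exact: cL.
  - by apply: ae_on_subset sub _; exact: state_characteristic.
rewrite (Rintegral_characteristic eps0 mlambda lambda_bounds (fLi i) z01 sT).
by rewrite primB//; [exact: addr_ge0|rewrite lerD2r].
Qed.

(** Conversely, a transported state satisfies the interior part of the mild equations. That
    [transported] has weak derivative x(., 0) - x(., t) is an identity between values of the
    primitive of f. *)
Lemma mild_representative_exists (t : R) : 0 <= t ->
  exists I w v : R -> 'cV[R]_n,
    [/\ integral_in_X x t I,
        H1_with_deriv w v /\
          ae_on `[0, 1] (fun zeta => w zeta = lambda zeta *: I zeta) &
        ae_on `[0, 1] (fun zeta => x zeta t - x zeta 0 = - v zeta)].
Proof.
move=> t0; have tT : 0 <= t / T by rewrite divr_ge0// ltW.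
exists (fun y => c y *: transported t y), (transported t), (fun y => x y 0 - x y t).
have IL : L2on `[0, 1] (fun y => c y *: transported t y).
  move=> i; apply: (L2fun_eq (f := fun y => c y * transported t y i 0)).
    by move=> y _; rewrite [RHS]mxE.
  exact: ctL.
split; last 2 first.
- split; last first.
    apply: ae_on_T => y _; rewrite scalerA divff ?scale1r// gt_eqF//.
  split; first by apply: L2on_sub => //; exact: xX.
  move=> zeta; rewrite in_itv/= => z01; apply/colP => i; rewrite [RHS]mxE.
  have i01 : 0 <= (0 : R) <= 1 by rewrite lexx ler01.
  have P1 := transported_prim i t0 z01; have P2 := transported_prim i t0 i01.
  rewrite (kappa0 lambda) in P2; apply: (etrans P1); apply/esym.
  have /andP[z0 z1] := z01.
  have xi (s : R) : 0 <= s -> mu.-integrable `[0, zeta] (EFin \o (fun y => x y s i 0)).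
    move=> s0; have := L2fun_integrable (measurable_itv _) (lebesgue_itv_lty _ _) (xLi i s0).
    exact: integrable_subitv.
  have -> : vint `[0, zeta] (fun y => x y 0 - x y t) i 0 =
      \int[mu]_(y in `[0, zeta]) x y 0 i 0 - \int[mu]_(y in `[0, zeta]) x y t i 0.
    rewrite /vint mxE -RintegralB//; [|exact: xi..].
    by apply: eq_Rintegral => y _; rewrite !mxE.
  rewrite (state_primitive i (lexx 0) z01) (state_primitive i t0 z01) mul0r !addr0.
  apply: (etrans (congr1 (fun u => u + _) P2)).
  by ring.
- by apply: ae_on_T => y _; rewrite opprB.
split => // phi phiL; rewrite ipX_sum//.
transitivity (\int[mu]_(s in `[0, t]) \sum_i \int[mu]_(y in `[0, 1]) (phi y i 0 * x y s i 0)).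
  have H i : mu.-integrable `[0, t] (EFin \o (fun s =>
      \int[mu]_(y in `[0, 1]) (phi y i 0 * x y s i 0))).
    by apply: phi_state_integrable => //; exact: phiL.
  have [_ ->] := Rintegral_sum (measurable_itv `[0, t]) H.
  apply: eq_bigr => i _; rewrite (@phi_state t i (fun y => phi y i 0))//; last exact: phiL.
  by apply: eq_Rintegral => y _; rewrite mxE.
apply: eq_Rintegral => s /[!inE]/=; rewrite in_itv/= => /andP[s0 _].
by rewrite ipX_sum//; exact: xX.
Qed.

End MildTransport.

(** * Boundary equations *)

Section VectorIntegrals.
Context {R : realType}.
Local Notation mu := (@lebesgue_measure R).

Definition integrable_vec (D : set R) n (v : R -> 'cV[R]_n) : Prop :=
  forall i, mu.-integrable D (EFin \o (fun s => v s i 0)).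

Lemma L2loc_integrable n (v : R -> 'cV[R]_n) (a b : R) : L2loc v -> 0 <= a ->
  integrable_vec `[a, b] v.
Proof.
move=> vL a0 i.
have := L2fun_integrable (measurable_itv _) (lebesgue_itv_lty _ _) (L2loc_L2fun vL i b).
exact: integrable_subitv.
Qed.

Lemma integrable_vec_mulmx (D : set R) m n (A : 'M[R]_(m, n)) (v : R -> 'cV[R]_n) :
  measurable D -> integrable_vec D v ->
  integrable_vec D (fun s => A *m v s) /\
  vint D (fun s => A *m v s) = A *m vint D v.
Proof.
move=> mD vi.
have H i := Rintegral_sum mD (fun j => integrableZR (A i j) mD (vi j)).
have E i : (fun s => (A *m v s) i 0) = (fun s => \sum_j A i j * v s j 0).
  by apply/funext => s; rewrite mxE.
split=> [i|]; first by rewrite E; exact: (H i).1.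
apply/colP => i; rewrite /vint mxE E (H i).2 mxE.
by apply: eq_bigr => j _; rewrite mxE RintegralZl//; exact: vi.
Qed.

Lemma integrable_vec_add (D : set R) n (v w : R -> 'cV[R]_n) :
  measurable D -> integrable_vec D v -> integrable_vec D w ->
  integrable_vec D (fun s => v s + w s) /\
  vint D (fun s => v s + w s) = vint D v + vint D w.
Proof.
move=> mD vi wi.
have E i : (fun s => (v s + w s) i 0) = (fun s => v s i 0 + w s i 0).
  by apply/funext => s; rewrite mxE.
split=> [i|]; first by rewrite E; exact: integrableDR.
by apply/colP => i; rewrite /vint !mxE E RintegralD.
Qed.

Lemma L2loc_time_scale n (v : R -> 'cV[R]_n) (T : R) : 0 < T ->
  L2loc v -> L2loc (fun r => v (r * T)).
Proof.
move=> T0 vL B B0 i.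
have sub := affine_substitution 0 (ltW B0) T0.
rewrite mulr0 addr0 addr0 in sub.
have := substitution_L2fun sub T0 (fun x _ => lexx T) (L2loc_L2fun vL i (T * B)).
by apply: L2fun_eq => r _; rewrite addr0 mulrC.
Qed.

Lemma vint_time_scale n (v : R -> 'cV[R]_n) (T t : R) : 0 < T -> 0 <= t ->
  L2loc v -> vint `[0, t] v = T *: vint `[0, t / T] (fun r => v (r * T)).
Proof.
move=> T0 t0 vL; have tT : 0 <= t / T by rewrite divr_ge0// ltW.
have sub := affine_substitution 0 tT T0.
rewrite mulr0 !addr0 (mulrC T) divfK ?gt_eqF// in sub.
apply/colP => i; rewrite /vint !mxE.
have vi := L2loc_integrable t vL (lexx 0) i.
have wi := L2loc_integrable (t / T) (L2loc_time_scale T0 vL) (lexx 0) i.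
rewrite (substitution_Rintegral sub vi) -RintegralZl//.
by apply: eq_Rintegral => r _; rewrite addr0 [T * r]mulrC.
Qed.

Lemma L2loc_shift n (v : R -> 'cV[R]_n) (s : R) : 0 <= s ->
  L2loc v -> L2loc (fun r => v (s + r)).
Proof.
move=> s0 vL B B0 i.
have := @L2fun_shift R 0 B s (fun r => v r i 0) (ltW B0).
rewrite add0r => H.
apply: (L2fun_eq (f := fun x => v (x + s) i 0)); first by move=> r _; rewrite addrC.
apply: H; apply: L2fun_sub_set (L2loc_L2fun vL i (B + s)) => //.
by apply: subset_itv; rewrite bnd_simp.
Qed.

Lemma vint_shift n (v : R -> 'cV[R]_n) (s t : R) : 0 <= s -> 0 <= t ->
  L2loc v -> vint `[s, s + t] v = vint `[0, t] (fun r => v (s + r)).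
Proof.
move=> s0 t0 vL; have sub := shift_substitution s t0.
rewrite add0r (addrC t) in sub.
apply/colP => i; rewrite /vint !mxE.
rewrite (substitution_Rintegral sub (L2loc_integrable _ vL s0 i)).
by apply: eq_Rintegral => r _; rewrite mul1r addrC.
Qed.

Lemma ae_on_countable (D : set R) (P : nat -> R -> Prop) :
  (forall j, ae_on D (P j)) -> ae_on D (fun x => forall j, P j x).
Proof.
move=> h; have /choice[N hN] : forall j, exists N : set (measurableTypeR R),
    [/\ measurable N, mu N = 0%E & ~` [set x | D x -> P j x] `<=` N].
  by move=> j; have [N [mN N0 PN]] := h j; exists N.
have [B [mB B0 NB]] : mu.-negligible (\bigcup_j N j).
  apply: negligible_bigcup => j; have [mN N0 _] := hN j.
  by exists (N j); split.
exists B; split => // x /= nP; apply: NB; apply: contrapT => nN.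
apply: nP => Dx j; apply: contrapT => nPj; apply: nN; exists j => //.
by have [_ _] := hN j; apply => /(_ Dx).
Qed.

(** A countable union of null sets is null, and each r >= 0 lies in the unit interval that starts at
    its integer part. *)
Lemma ae_on_pieces (P : R -> Prop) :
  (forall j : nat, ae_on `[0, 1] (fun z => P (j%:R + z))) <-> ae_on `[0, +oo[ P.
Proof.
split=> [h|h j]; last first.
  have sub := shift_substitution j%:R (@ler01 R).
  have hj : ae_on `[0 + j%:R, 1 + j%:R] P.
    apply: ae_on_subset h => x /=; rewrite !in_itv/= andbT => /andP[+ _].
    by apply: le_trans; rewrite add0r.
  by apply: ae_onS (substitution_ae sub hj) => x _; rewrite addrC.
have h' (j : nat) : ae_on setT (fun x => j%:R <= x <= j.+1%:R -> P x).
  have jj : (j%:R : R) <= j.+1%:R by rewrite ler_nat.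
  have sub := shift_substitution (- j%:R) jj.
  rewrite subrr -natr1 addrAC subrr add0r in sub.
  have := substitution_ae sub (h j).
  apply: (@filterS _ _ (ae_filter_ringOfSetsType mu)) => x /= hx _ xj.
  have := hx; rewrite /= in_itv/= natr1 => /(_ xj).
  by rewrite addrC subrK.
have := ae_on_countable h'.
apply: (@filterS _ _ (ae_filter_ringOfSetsType mu)) => x /= hx.
rewrite in_itv/= andbT => x0; apply: (hx I (Num.truncn x)).
by apply/andP; split; [rewrite truncn_le|exact/ltW/truncnS_gt].
Qed.

Lemma vint_eq0 n (G : R -> 'cV[R]_n) : (forall B, integrable_vec `[0, B] G) ->
  (forall t, 0 <= t -> vint `[0, t] G = 0) <-> ae_on `[0, +oo[ (fun r => G r = 0).
Proof.
move=> Gi; split=> [h|h t t0].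
  have H i B : 0 <= B -> ae_on `[0, B] (fun r => G r i 0 = 0).
    move=> B0; apply: primitive_eq0_ae; first exact: Gi.
    by move=> s /andP[s0 _]; have /colP/(_ i) := h s s0; rewrite /vint !mxE.
  apply/ae_on_pieces => j.
  have j1 : (0 : R) <= j.+1%:R by [].
  have {}H : ae_on `[0, j.+1%:R] (fun r => G r = 0).
    have := ae_on_forall (fun i => H i _ j1); apply: ae_onS => r _ Gr.
    by apply/colP => i; rewrite Gr mxE.
  have sub := shift_substitution j%:R (@ler01 R).
  have hj : ae_on `[0 + j%:R, 1 + j%:R] (fun r => G r = 0).
    apply: ae_on_subset H => x /=; rewrite !in_itv/= add0r -natr1 (addrC 1).
    by move=> /andP[jx ->]; rewrite (le_trans _ jx).
  by apply: ae_onS (substitution_ae sub hj) => x _; rewrite addrC.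
apply/colP => i; rewrite /vint !mxE.
have sub : `[0, t] `<=` `[(0:R), +oo[ by apply: subset_itvl.
rewrite (@ae_eq_Rintegral _ _ _ (fun=> 0))// ?Rintegral_cst ?mul0r//.
  exact: integrable_measurable (Gi t i).
by apply: ae_onS (ae_on_subset sub h) => r _ ->; rewrite mxE.
Qed.

(** After time scaling, and a shift of [1, 1 + t / T] to [0, t / T], both sides are T times
    integrals over [0, t / T]. The equation for all t thus says that the primitive of [G] vanishes,
    which means that [G] vanishes almost everywhere. *)
Lemma boundary_equation n q (K L : 'M[R]_(q, n)) (g : R -> 'cV[R]_q)
    (f : R -> 'cV[R]_n) (T : R) : 0 < T -> L2loc g -> L2loc f ->
  (forall t, 0 <= t -> vint `[0, t] g =
     - (K *m (T *: vint `[1, 1 + t / T] f)) - L *m (T *: vint `[0, t / T] f)) <->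
  ae_on `[0, +oo[ (fun r => g (r * T) = - (K *m f (1 + r)) - L *m f r).
Proof.
move=> T0 gL fL; have gTL := L2loc_time_scale T0 gL.
have f1L := L2loc_shift ler01 fL.
pose G r := g (r * T) + (K *m f (1 + r) + L *m f r).
have mB B : measurable `[(0 : R), B] by [].
have GE B : 0 <= B -> integrable_vec `[0, B] G /\ vint `[0, B] G =
    vint `[0, B] (fun r => g (r * T)) + (K *m vint `[1, 1 + B] f + L *m vint `[0, B] f).
  move=> B0; rewrite (vint_shift ler01 B0 fL).
  have [i1 e1] := integrable_vec_mulmx K (mB B) (L2loc_integrable B f1L (lexx 0)).
  have [i2 e2] := integrable_vec_mulmx L (mB B) (L2loc_integrable B fL (lexx 0)).
  have [i3 e3] := integrable_vec_add (mB B) i1 i2.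
  have [i4 e4] := integrable_vec_add (mB B) (L2loc_integrable B gTL (lexx 0)) i3.
  by rewrite -e1 -e2 -e3.
have Gi B : integrable_vec `[0, B] G.
  have B0 : 0 <= Num.max B 0 by rewrite le_max lexx orbT.
  move=> i; apply: integrable_subitv ((GE _ B0).1 i) => //.
  by rewrite le_max lexx.
have equ : (forall t, 0 <= t -> vint `[0, t] g =
     - (K *m (T *: vint `[1, 1 + t / T] f)) - L *m (T *: vint `[0, t / T] f)) <->
   (forall t, 0 <= t -> vint `[0, t] G = 0).
  split=> h t t0.
    have tT : 0 <= t * T by rewrite mulr_ge0// ltW.
    have := h _ tT; rewrite (vint_time_scale T0 tT gL) mulfK ?gt_eqF//.
    rewrite -!scalemxAr -scalerN -scalerBr => /(scalerI (lt0r_neq0 T0)) E.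
    by rewrite (GE _ t0).2 E -opprD addNr.
  have tT : 0 <= t / T by rewrite divr_ge0// ltW.
  rewrite (vint_time_scale T0 t0 gL) -!scalemxAr -scalerN -scalerBr; congr (_ *: _).
  have := h _ tT; rewrite (GE _ tT).2 => /eqP; rewrite addr_eq0 => /eqP ->.
  by rewrite opprD.
rewrite equ (vint_eq0 Gi); split; apply: ae_onS => r _; rewrite /G.
  by move=> /eqP; rewrite addr_eq0 => /eqP ->; rewrite opprD.
by move=> ->; rewrite -opprD addNr.
Qed.

End VectorIntegrals.

(** * The inverse of kappa as a change of variables *)

Section InverseSubstitution.
Context {R : realType}.
Variables (lambda : R -> R) (eps M : R).
Hypotheses (eps0 : 0 < eps) (mlambda : measurable_fun setT lambda).
Hypothesis lambda_bounds : forall x, eps <= lambda x <= M.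
Local Notation T := (tau lambda 1).
Local Notation kap := (kappa lambda).
Local Notation sigma := (kappa_inv lambda).
Let T0 : 0 < T := tau1_gt0 eps0 mlambda lambda_bounds.
Let lambda_gt0 (x : R) : 0 < lambda x.
Proof. by have /andP[] := lambda_bounds x => /(lt_le_trans eps0). Qed.
Let sigmaP := kappa_invP eps0 mlambda lambda_bounds.

Lemma kappa_unit_substitution :
  substitution 0 1 0 1 kap (fun x => (lambda x)^-1 / T).
Proof.
have := kappa_substitution eps0 mlambda lambda_bounds (lexx 0) ler01 (lexx 1).
by rewrite (kappa0 lambda) (kappa1 eps0 mlambda lambda_bounds).
Qed.

(** Applying the rule for [kappa] to the right-hand side makes the weights cancel: T lambda(sigma
    (kap x)) times (lambda x)^-1 / T is 1. *)
Lemma kappa_inv_substitution :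
  substitution 0 1 0 1 sigma (fun r => T * lambda (sigma r)).
Proof.
have ms := measurable_kappa_inv eps0 mlambda lambda_bounds.
have s01 (r : R) : 0 <= r <= 1 -> 0 <= sigma r <= 1 by move=> /sigmaP[].
have simg : sigma @` `[0, 1] `<=` `[(0:R), 1].
  by move=> _ /= [r + <-]; rewrite !in_itv/=; exact: s01.
have ml : measurable_fun `[(0 : R), 1] (fun r => T * lambda (sigma r)).
  apply: measurable_funM => //; apply: (measurable_comp (F := `[(0 : R), 1]%classic)) => //.
  exact: measurable_funTS.
split => //; first by move=> x _; exact: mulr_gt0.
move=> g mg g0; have [_ _ _ _ cv] := kappa_unit_substitution.
rewrite [RHS]cv; last 2 first.
- apply: emeasurable_funM; first exact/measurable_EFinP.
  exact: (measurable_comp (F := `[(0 : R), 1]%classic)).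
- move=> y y01; rewrite mule_ge0//; first by rewrite lee_fin ltW// mulr_gt0.
  by apply: g0; exact: s01.
apply: eq_integral => x /[!inE]/=; rewrite in_itv/= => x01.
rewrite (kappaK eps0 mlambda lambda_bounds x01) muleA -EFinM.
rewrite (_ : _ * _ = 1) ?mul1e//.
by field; rewrite !gt_eqF.
Qed.

Lemma ae_on_kappa (P : R -> Prop) :
  ae_on `[0, 1] (fun x => P (kap x)) <-> ae_on `[0, 1] P.
Proof.
split=> [h|]; last exact: (substitution_ae kappa_unit_substitution).
apply: ae_onS (substitution_ae kappa_inv_substitution h) => r /=.
by rewrite in_itv/= => /sigmaP[_ ->].
Qed.

Lemma L2fun_kappa_inv (g : R -> R) : L2fun `[0, 1] g ->
  L2fun `[0, 1] (fun r => g (sigma r)).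
Proof.
apply: (substitution_L2fun kappa_inv_substitution (delta := T * eps)).
  exact: mulr_gt0.
by move=> r _; rewrite ler_pM2l//; have /andP[] := lambda_bounds (sigma r).
Qed.

End InverseSubstitution.

(** * Equivalence of the two systems when xd 0 agrees with f *)

Section Equivalence.
Context {R : realType}.
Variables (lambda : R -> R) (eps M : R).
Hypotheses (eps0 : 0 < eps) (mlambda : measurable_fun setT lambda).
Hypothesis lambda_bounds : forall x, eps <= lambda x <= M.
Local Notation T := (tau lambda 1).
Let T0 : 0 < T := tau1_gt0 eps0 mlambda lambda_bounds.
Let lambda_gt0 (x : R) : 0 < lambda x.
Proof. by have /andP[] := lambda_bounds x => /(lt_le_trans eps0). Qed.
Variables (n p k m l : nat) (E : 'M[R]_(n, k)) (K L : 'M[R]_n)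
  (Ky Ly : 'M[R]_(m, n)) (Kz Lz : 'M[R]_(l, n)) (x0 : R -> 'cV[R]_n).
Hypothesis hK : K \in unitmx.
Local Notation J := (@lower_id R n p).

(* With [g = E d + (0; I) u] and the matrix pairs [(K, L)], [(Kz, Lz)],
   [(Ky, Ly)], each boundary equation takes the form treated in
   [boundary_equation]. *)
Definition boundary_ae (f : R -> 'cV[R]_n) (d : R -> 'cV[R]_k) (u : R -> 'cV[R]_p)
    (z : R -> 'cV[R]_l) (y : R -> 'cV[R]_m) : Prop :=
  ae_on `[0, +oo[ (fun r =>
    [/\ E *m d (r * T) + J *m u (r * T) = - (K *m f (1 + r)) - L *m f r,
        z (r * T) = - (Kz *m f (1 + r)) - Lz *m f r &
        y (r * T) = - (Ky *m f (1 + r)) - Ly *m f r]).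

(** Invertibility of K lets the boundary condition be solved for [f1]; inserting the solution into
    the two outputs produces the remaining matrices of the discrete-time system. *)
Lemma boundary_solve (f0 f1 : 'cV[R]_n) (dv : 'cV[R]_k) (uv : 'cV[R]_p)
    (zv : 'cV[R]_l) (yv : 'cV[R]_m) :
  [/\ E *m dv + J *m uv = - (K *m f1) - L *m f0,
      zv = - (Kz *m f1) - Lz *m f0 & yv = - (Ky *m f1) - Ly *m f0] <->
  [/\ f1 = - (invmx K *m L) *m f0 + - (invmx K *m E) *m dv + - (invmx K *m J) *m uv,
      zv = (Kz *m invmx K *m L - Lz) *m f0 + Kz *m invmx K *m E *m dv +
           Kz *m invmx K *m J *m uv &
      yv = (Ky *m invmx K *m L - Ly) *m f0 + Ky *m invmx K *m E *m dv +
           Ky *m invmx K *m J *m uv].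
Proof.
have eqv : E *m dv + J *m uv = - (K *m f1) - L *m f0 <->
    f1 = - (invmx K *m L) *m f0 + - (invmx K *m E) *m dv + - (invmx K *m J) *m uv.
  split=> H.
    rewrite !mulNmx -!mulmxA -!opprD -!mulmxDr -addrA H.
    by rewrite addrCA subrr addr0 mulmxN opprK mulKmx.
  have -> : K *m f1 = - (L *m f0 + E *m dv + J *m uv).
    by rewrite H !mulNmx -!mulmxA -!opprD -!mulmxDr mulmxN mulKVmx.
  by rewrite opprK -(addrA (L *m f0)) (addrC (L *m f0)) addrK.
have out q (A B : 'M[R]_(q, n)) :
    f1 = - (invmx K *m L) *m f0 + - (invmx K *m E) *m dv + - (invmx K *m J) *m uv ->
    - (A *m f1) - B *m f0 = (A *m invmx K *m L - B) *m f0 +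
      A *m invmx K *m E *m dv + A *m invmx K *m J *m uv.
  move=> ->; set F := (X in - (A *m X)).
  have -> : A *m F = - (A *m invmx K *m L *m f0 + A *m invmx K *m E *m dv +
      A *m invmx K *m J *m uv).
    by rewrite /F !mulNmx -!opprD mulmxN !mulmxDr !mulmxA.
  rewrite opprK mulmxBl -!addrA; congr (_ + _).
  by rewrite addrA addrC.
split.
  move=> [/eqv H -> ->]; split => //; exact: out.
by move=> [H -> ->]; split; [exact/eqv|rewrite out..].
Qed.

(** The relation already makes x transported, so being a mild solution reduces to the boundary
    equations; on unit intervals, and solved at each point, these are the discrete-time equations.
    The initial conditions and the value of xd 0 are assumed here and are linked to each other in
    [related_initial]. *)
Lemma related_systems x d u z y f xd dd ud zd yd :
  ct_variables x d u z y ->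
  related lambda x d u z y f xd dd ud zd yd ->
  ae_on `[0, 1] (fun zeta => xd 0%N zeta = f zeta) ->
  ct_initial x0 x -> dt_initial lambda x0 xd ->
  ct_system lambda E K L Ky Ly Kz Lz x0 x d u z y <->
  dt_system lambda (- (invmx K *m L)) (- (invmx K *m E)) (- (invmx K *m J))
    (Kz *m invmx K *m L - Lz) (Ky *m invmx K *m L - Ly)
    (Kz *m invmx K *m E) (Kz *m invmx K *m J)
    (Ky *m invmx K *m E) (Ky *m invmx K *m J) x0 xd dd ud zd yd.
Proof.
move=> [xX dL uL zL yL] [fL fx fxd [sd su] [sz sy]] xd0 ct0 dt0.
have xdf j : ae_on `[0, 1] (fun zeta => xd j zeta = f (j%:R + zeta)).
  case: j => [|j]; last exact: fxd.
  by apply: ae_onS xd0 => zeta _ ->; rewrite add0r.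
have mI a b : measurable `[(a : R), b] by [].
pose g s := E *m d s + J *m u s.
have gE (t : R) : vint `[0, t] g = E *m vint `[0, t] d + J *m vint `[0, t] u.
  have [i1 e1] := integrable_vec_mulmx E (mI 0 t) (L2loc_integrable t dL (lexx 0)).
  have [i2 e2] := integrable_vec_mulmx J (mI 0 t) (L2loc_integrable t uL (lexx 0)).
  by rewrite /g (integrable_vec_add (mI 0 t) i1 i2).2 e1 e2.
have L2loc_mulmx q r (A : 'M[R]_(q, r)) (v : R -> 'cV[R]_r) :
    L2loc v -> L2loc (fun s => A *m v s).
  move=> vL B B0 i; apply: (L2fun_eq (f := fun s => \sum_j A i j * v s j 0)).
    by move=> s _; rewrite mxE.
  apply: L2fun_sum => //; first exact: lebesgue_itv_lty.
  by move=> j; apply: L2fun_scale => //; exact: (vL B B0 j).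
have gL : L2loc g.
  move=> B B0 i; apply: (L2fun_eq (f := fun s => (E *m d s) i 0 + (J *m u s) i 0)).
    by move=> s _; rewrite /g [RHS]mxE.
  by apply: L2fun_add => //; [exact: (L2loc_mulmx _ _ E d dL B B0 i)|
    exact: (L2loc_mulmx _ _ J u uL B B0 i)].
have B1 := boundary_equation K L T0 gL fL.
have B2 := boundary_equation Kz Lz T0 zL fL.
have B3 := boundary_equation Ky Ly T0 yL fL.
(* As kappa 0 = 1 and kappa 1 = 0, the inflow trace reads f one unit ahead of the outflow trace. *)
have traces (w : R -> 'cV[R]_n) t : 0 <= t ->
    (forall zeta : R, 0 <= zeta <= 1 -> w zeta = transported lambda f t zeta) ->
    w 0 = T *: vint `[1, 1 + t / T] f /\ w 1 = T *: vint `[0, t / T] f.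
  move=> t0 wE; rewrite !wE ?lexx ?ler01// /transported (kappa0 lambda).
  by rewrite (kappa1 eps0 mlambda lambda_bounds) add0r.
have ct_bd : ct_system lambda E K L Ky Ly Kz Lz x0 x d u z y <->
    boundary_ae f d u z y.
  split=> [[_ _ H]|H].
    have {}H t : 0 <= t -> [/\ vint `[0, t] g =
        - (K *m (T *: vint `[1, 1 + t / T] f)) - L *m (T *: vint `[0, t / T] f),
        vint `[0, t] z =
        - (Kz *m (T *: vint `[1, 1 + t / T] f)) - Lz *m (T *: vint `[0, t / T] f) &
        vint `[0, t] y =
        - (Ky *m (T *: vint `[1, 1 + t / T] f)) - Ly *m (T *: vint `[0, t / T] f)].
      move=> t0; have [I [w [v [xI [wv wI] xv bd [bz bY]]]]] := H t t0.
      have wE := mild_representative eps0 mlambda lambda_bounds fL xX fx t0 xI wv wI.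
      have [w0 w1] := traces w t t0 wE.
      by rewrite gE bd bz bY w0 w1.
    have H1 := B1.1 (fun t t0 => let: And3 h _ _ := H t t0 in h).
    have H2 := B2.1 (fun t t0 => let: And3 _ h _ := H t t0 in h).
    have H3 := B3.1 (fun t t0 => let: And3 _ _ h := H t t0 in h).
    by apply: ae_onS (ae_onI H1 (ae_onI H2 H3)) => r _ [h1 [h2 h3]].
  have H1 := B1.2 (ae_onS (fun r _ (h : [/\ _, _ & _]) => let: And3 h _ _ := h in h) H).
  have H2 := B2.2 (ae_onS (fun r _ (h : [/\ _, _ & _]) => let: And3 _ h _ := h in h) H).
  have H3 := B3.2 (ae_onS (fun r _ (h : [/\ _, _ & _]) => let: And3 _ _ h := h in h) H).
  split => //; first exact: (mild_continuous eps0 mlambda lambda_bounds fL xX fx).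
  move=> t t0; have [I [w [v [xI [wv wI] xv]]]] :=
    mild_representative_exists eps0 mlambda lambda_bounds fL xX fx t0.
  exists I, w, v.
  have wE := mild_representative eps0 mlambda lambda_bounds fL xX fx t0 xI wv wI.
  have [w0 w1] := traces w t t0 wE.
  by split => //; rewrite -?gE w0 w1; [exact: H1|split; [exact: H2|exact: H3]].
(* At r = j + zeta, f(r) is sampled as xd j and f(1 + r) as xd j.+1. *)
have step j : ae_on `[0, 1] (fun zeta => let r := j%:R + zeta in
    [/\ E *m d (r * T) + J *m u (r * T) = - (K *m f (1 + r)) - L *m f r,
        z (r * T) = - (Kz *m f (1 + r)) - Lz *m f r &
        y (r * T) = - (Ky *m f (1 + r)) - Ly *m f r]) <->
  ae_on `[0, 1] (fun zeta =>
    [/\ xd j.+1 zeta = - (invmx K *m L) *m xd j zeta +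
          - (invmx K *m E) *m dd j zeta + - (invmx K *m J) *m ud j zeta,
        zd j zeta = (Kz *m invmx K *m L - Lz) *m xd j zeta +
          Kz *m invmx K *m E *m dd j zeta + Kz *m invmx K *m J *m ud j zeta &
        yd j zeta = (Ky *m invmx K *m L - Ly) *m xd j zeta +
          Ky *m invmx K *m E *m dd j zeta + Ky *m invmx K *m J *m ud j zeta]).
  have A := ae_onI (xdf j) (ae_onI (xdf j.+1) (ae_onI (sd j)
    (ae_onI (su j) (ae_onI (sz j) (sy j))))).
  split=> H; apply: ae_onS (ae_onI H A) => zeta _ /= [h [x1 [x2 [h1 [h2 [h3 h4]]]]]].
    rewrite addrA [1 + _]addrC natr1 in h.
    by rewrite x1 x2 h1 h2 h3 h4; exact/boundary_solve.
  rewrite x1 x2 h1 h2 h3 h4 in h.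
  by rewrite addrA [1 + _]addrC natr1; exact/boundary_solve.
rewrite ct_bd; split=> [H|[_ H]].
  split => // j; have Hj := (step j).1 ((ae_on_pieces _).2 H j).
  by split; apply: ae_onS Hj => zeta _ [].
apply/ae_on_pieces => j; apply/step; have [h1 h2 h3] := H j.
by apply: ae_onS (ae_onI h1 (ae_onI h2 h3)) => zeta _ [? [? ?]].
Qed.

End Equivalence.

(** * Cutting and gluing at the integers *)

Section Glue.
Context {R : realType}.

(** At an integer j the value is that of v j at 0, not that of the preceding piece at 1; hence the
    strict bound z < 1 in [glueE], which costs only a null set. *)
Definition glue (A : Type) (v : nat -> R -> A) (r : R) : A :=
  v (Num.truncn r) (r - (Num.truncn r)%:R).

Lemma glueE (A : Type) (v : nat -> R -> A) (j : nat) (z : R) :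
  0 <= z < 1 -> glue v (j%:R + z) = v j z.
Proof.
move=> /andP[z0 z1]; rewrite /glue.
have -> : Num.truncn (j%:R + z) = j.
  by apply/truncn_def; rewrite lerDl z0 -natr1 ltrD2l z1.
by rewrite addrAC subrr add0r.
Qed.

Lemma L2fun_setU (D1 D2 : set R) (h : R -> R) : measurable D1 -> measurable D2 ->
  L2fun D1 h -> L2fun D2 h -> L2fun (D1 `|` D2) h.
Proof.
move=> m1 m2 h1 h2; have mT : measurable [set: R] by [].
have toT (D : set R) : L2fun D h -> L2fun setT (h \_ D).
  by rewrite /L2fun patch_setT.
(* Removing D1 makes the pieces disjoint, so that their extensions by 0 add up to that of the
   union. *)
have h2' : L2fun (D2 `\` D1) h.
  by apply: L2fun_sub_set h2 => //; exact: measurableD.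
have := L2fun_add mT (toT _ h1) (toT _ h2').
rewrite /L2fun patch_setT (_ : (fun x => _) = h \_ (D1 `|` D2))//; apply/funext => x.
rewrite !patchE !in_setU !in_setD.
by case: (x \in D1); case: (x \in D2); rewrite ?addr0 ?add0r.
Qed.

Lemma L2fun_glue (v : nat -> R -> R) (B : R) :
  (forall j, L2fun `[0, 1] (v j)) -> L2fun `[0, B] (glue v).
Proof.
move=> vL.
(* On half-open pieces the glued function is exactly a shift of v j. *)
have piece j : L2fun `[j%:R, j.+1%:R[ (glue v).
  have jj : (j%:R : R) <= j.+1%:R by rewrite ler_nat.
  have H := @L2fun_shift R j%:R j.+1%:R (- j%:R) (v j) jj.
  rewrite subrr -natr1 addrAC subrr add0r in H.
  apply: (L2fun_eq (f := fun r => v j (r - j%:R))); last first.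
    apply: L2fun_sub_set (H (vL j)) => //.
    by rewrite natr1; apply: subset_itvl; rewrite bnd_simp.
  move=> r /[!inE]/=; rewrite in_itv/= => /andP[r0 r1].
  rewrite -{2}(subrKC j%:R r) glueE//.
  by rewrite subr_ge0 r0 ltrBlDr addrC natr1.
have all_ N : L2fun `[0, N%:R[ (glue v).
  elim: N => [|N ih].
    rewrite set_itvco0; apply: (L2fun_eq (f := fun=> 0)) => [r /[!inE]//|].
    by apply: L2fun_cst; rewrite ?measure0.
  have -> : `[(0 : R), N.+1%:R[%classic = `[0, N%:R[ `|` `[N%:R, N.+1%:R[.
    apply/seteqP; split=> r /=; rewrite !in_itv/=.
      by move=> /andP[r0 rN]; have [h|h] := ltP r N%:R; [left; rewrite r0|right].
    have NN : (N%:R : R) <= N.+1%:R by rewrite ler_nat.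
    by case=> /andP[r0 rN]; [rewrite r0 (lt_le_trans rN)|rewrite rN (le_trans _ r0)].
  exact: L2fun_setU.
apply: L2fun_sub_set (all_ (Num.truncn B).+1) => //.
by apply: subset_itvl; rewrite bnd_simp truncnS_gt.
Qed.

Lemma L2loc_glue n (v : nat -> R -> 'cV[R]_n) :
  (forall j, L2on `[0, 1] (v j)) -> L2loc (glue v).
Proof. by move=> vL B B0 i; apply: (L2fun_glue (v := fun j r => v j r i 0)) => j; exact: vL. Qed.

Lemma glue_ae (A : Type) (v : nat -> R -> A) j :
  ae_on `[0, 1] (fun zeta => v j zeta = glue v (j%:R + zeta)).
Proof.
apply: ae_on_itv_ends; apply: ae_on_T => z /=; rewrite in_itv/= => /andP[z0 z1].
by rewrite glueE// ltW.
Qed.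

End Glue.

Section FromDiscrete.
Context {R : realType}.
Variables (lambda : R -> R) (eps M : R).
Hypotheses (eps0 : 0 < eps) (mlambda : measurable_fun setT lambda).
Hypothesis lambda_bounds : forall x, eps <= lambda x <= M.
Local Notation T := (tau lambda 1).
Local Notation kap := (kappa lambda).
Let T0 : 0 < T := tau1_gt0 eps0 mlambda lambda_bounds.
Let lambda_gt0 (x : R) : 0 < lambda x.
Proof. by have /andP[] := lambda_bounds x => /(lt_le_trans eps0). Qed.

Lemma related_from_discrete n p k m l (x0 : R -> 'cV[R]_n)
    (xd : nat -> R -> 'cV[R]_n) (dd : nat -> R -> 'cV[R]_k)
    (ud : nat -> R -> 'cV[R]_p) (zd : nat -> R -> 'cV[R]_l)
    (yd : nat -> R -> 'cV[R]_m) :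
  dt_variables xd dd ud zd yd -> dt_initial lambda x0 xd ->
  exists x d u z y f,
    [/\ ct_variables x d u z y, related lambda x d u z y f xd dd ud zd yd,
        ae_on `[0, 1] (fun zeta => xd 0%N zeta = f zeta) & ct_initial x0 x].
Proof.
move=> dv dt0.
(* f is glued from all the xd j, xd 0 included, and the transport formula is taken as the definition
   of x. The initial condition for x is then the one for xd 0, read through [kappa]. *)
pose f := glue xd; pose x zeta t := (lambda zeta)^-1 *: f (kap zeta + T^-1 * t).
have TV : 0 < T^-1 by rewrite invr_gt0.
have fL : L2loc f by apply: L2loc_glue => j; have [] := dv j.
exists x, (fun s => glue dd (s / T)), (fun s => glue ud (s / T)),
  (fun s => glue zd (s / T)), (fun s => glue yd (s / T)), f.
have xd0 : ae_on `[0, 1] (fun zeta => xd 0%N zeta = f zeta).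
  by apply: ae_onS (glue_ae xd 0) => z _; rewrite add0r.
have samp q (v : nat -> R -> 'cV[R]_q) : sampled T v (fun s => glue v (s / T)).
  by move=> j; apply: ae_onS (glue_ae v j) => z _; rewrite mulfK// gt_eqF.
split => //.
- split; try (by apply: L2loc_time_scale => //; apply: L2loc_glue => j; have [] := dv j).
  move=> t t0 i; have tT : 0 <= T^-1 * t by rewrite mulr_ge0// ltW.
  apply: (L2fun_eq (f := fun y => (lambda y)^-1 * f (kap y + T^-1 * t) i 0)).
    by move=> y _; rewrite /x mxE.
  exact: (L2fun_characteristic eps0 mlambda lambda_bounds (L2loc_L2fun fL i) tT).
- split => //.
  + by move=> t t0; apply: ae_on_T => z _; rewrite /x scalerA divff ?scale1r// gt_eqF.
  + by move=> j _; exact: glue_ae.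
- have := (ae_on_kappa eps0 mlambda lambda_bounds _).2 xd0.
  move=> H; apply: ae_onS (ae_onI H dt0) => z _ [e1 e2].
  by rewrite /x mulr0 addr0 -e1 e2 scalerA mulVf ?scale1r// gt_eqF.
Qed.

End FromDiscrete.

(** * Mild solutions are transported *)

Section ScalarRepresentation.
Context {R : realType}.
Local Notation mu := (@lebesgue_measure R).
Variables (lambda : R -> R) (eps M : R).
Hypotheses (eps0 : 0 < eps) (mlambda : measurable_fun setT lambda).
Hypothesis lambda_bounds : forall x, eps <= lambda x <= M.
Local Notation c := (fun x => (lambda x)^-1).
Local Notation T := (tau lambda 1).
Local Notation kap := (kappa lambda).
Local Notation sigma := (kappa_inv lambda).
Let T0 : 0 < T := tau1_gt0 eps0 mlambda lambda_bounds.
Let lambda_gt0 (x : R) : 0 < lambda x.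
Proof. by have /andP[] := lambda_bounds x => /(lt_le_trans eps0). Qed.
Let sigmaP := kappa_invP eps0 mlambda lambda_bounds.

Variable g : R -> R -> R.
Hypothesis gL : forall s : R, 0 <= s -> L2fun `[0, 1] (g^~ s).
Hypothesis gc : forall t : R, 0 <= t -> forall e : R, 0 < e -> exists2 d : R, 0 < d &
  forall s : R, 0 <= s -> `|s - t| < d ->
    \int[mu]_(y in `[0, 1]) (g y s - g y t) ^+ 2 <= e.
Hypothesis gm : forall t : R, 0 <= t -> exists w I : R -> R,
  [/\ L2fun `[0, 1] I, ae_on `[0, 1] (fun y => w y = lambda y * I y),
      forall y : R, 0 <= y <= 1 ->
        w y = w 1 + (\int[mu]_(q in `[y, 1]) g q t - \int[mu]_(q in `[y, 1]) g q 0) &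
      forall y : R, 0 <= y <= 1 ->
        \int[mu]_(q in `[y, 1]) I q =
        \int[mu]_(s in `[0, t]) \int[mu]_(q in `[y, 1]) g q s].

Let A (y s : R) : R := \int[mu]_(q in `[y, 1]) g q s.

Let gi (y s : R) : 0 <= s -> 0 <= y -> mu.-integrable `[y, 1] (EFin \o g^~ s).
Proof.
move=> s0 y0; have := L2fun_integrable (measurable_itv _) (lebesgue_itv_lty _ _) (gL s0).
exact: integrable_subitv.
Qed.

Lemma tail_time_cont (t e : R) : 0 <= t -> 0 < e -> exists2 d : R, 0 < d &
  forall s : R, 0 <= s -> `|s - t| < d ->
    forall y : R, 0 <= y <= 1 -> `|A y s - A y t| <= e.
Proof.
move=> t0 e0; have e2 : 0 < (e / 2) ^+ 2 by rewrite exprn_gt0// divr_gt0.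
have [d d0 h] := gc t0 e2; exists d => // s s0 st y /andP[y0 y1].
have hD := L2fun_sub (measurable_itv _) (gL s0) (gL t0).
have hDi := L2fun_integrable (measurable_itv _) (lebesgue_itv_lty _ _) hD.
have hDn := integrable_normR hDi.
rewrite /A -RintegralB//; [|exact: gi|exact: gi].
have hDy := integrable_subitv y0 (lexx 1) hDi.
apply: (@le_trans _ _ (\int[mu]_(q in `[y, 1]) `|g q s - g q t|)).
  exact: le_normr_Rintegral.
apply: (@le_trans _ _ (\int[mu]_(q in `[0, 1]) `|g q s - g q t|)).
  exact: Rintegral_subitv_le.
have [_ h2] := (L2funP _ (measurable_itv _)).1 hD.
have i1 := @integrable_cstR R `[0, 1] (e / 2) (measurable_itv _) (lebesgue_itv_lty _ _).
have i2 := integrableZR (e / 2)^-1 (measurable_itv _) h2.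
have e20 : 0 < e / 2 by rewrite divr_gt0.
(* From L^2 to L^1 through a <= delta + delta^-1 a^2 with delta = e / 2: a bound (e / 2)^2 on the
   integral of a^2 is enough. *)
apply: (@le_trans _ _ (\int[mu]_(q in `[0, 1]) (e / 2 + (e / 2)^-1 * (g q s - g q t) ^+ 2))).
  apply: le_Rintegral => //; first exact: integrableDR.
  move=> q _; rewrite -(real_normK (num_real (g q s - g q t))).
  set a := `|_|; have a0 : 0 <= a by exact: normr_ge0.
  have [ae|ae] := leP a (e / 2).
    by rewrite (le_trans ae)// lerDl mulr_ge0 ?sqr_ge0// invr_ge0 ltW.
  apply: (@le_trans _ _ ((e / 2)^-1 * a ^+ 2)); last by rewrite lerDr ltW.
  by rewrite ler_pdivlMl// expr2 ler_wpM2r// ltW.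
rewrite RintegralD// Rintegral_itv_cst// subr0 mulr1 RintegralZl//.
by rewrite [leRHS](splitr e) lerD2l ler_pdivrMl// -expr2; exact: h.
Qed.

Let A_cont (y N : R) : 0 <= y <= 1 -> cont_on 0 N (A y).
Proof.
move=> y01 s /andP[s0 _] e e0; have [d d0 h] := tail_time_cont s0 e0.
by exists d => // s' /andP[s'0 _] ss; exact: h.
Qed.

(** T^-1 is the factor in the weight c / T of [kappa]: in that coordinate this is the integral of
    the flux over [0, r] at time t T, as [QE] confirms. *)
Let Q (r t : R) : R := T^-1 * A (sigma r) (t * T).

Let sigma0 : sigma 0 = 1.
Proof.
have := @kappaK _ _ _ _ eps0 mlambda lambda_bounds 1.
by rewrite (kappa1 eps0 mlambda lambda_bounds); apply; rewrite ler01 lexx.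
Qed.

Let sigma_sub (r : R) : 0 <= r <= 1 -> substitution (sigma r) 1 0 r kap (fun y => c y / T).
Proof.
move=> r01; have [/andP[s0 s1] ks] := sigmaP r01.
have := kappa_substitution eps0 mlambda lambda_bounds s0 s1 (lexx 1).
by rewrite ks (kappa1 eps0 mlambda lambda_bounds).
Qed.

(* [G t] is [lambda0 x(., t T)] read along the coordinate [kappa]. *)
Let G (t r : R) : R := lambda (sigma r) * g (sigma r) (t * T).

Let GL (t : R) : 0 <= t -> L2fun `[0, 1] (G t).
Proof.
move=> t0; apply: (L2fun_kappa_inv eps0 mlambda lambda_bounds
  (g := fun y => lambda y * g y (t * T))).
apply: (@L2fun_boundedM _ _ _ _ M) => //; first exact: measurable_funTS.
- by move=> y _; rewrite gtr0_norm//; have /andP[] := lambda_bounds y.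
- by apply: gL; rewrite mulr_ge0// ltW.
Qed.

Let QE (r t : R) : 0 <= r <= 1 -> 0 <= t -> \int[mu]_(q in `[0, r]) G t q = Q r t.
Proof.
move=> r01 t0; have /andP[r0 r1] := r01; have [/andP[s0 s1] _] := sigmaP r01.
have Gi := L2fun_integrable (measurable_itv _) (lebesgue_itv_lty _ _) (GL t0).
rewrite (substitution_Rintegral (sigma_sub r01) (integrable_subitv (lexx 0) r1 Gi)).
rewrite /Q /A -RintegralZl//; last by apply: gi => //; rewrite mulr_ge0// ltW.
apply: eq_Rintegral => y /[!inE]/=; rewrite in_itv/= => /andP[sy y1].
rewrite /G (kappaK eps0 mlambda lambda_bounds); last by rewrite (le_trans s0 sy).
by rewrite mulrA (mulrAC _ T^-1) mulVf ?mul1r// gt_eqF.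
Qed.

Let Q_cont (t : R) : 0 <= t -> cont_on 0 1 (Q^~ t).
Proof.
move=> t0; have Gi := L2fun_integrable (measurable_itv _) (lebesgue_itv_lty _ _) (GL t0).
by apply: eq_cont_on (primitive_cont ler01 Gi) => r r01; exact: QE.
Qed.

Let Q_time (t e : R) : 0 <= t -> 0 < e -> exists2 d : R, 0 < d &
  forall s : R, 0 <= s -> `|s - t| < d ->
    forall r : R, 0 <= r <= 1 -> `|Q r s - Q r t| <= e.
Proof.
move=> t0 e0; have tT : 0 <= t * T by rewrite mulr_ge0// ltW.
have [d d0 h] := tail_time_cont tT (mulr_gt0 T0 e0).
exists (d / T); first by rewrite divr_gt0.
move=> s s0 st r r01; have [s01 _] := sigmaP r01.
rewrite /Q -mulrBr normrM gtr0_norm ?invr_gt0// ler_pdivrMl//.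
apply: h => //; first by rewrite mulr_ge0// ltW.
by rewrite -mulrBl normrM (gtr0_norm T0) -ltr_pdivlMr.
Qed.

(** The existential stands before 0 <= t, so that choice yields a function [alpha] on all of R. *)
Let Q_eq (t : R) : exists a : R, 0 <= t -> forall r : R, 0 <= r <= 1 ->
  \int[mu]_(s in `[0, t]) Q r s =
  r * a + \int[mu]_(rho in `[0, r]) (Q rho t - Q rho 0).
Proof.
have [t0|tN] := leP 0 t; last by exists 0.
have tT : 0 <= t * T by rewrite mulr_ge0// ltW.
have [w [I [IL wI wE IE]]] := gm tT.
(* w 1 is the flux through zeta = 1 integrated over [0, t T]; the division by T measures time in
   units of T. *)
exists (w 1 / T) => _ r r01; have [s01 _] := sigmaP r01.
have /andP[r0 r1] := r01; have /andP[s0 s1] := s01.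
have Qd : mu.-integrable `[0, r] (EFin \o (fun rho => Q rho t - Q rho 0)).
  apply: integrable_subitv (lexx 0) r1 _.
  by apply: integrableBR => //; apply: cont_on_integrable; exact: Q_cont.
have wQ (rho : R) : 0 <= rho <= 1 -> w (sigma rho) = w 1 + T * (Q rho t - Q rho 0).
  move=> rho01; have [s'01 _] := sigmaP rho01; rewrite wE// /Q /A mul0r.
  by rewrite -mulrBr mulrA divff ?gt_eqF// mul1r.
have wsi : mu.-integrable `[0, r] (EFin \o (fun rho => w (sigma rho))).
  apply: (eq_integrableR (f := fun rho => w 1 + T * (Q rho t - Q rho 0))) => //.
    move=> rho /=; rewrite in_itv/= => /andP[h0 h1].
    by rewrite wQ// h0 (le_trans h1).
  apply: integrableDR => //; last exact: integrableZR.
  exact: integrable_cstR (lebesgue_itv_lty _ _).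
have lhs : \int[mu]_(q in `[sigma r, 1]) I q = T * \int[mu]_(rho in `[0, r]) w (sigma rho).
  rewrite (substitution_Rintegral (sigma_sub r01) wsi).
  have := substitution_integrable (sigma_sub r01) wsi.
  move=> H; rewrite -RintegralZl//; apply: ae_eq_Rintegral => //.
  - apply: integrable_measurable; apply: integrable_subitv s0 (lexx 1) _.
    exact: L2fun_integrable (lebesgue_itv_lty _ _) IL.
  - by apply: integrable_measurable; exact: integrableZR H.
  - have sub : `[sigma r, 1] `<=` `[(0 : R), 1] by apply: subset_itvr; rewrite bnd_simp.
    apply: ae_onS (ae_on_subset sub wI) => y /=; rewrite in_itv/= => /andP[sy y1] wy.
    rewrite (kappaK eps0 mlambda lambda_bounds) ?(le_trans s0 sy)//.
    by rewrite wy mulrA (mulrCA T) divff ?gt_eqF// mulr1 mulrA mulVf ?mul1r// gt_eqF.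
(* One factor T comes from the time scaling and one from the definition of [Q]. Together with [lhs]
   and [wint] this gives the desired equation multiplied by T ^+ 2. *)
have rhs : \int[mu]_(s in `[0, t * T]) A (sigma r) s =
    T ^+ 2 * \int[mu]_(s in `[0, t]) Q r s.
  have sub := affine_substitution 0 t0 T0; rewrite mulr0 !addr0 (mulrC T t) in sub.
  have Ac := cont_on_integrable (@A_cont _ (t * T) s01).
  have Qc : mu.-integrable `[0, t] (EFin \o (fun s => Q r s)).
    apply: integrableZR => //; apply: cont_on_integrable.
    move=> s /andP[h0 h1] e e0; have [d d0 h] := tail_time_cont (mulr_ge0 h0 (ltW T0)) e0.
    exists (d / T) => [|s' /andP[h0' _] ss]; first by rewrite divr_gt0.
    apply: h => //; first by rewrite mulr_ge0// ltW.
    by rewrite -mulrBl normrM (gtr0_norm T0) -ltr_pdivlMr.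
  rewrite (substitution_Rintegral sub Ac) -RintegralZl//.
  apply: eq_Rintegral => s _; rewrite /Q addr0 (mulrC T s) expr2.
  by field; rewrite gt_eqF.
have wint : \int[mu]_(rho in `[0, r]) w (sigma rho) =
    r * w 1 + T * \int[mu]_(rho in `[0, r]) (Q rho t - Q rho 0).
  transitivity (\int[mu]_(rho in `[0, r]) (w 1 + T * (Q rho t - Q rho 0))).
    apply: eq_Rintegral => rho /[!inE]/=; rewrite in_itv/= => /andP[h0 h1].
    by rewrite wQ// h0 (le_trans h1).
  rewrite RintegralD//; last 2 first.
  - exact: integrable_cstR (lebesgue_itv_lty _ _).
  - exact: integrableZR.
  by rewrite Rintegral_itv_cst// subr0 (mulrC _ r) RintegralZl.
have := IE _ s01; rewrite -/(A _ _) lhs wint => E.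
have {}E := etrans (esym rhs) (esym E).
set X := \int[mu]_(s in `[0, t]) Q r s in E *.
set Y := \int[mu]_(rho in `[0, r]) (Q rho t - Q rho 0) in E *.
have TN : T != 0 by rewrite gt_eqF.
have -> : X = T ^- 2 * (T ^+ 2 * X) by rewrite mulrA mulVf ?mul1r// expf_neq0.
by rewrite E; field.
Qed.

Lemma transport_representation : exists2 f : R -> R, (forall B, L2fun `[0, B] f) &
  forall t : R, 0 <= t ->
    ae_on `[0, 1] (fun y => f (kap y + T^-1 * t) = lambda y * g y t).
Proof.
have [alpha alphaP] := choice Q_eq.
have QA : forall r t : R, 0 <= r <= 1 -> 0 <= t -> Q r t = alpha (r + t) - alpha t.
  apply: transport_uniqueness.
  - exact: Q_cont.
  - by move=> t t0 e e0; exact: Q_time.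
  - by move=> t t0; rewrite /Q sigma0 /A set_itv1 Rintegral_set1 mulr0.
  - by move=> r t r01 t0; exact: alphaP.
(* f uses the states at integer multiples of T only. Its primitive equals alpha up to a constant, at
   the integers by induction and in between by [piece]; this pins down the states at all other
   times. *)
pose f := glue (fun j => G j%:R).
have fL B : L2fun `[0, B] f by apply: L2fun_glue => j; exact: GL.
have fi (a b : R) : 0 <= a -> mu.-integrable `[a, b] (EFin \o f).
  move=> a0; have := L2fun_integrable (measurable_itv `[0, b]) (lebesgue_itv_lty _ _) (fL b).
  exact: integrable_subitv.
have shift (a r : R) : 0 <= a -> 0 <= r ->
    mu.-integrable `[0, r] (EFin \o (fun y => f (y + a))) /\
    \int[mu]_(y in `[a, a + r]) f y = \int[mu]_(y in `[0, r]) f (y + a).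
  move=> a0 r0; have sub := shift_substitution a r0; rewrite add0r (addrC r a) in sub.
  have fai := fi a (a + r) a0; split.
    apply: eq_integrableR (substitution_integrable sub fai) => // y _.
    by rewrite mul1r.
  by rewrite (substitution_Rintegral sub fai); apply: eq_Rintegral => y _; rewrite mul1r.
have piece (j : nat) (r : R) : 0 <= r <= 1 ->
    \int[mu]_(y in `[j%:R, j%:R + r]) f y = Q r j%:R.
  move=> r01; have /andP[r0 r1] := r01; have [si ->] := shift _ _ (ler0n _ j) r0.
  rewrite -QE//; apply: ae_eq_Rintegral => //.
  - exact: integrable_measurable si.
  - have := L2fun_integrable (measurable_itv _) (lebesgue_itv_lty _ _) (GL (ler0n R j)).
    by move=> /(integrable_subitv (lexx 0) r1)/integrable_measurable.
  - have sub : `[0, r] `<=` `[(0 : R), 1] by apply: subset_itvl; rewrite bnd_simp.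
    apply: ae_onS (ae_on_subset sub (glue_ae (fun j => G j%:R) j)) => y _ /= ->.
    by rewrite addrC.
pose Phi (s : R) : R := \int[mu]_(y in `[0, s]) f y.
have PhiD (a r : R) : 0 <= a -> 0 <= r ->
    Phi (a + r) = Phi a + \int[mu]_(y in `[a, a + r]) f y.
  move=> a0 r0; rewrite /Phi (@Rintegral_itv_cat _ 0 a)//; first by rewrite lerDl.
  exact: fi.
have PhiN (j : nat) : Phi j%:R = alpha j%:R - alpha 0.
  elim: j => [|j ih]; first by rewrite /Phi set_itv1 Rintegral_set1 subrr.
  rewrite -natr1 PhiD// ih piece ?ler01 ?lexx// QA ?ler01 ?lexx// (addrC 1).
  by ring.
have PhiE (s : R) : 0 <= s -> Phi s = alpha s - alpha 0.
  move=> s0; have /andP[j0 j1] := truncn_itv s0.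
  have r01 : 0 <= s - (Num.truncn s)%:R <= 1.
    by rewrite subr_ge0 j0/= lerBlDr addrC natr1 ltW.
  have /andP[r0 _] := r01.
  rewrite -{1}(subrKC (Num.truncn s)%:R s) PhiD// PhiN piece// QA// subrK.
  by ring.
exists f => // t t0; have tT : 0 <= T^-1 * t by rewrite mulr_ge0// invr_ge0 ltW.
(* Integrated over [0, r], both functions give alpha(r + t / T) - alpha(t / T). *)
have key : ae_on `[0, 1] (fun r => f (r + T^-1 * t) - G (T^-1 * t) r = 0).
  have GLi := L2fun_integrable (measurable_itv _) (lebesgue_itv_lty _ _) (GL tT).
  apply: primitive_eq0_ae.
    by apply: integrableBR => //; exact: (shift _ _ tT ler01).1.
  move=> r r01; have /andP[r0 r1] := r01; have [si sE] := shift _ _ tT r0.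
  rewrite RintegralB//; last exact: integrable_subitv (lexx 0) r1 GLi.
  rewrite -sE QE// QA//.
  have := PhiD _ _ tT r0; rewrite !PhiE ?addr_ge0// => H.
  rewrite (addrC r); set X := \int[mu]_(y in _) f y in H *.
  by lra.
have := (ae_on_kappa eps0 mlambda lambda_bounds _).2 key.
apply: ae_onS => y /=; rewrite in_itv/= => y01 /eqP; rewrite subr_eq0 => /eqP ->.
rewrite /G (kappaK eps0 mlambda lambda_bounds)//.
by rewrite mulrAC mulVf ?mul1r// gt_eqF.
Qed.

End ScalarRepresentation.

Section MildRepresentation.
Context {R : realType}.
Local Notation mu := (@lebesgue_measure R).
Variables (lambda : R -> R) (eps M : R).
Hypotheses (eps0 : 0 < eps) (mlambda : measurable_fun setT lambda).
Hypothesis lambda_bounds : forall x, eps <= lambda x <= M.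
Local Notation T := (tau lambda 1).
Local Notation kap := (kappa lambda).
Let T0 : 0 < T := tau1_gt0 eps0 mlambda lambda_bounds.

(** Pairing with this test function turns the Pettis integral into the tail integrals of a single
    component, the form used in [transport_representation]. *)
Lemma ipX_tail n (y : R) (i : 'I_n) (h : R -> 'cV[R]_n) : 0 <= y ->
  ipX (fun q => \1_`[y, 1] q *: delta_mx i 0) h = \int[mu]_(q in `[y, 1]) h q i 0.
Proof.
move=> y0; rewrite /ipX [RHS]Rintegral_mkcond.
have -> : (fun q => h q i 0) \_ `[y, 1] = ((fun q => h q i 0) \_ `[y, 1]) \_ `[0, 1].
  by rewrite -patch_setI setIidr//; apply: subset_itvr; rewrite bnd_simp.
rewrite -Rintegral_mkcond; apply: eq_Rintegral => q _.
rewrite (bigD1 i)//= big1 => [|j ji]; last first.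
  by rewrite !mxE (negbTE ji) mulr0 mul0r.
by rewrite !mxE !eqxx addr0 mulr1 indicE patchE; case: ifP => _; rewrite ?mul1r ?mul0r.
Qed.

Lemma L2on_tail n (y : R) (i : 'I_n) :
  L2on `[0, 1] (fun q : R => \1_`[y, 1] q *: delta_mx i 0 : 'cV[R]_n).
Proof.
move=> j; apply: (L2fun_eq (f := fun q => \1_`[y, 1] q * (delta_mx i 0 : 'cV[R]_n) j 0)).
  by move=> q _; rewrite [RHS]mxE.
apply: (@L2fun_boundedM _ _ _ _ 1) => //.
- by move=> q _; rewrite indicE; case: (_ \in _); rewrite ?normr1 ?normr0.
- exact: L2fun_cst (lebesgue_itv_lty _ _).
Qed.

Variables (n : nat) (x : R -> R -> 'cV[R]_n).
Hypotheses (xX : state_in_X x) (xc : continuous_in_X x).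
Hypothesis xm : forall t : R, 0 <= t -> exists I w v : R -> 'cV[R]_n,
  [/\ integral_in_X x t I,
      H1_with_deriv w v /\
        ae_on `[0, 1] (fun zeta => w zeta = lambda zeta *: I zeta) &
      ae_on `[0, 1] (fun zeta => x zeta t - x zeta 0 = - v zeta)].

Lemma mild_transport : exists2 f : R -> 'cV[R]_n, L2loc f &
  forall t : R, 0 <= t -> ae_on `[0, 1] (fun zeta =>
    f (kap zeta + T^-1 * t) = lambda zeta *: x zeta t).
Proof.
have xi i s : 0 <= s -> L2fun `[0, 1] (fun y => x y s i 0) by move=> s0; exact: xX.
have xint i (s a : R) : 0 <= s -> 0 <= a ->
    mu.-integrable `[a, 1] (EFin \o (fun y => x y s i 0)).
  move=> s0 a0; have := L2fun_integrable (measurable_itv _) (lebesgue_itv_lty _ _) (xi i s s0).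
  exact: integrable_subitv.
have /choice[f fP] : forall i, exists f : R -> R, (forall B, L2fun `[0, B] f) /\
    forall t : R, 0 <= t ->
      ae_on `[0, 1] (fun y => f (kap y + T^-1 * t) = lambda y * x y t i 0).
  move=> i.
  have [|t t0 e e0|t t0|f fL fx] := @transport_representation R lambda eps M eps0 mlambda
      lambda_bounds (fun y s => x y s i 0).
  - by move=> s s0; exact: xi.
  - have /cvgrPdist_le/(_ _ e0)/nbhs_ballP[d /= d0 hd] := xc t0.
    exists d => // s s0 st; have := hd s; rewrite /= -ball_normE/= distrC => /(_ st s0).
    rewrite add0r normrN; apply: le_trans; apply: le_trans (ler_norm _).
    have DL : L2on `[0, 1] (fun y => x y s - x y t) by apply: L2on_sub => //; exact: xX.
    (* The other components contribute nonnegative terms to the squared distance. *)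
    rewrite ipX_sum// (bigD1 i)//= -[leLHS]addr0; apply: lerD.
      rewrite le_eqVlt; apply/orP; left; apply/eqP; apply: eq_Rintegral => y _.
      by rewrite !mxE expr2.
    by apply: sumr_ge0 => j _; apply: Rintegral_ge0 => y _; rewrite -expr2 sqr_ge0.
  - have [I [w [v [[IL Ieq] [[vL wv] wI] xv]]]] := xm t0.
    exists (fun y => w y i 0), (fun y => I y i 0); split.
    + exact: IL.
    + by apply: ae_onS wI => y _ ->; rewrite mxE.
    + move=> y y01; have /andP[y0 y1] := y01.
      have vi := L2fun_integrable (measurable_itv _) (lebesgue_itv_lty _ _) (vL i).
      rewrite (wv y) ?in_itv//= (wv 1) ?in_itv/= ?ler01 ?lexx// !mxE (@Rintegral_itv_cat _ 0 y 1)//.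
      rewrite -RintegralB//; [|exact: xint|exact: xint].
      have -> : \int[mu]_(q in `[y, 1]) (x q t i 0 - x q 0 i 0) =
          - \int[mu]_(q in `[y, 1]) v q i 0.
        rewrite -mulN1r -RintegralZl//; last exact: integrable_subitv vi.
        have sub : `[y, 1] `<=` `[(0 : R), 1] by apply: subset_itvr; rewrite bnd_simp.
        apply: ae_eq_Rintegral => //.
        * by apply: integrable_measurable; apply: integrableBR => //; exact: xint.
        * apply: integrable_measurable; apply: integrableZR => //.
          exact: integrable_subitv vi.
        * apply: ae_onS (ae_on_subset sub xv) => q _ /colP/(_ i).
          by rewrite !mxE mulN1r.
      by rewrite addrA addrK.
    + move=> y /andP[y0 _]; rewrite -ipX_tail// Ieq; last exact: L2on_tail.
      by apply: eq_Rintegral => s _; rewrite ipX_tail.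
  - by exists f.
exists (fun r => \col_i f i r).
  move=> B B0 i; apply: (L2fun_eq (f := f i)); first by move=> r _; rewrite mxE.
  exact: (fP i).1.
move=> t t0; have := ae_on_forall (fun i => (fP i).2 t t0).
by apply: ae_onS => y _ h; apply/colP => i; rewrite !mxE h.
Qed.

End MildRepresentation.

(** * Bounded representatives of the coefficient *)

Section Coefficient.
Context {R : realType}.
Local Notation mu := (@lebesgue_measure R).

(** The inverse is h times (h^2)^-1, a real power of a nonnegative base; where h vanishes, both
    expressions are 0. *)
Lemma measurable_funV (D : set R) (h : R -> R) : measurable D ->
  measurable_fun D h -> measurable_fun D (fun x => (h x)^-1).
Proof.
move=> mD mh; rewrite (_ : (fun x => _) = (fun x => h x * (h x ^+ 2) `^ (-1))).
  apply: measurable_funM => //; apply: (measurableT_comp (measurable_powR _)).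
  exact: measurable_funX.
apply/funext => x; rewrite powR_inv1 ?sqr_ge0// expr2.
by have [->|h0] := eqVneq (h x) 0; rewrite ?invr0 ?mul0r// invfM mulrA divff// mul1r.
Qed.

Lemma Linfty_bounded (D : set R) (h : R -> R) : measurable D -> Linfty_on D h ->
  measurable_fun setT (h \_ D) /\ exists M : R, ae_on D (fun x => `|h x| <= M).
Proof.
move=> mD; rewrite /Linfty_on inE => /andP[/[!inE]/= mh hN]; split => //.
(* The norm unfolds to an essential supremum once the space is known to have positive measure. *)
have mu0 : (0 < mu setT)%E.
  apply: (@lt_le_trans _ _ (mu `[0, 1])).
    by rewrite lebesgue_measure_itv/= lte_fin ltr01 sube0 lte_fin.
  by apply: le_measure; rewrite ?inE.
move: hN; rewrite /finite_norm unlock /Lnorm mu0.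
move=> /(@ess_sup_inf.ess_supr_bounded _ _ _ mu (fun x => `|(h \_ D) x|))[M hM].
exists M; apply: (@filterS _ _ (ae_filter_ringOfSetsType mu)) hM => x /= + Dx.
by rewrite patchE mem_set.
Qed.

(* [lambda0] is bounded, and bounded below, only almost everywhere on [0, 1]; it
   is replaced by a representative that is measurable and bounded on R. *)
Definition same_coefficient (l1 l2 : R -> R) : Prop :=
  ae_on `[0, 1] (fun zeta => l1 zeta = l2 zeta) /\
  (forall zeta : R, 0 <= zeta <= 1 -> tau l1 zeta = tau l2 zeta).

Lemma same_coefficientC l1 l2 : same_coefficient l1 l2 -> same_coefficient l2 l1.
Proof.
by move=> [l12 t12]; split=> [|z z01]; [apply: ae_onS l12 => z _ ->|rewrite t12].
Qed.

Lemma bounded_representative (lambda : R -> R) (eps : R) : 0 < eps ->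
  Linfty_on `[0, 1] lambda -> ae_on `[0, 1] (fun zeta => eps <= lambda zeta) ->
  exists (l : R -> R) (M : R), [/\ measurable_fun setT l,
    forall zeta, eps <= l zeta <= M & same_coefficient lambda l].
Proof.
move=> eps0 lL le_l; have mI (a : R) : measurable `[(0 : R), a] by [].
have [ml [M lM]] := Linfty_bounded (mI 1) lL.
(* The upper clamp max eps M is at least eps by construction; where eps <= lambda <= M the clamping
   changes nothing. *)
pose l (zeta : R) : R := Num.max eps (Num.min (Num.max eps M) ((lambda \_ `[0, 1]) zeta)).
have mll : measurable_fun setT l.
  by apply: measurable_maxr => //; apply: measurable_minr.
have ll : ae_on `[0, 1] (fun zeta => lambda zeta = l zeta).
  apply: ae_onS (ae_onI le_l lM) => z z01 [h1 h2]; rewrite /l patchE mem_set//.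
  have hM : lambda z <= Num.max eps M by rewrite le_max (le_trans (ler_norm _) h2) orbT.
  by rewrite (min_r hM) (max_r h1).
exists l, (Num.max eps M); split => //.
  move=> z; rewrite /l le_max lexx/= ge_max ge_min !lexx andbT.
  by rewrite le_max lexx.
split => // z /andP[z0 z1].
have sub : `[0, z] `<=` `[(0 : R), 1] by apply: subset_itvl; rewrite bnd_simp.
apply: ae_eq_Rintegral => //.
- apply: measurable_funV => //; apply: measurable_funS sub _ => //.
  exact: (measurable_restrictT _ _).2 ml.
- by apply: measurable_funV => //; exact: measurable_funTS.
- by apply: ae_onS (ae_on_subset sub ll) => y _ ->.
Qed.

Lemma same_kappa l1 l2 : same_coefficient l1 l2 ->
  forall zeta : R, 0 <= zeta <= 1 -> kappa l1 zeta = kappa l2 zeta.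
Proof. by move=> [_ tt] z z01; rewrite /kappa !tt// ler01 lexx. Qed.

Lemma same_dt_initial l1 l2 n (x0 : R -> 'cV[R]_n) xd : same_coefficient l1 l2 ->
  dt_initial l1 x0 xd -> dt_initial l2 x0 xd.
Proof.
move=> l12 h; apply: ae_onS (ae_onI h l12.1) => z /=; rewrite in_itv/= => z01 [e <-].
by rewrite -(same_kappa l12 z01).
Qed.

Lemma same_related l1 l2 n p k m l x d u z y f
  (xd : nat -> R -> 'cV[R]_n) (dd : nat -> R -> 'cV[R]_k)
  (ud : nat -> R -> 'cV[R]_p) (zd : nat -> R -> 'cV[R]_l) (yd : nat -> R -> 'cV[R]_m) :
  same_coefficient l1 l2 ->
  related l1 x d u z y f xd dd ud zd yd -> related l2 x d u z y f xd dd ud zd yd.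
Proof.
move=> l12; have [ll tt] := l12.
have TE : tau l1 1 = tau l2 1 by rewrite tt// ler01 lexx.
rewrite /related TE => -[fL fx fxd sdu szy]; split => // t t0.
apply: ae_onS (ae_onI (fx t t0) ll) => q /=; rewrite in_itv/= => q01 [e <-].
by rewrite -(same_kappa l12 q01).
Qed.

Lemma same_ct_system l1 l2 n p k m l (E : 'M[R]_(n, k)) (K L : 'M[R]_n)
    (Ky Ly : 'M[R]_(m, n)) (Kz Lz : 'M[R]_(l, n)) (x0 : R -> 'cV[R]_n)
    x d (u : R -> 'cV[R]_p) z y :
  same_coefficient l1 l2 ->
  ct_system l1 E K L Ky Ly Kz Lz x0 x d u z y ->
  ct_system l2 E K L Ky Ly Kz Lz x0 x d u z y.
Proof.
move=> [ll _] [xc ct0 H]; split => // t t0.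
have [I [w [v [xI [wv wI] xv bd bzy]]]] := H t t0; exists I, w, v; split => //.
by split => //; apply: ae_onS (ae_onI wI ll) => q _ [e <-].
Qed.

End Coefficient.

(** * Sampling continuous-time variables; the initial conditions *)

Section Sampling.
Context {R : realType}.

Lemma L2on_piece n (v : R -> 'cV[R]_n) (j : nat) :
  L2loc v -> L2on `[0, 1] (fun zeta => v (j%:R + zeta)).
Proof. by move=> vL; apply: L2loc_shift. Qed.

Variables (lambda : R -> R) (eps M : R).
Hypotheses (eps0 : 0 < eps) (mlambda : measurable_fun setT lambda).
Hypothesis lambda_bounds : forall x, eps <= lambda x <= M.
Local Notation T := (tau lambda 1).
Let T0 : 0 < T := tau1_gt0 eps0 mlambda lambda_bounds.

Lemma related_from_continuous n p k m l x (d : R -> 'cV[R]_k) (u : R -> 'cV[R]_p)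
    (z : R -> 'cV[R]_l) (y : R -> 'cV[R]_m) (f : R -> 'cV[R]_n) :
  ct_variables x d u z y -> L2loc f ->
  (forall t : R, 0 <= t -> ae_on `[0, 1] (fun zeta =>
    f (kappa lambda zeta + T^-1 * t) = lambda zeta *: x zeta t)) ->
  exists xd dd ud zd yd,
    [/\ dt_variables xd dd ud zd yd, related lambda x d u z y f xd dd ud zd yd &
        xd 0%N = f].
Proof.
move=> [xX dL uL zL yL] fL fx.
have samp q (v : R -> 'cV[R]_q) :
    sampled T (fun j zeta => v ((j%:R + zeta) * T)) v by move=> j; exact: ae_on_T.
exists (fun j zeta => f (j%:R + zeta)), (fun j zeta => d ((j%:R + zeta) * T)),
  (fun j zeta => u ((j%:R + zeta) * T)), (fun j zeta => z ((j%:R + zeta) * T)),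
  (fun j zeta => y ((j%:R + zeta) * T)); split.
- by move=> j; split; do ?[exact: L2on_piece |
    by apply: (L2on_piece (v := fun r => _ (r * T))); exact: L2loc_time_scale].
- by split => // j _; exact: ae_on_T.
- by apply/funext => r; rewrite add0r.
Qed.

(** At time 0 the transport formula gives f(kappa zeta) = lambda(zeta) x0(zeta), which is what the
    discrete initial condition says of xd 0; null sets can be carried through [kappa] in both
    directions. *)
Lemma related_initial n p k m l x (d : R -> 'cV[R]_k) (u : R -> 'cV[R]_p)
    (z : R -> 'cV[R]_l) (y : R -> 'cV[R]_m) (f : R -> 'cV[R]_n) x0 xd dd ud zd yd :
  related lambda x d u z y f xd dd ud zd yd -> ct_initial x0 x ->
  dt_initial lambda x0 xd <-> ae_on `[0, 1] (fun zeta => xd 0%N zeta = f zeta).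
Proof.
move=> [fL fx _ _ _] ct0.
have f0 : ae_on `[0, 1] (fun zeta => f (kappa lambda zeta) = lambda zeta *: x0 zeta).
  by apply: ae_onS (ae_onI (fx 0 (lexx 0)) ct0) => q _; rewrite mulr0 addr0 => -[-> ->].
split=> [dt0|xd0].
  apply/(ae_on_kappa eps0 mlambda lambda_bounds).
  by apply: ae_onS (ae_onI f0 dt0) => q _ [-> ->].
have := (ae_on_kappa eps0 mlambda lambda_bounds _).2 xd0 => H.
by apply: ae_onS (ae_onI f0 H) => q _ [<- ->].
Qed.

End Sampling.

Theorem lemma1 (R : realType) (n p k m l : nat) (hpn : (p <= n)%N)
  (lambda0 : R -> R) (epsilon : R)
  (hlambda0 : Linfty_on `[0, 1] lambda0)
  (hepsilon : 0 < epsilon)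
  (hlambda0_ge : ae_on `[0, 1] (fun zeta => epsilon <= lambda0 zeta))
  (E : 'M[R]_(n, k)) (K L : 'M[R]_n) (Ky Ly : 'M[R]_(m, n))
  (Kz Lz : 'M[R]_(l, n)) (x0 : R -> 'cV[R]_n)
  (hx0 : L2on `[0, 1] x0) (hK : K \in unitmx) :
  let Ad := - (invmx K *m L) in
  let B1d := - (invmx K *m E) in
  let B2d := - (invmx K *m lower_id n p) in
  let C1d := Kz *m invmx K *m L - Lz in
  let C2d := Ky *m invmx K *m L - Ly in
  let D11d := Kz *m invmx K *m E in
  let D12d := Kz *m invmx K *m lower_id n p in
  let D21d := Ky *m invmx K *m E in
  let D22d := Ky *m invmx K *m lower_id n p in
  let continuous_system x d u z y :=
    ct_system lambda0 E K L Ky Ly Kz Lz x0 x d u z y in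
  let discrete_system xd dd ud zd yd :=
    dt_system lambda0 Ad B1d B2d C1d C2d D11d D12d D21d D22d x0
      xd dd ud zd yd in
  (* Related variables solve one system iff they solve the other. The relation
     between xd and f says nothing about xd 0, which is given by its initial
     condition; hence each initial condition appears on both sides. *)
  [/\ (forall x (d : R -> 'cV[R]_k) (u : R -> 'cV[R]_p) z y f xd dd ud zd yd,
         ct_variables x d u z y -> dt_variables xd dd ud zd yd ->
         related lambda0 x d u z y f xd dd ud zd yd ->
         (continuous_system x d u z y /\ dt_initial lambda0 x0 xd <->
          discrete_system xd dd ud zd yd /\ ct_initial x0 x)),
      (* every continuous-time solution has related discrete-time variables *)
      (forall x (d : R -> 'cV[R]_k) (u : R -> 'cV[R]_p) z y,
         ct_variables x d u z y -> continuous_system x d u z y ->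
         exists f xd dd ud zd yd,
           [/\ dt_variables xd dd ud zd yd,
               related lambda0 x d u z y f xd dd ud zd yd &
               discrete_system xd dd ud zd yd]) &
      (* and conversely *)
      (forall xd (dd : nat -> R -> 'cV[R]_k) (ud : nat -> R -> 'cV[R]_p) zd yd,
         dt_variables xd dd ud zd yd -> discrete_system xd dd ud zd yd ->
         exists x d u z y f,
           [/\ ct_variables x d u z y,
               related lambda0 x d u z y f xd dd ud zd yd &
               continuous_system x d u z y])].
Proof.
have [lambda1 [M [mlambda lambdaB same]]] := bounded_representative hepsilon hlambda0 hlambda0_ge.
have same' := same_coefficientC same.
have systems x d u z y f xd dd ud zd yd :=
  @related_systems R lambda1 epsilon M hepsilon mlambda lambdaB n p k m l E K L Ky Ly Kz Lz x0 hK
    x d u z y f xd dd ud zd yd.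
move=> Ad B1d B2d C1d C2d D11d D12d D21d D22d continuous_system discrete_system.
split.
- move=> x d u z y f xd dd ud zd yd cv dv /(same_related same) rel.
  (* Each system contains one initial condition and the statement supplies the other; with both, xd
     0 is f on [0, 1]. *)
  have key : ct_initial x0 x -> dt_initial lambda0 x0 xd ->
      continuous_system x d u z y <-> discrete_system xd dd ud zd yd.
    move=> ct0 /(same_dt_initial same) dt0.
    have xd0 := (related_initial hepsilon mlambda lambdaB rel ct0).1 dt0.
    have [ctd dtc] := systems _ _ _ _ _ _ _ _ _ _ _ cv rel xd0 ct0 dt0.
    split=> [/(same_ct_system same) /ctd [_ h]|[_ h]].
      by split => //; exact: same_dt_initial dt0.
    by apply: (same_ct_system same'); apply: dtc.
  split=> -[sys ini].
    by have [_ ct0 _] := sys; split => //; exact/key.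
  by have [dt0 _] := sys; split => //; exact/key.
- move=> x d u z y cv /(same_ct_system same) sys; have [xc ct0 xm] := sys.
  (* Here f is extracted from the mild solution by uniqueness; the discrete-time variables are then
     its samples and those of the signals. *)
  have [|f fL fx] := mild_transport hepsilon mlambda lambdaB (let: And5 h _ _ _ _ := cv in h) xc.
    by move=> t t0; have [I [w [v [h1 h2 h3 _ _]]]] := xm t t0; exists I, w, v.
  have [xd [dd [ud [zd [yd [dv rel xd0]]]]]] := related_from_continuous hepsilon mlambda lambdaB cv fL fx.
  have xdf : ae_on `[0, 1] (fun zeta => xd 0%N zeta = f zeta).
    by rewrite xd0; exact: ae_on_T.
  have dt0 := (related_initial hepsilon mlambda lambdaB rel ct0).2 xdf.
  have [_ h] := (systems _ _ _ _ _ _ _ _ _ _ _ cv rel xdf ct0 dt0).1 sys.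
  exists f, xd, dd, ud, zd, yd; split => //; first exact: same_related rel.
  by split => //; exact: same_dt_initial dt0.
- move=> xd dd ud zd yd dv [/(same_dt_initial same) dt0 h].
  have [x [d [u [z [y [f [cv rel xd0 ct0]]]]]]] :=
    related_from_discrete hepsilon mlambda lambdaB dv dt0.
  exists x, d, u, z, y, f; split => //; first exact: same_related rel.
  apply: (same_ct_system same').
  exact: (systems _ _ _ _ _ _ _ _ _ _ _ cv rel xd0 ct0 dt0).2 (conj dt0 h).
Qed.
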